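(* Let $k$ be a commutative ring with identity and let $R$ be an associative $k$-algebra with identity which is finitely generated as a left $k$-module, equipped with a $k$-linear involution, and let $(R,\Lambda)$ be a form ring. Let $\mathrm{G}(2n,\cdot,\cdot)$ and $\mathrm{E}(2n,\cdot,\cdot)$ denote either the general quadratic group $\mathrm{GQ}$ and its elementary subgroup $\mathrm{EQ}$, with $n\ge3$, or the general Hermitian group $\mathrm{GH}$ and its elementary subgroup $\mathrm{EH}$ of the elements $a_1,\dots,a_r$, with $n\ge r+3$. Then the following are equivalent: 1. (Normality) $\mathrm{E}(2n,R,\Lambda)$ is a normal subgroup of $\mathrm{G}(2n,R,\Lambda)$. 2. (Local-Global Principle) If $\alpha(X)\in \mathrm{G}(2n,R[X],\Lambda[X])$, $\alpha(0)=\mathrm{I}_{2n}$ and $\alpha_{\mathfrak m}(X)\in\mathrm{E}(2n,R_{\mathfrak m}[X],\Lambda_{\mathfrak m}[X])$ for every maximal ideal $\mathfrak m$ of $k$, then $\alpha(X)\in\mathrm{E}(2n,R[X],\Lambda[X])$. Here $R_{\mathfrak m}=S^{-1}R$ with $S=k\setminus\mathfrak m$, and $\alpha_{\mathfrak m}(X)$ is the image of $\alpha(X)$ over $R_{\mathfrak m}[X]$.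
   Context: **Form rings.** $R$ is an associative ring with identity with an involution $a\mapsto\bar a$ (additive, $\overline{ab}=\bar b\,\bar a$, $\bar{\bar a}=a$), and $\lambda$ is a fixed element of the center $C(R)$ with $\lambda\bar\lambda=1$. Put $\Lambda_{\max}=\{a\in R: a=-\lambda\bar a\}$ and $\Lambda_{\min}=\{a-\lambda\bar a: a\in R\}$. A ($\lambda$-)form parameter is an additive subgroup $\Lambda$ of $R$ with $\Lambda_{\min}\subseteq\Lambda\subseteq\Lambda_{\max}$ and $\bar x\Lambda x\subseteq\Lambda$ for all $x\in R$; $(R,\Lambda)$ is then called a form ring. The involution extends to $R[X]$ by $\bar X=X$ and to localizations at central multiplicative sets fixed elementwise by the involution. $\Lambda[X]$ is the smallest form parameter on $R[X]$ containing $\Lambda$; $\Lambda_{\mathfrak m}$ is the form parameter on $R_{\mathfrak m}$ induced by $\Lambda$ (the smallest one containing the image of $\Lambda$). **Notation.** For a matrix $M=(m_{ij})$, $\bar M=(\bar m_{ij})^t$ (conjugate transpose). $\rho(i)=n+i$ for $1\le i\le n$; $e_{ij}$ is the matrix unit. **Quadratic case.** $\psi_n=\begin{pmatrix}0&\lambda \mathrm{I}_n\\ \mathrm{I}_n&0\end{pmatrix}$. $\mathrm{GQ}(2n,R,\Lambda)$ is the group of all $\sigma=\begin{pmatrix}\alpha&\beta\\ \gamma&\delta\end{pmatrix}\in \mathrm{GL}_{2n}(R)$ ($n\times n$ blocks) with $\bar\sigma\psi_n\sigma=\psi_n$ and with all diagonal entries of $\bar\gamma\alpha$ and $\bar\delta\beta$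 in $\Lambda$ (i.e. $\sigma$ preserves the Hermitian form and the associated $\Lambda$-quadratic form). $\mathrm{EQ}(2n,R,\Lambda)$ is the subgroup generated by, for $1\le i,j\le n$: - $q\varepsilon_{ij}(a)=\mathrm{I}_{2n}+ae_{ij}-\bar a e_{\rho(j)\rho(i)}$ ($i\ne j$, $a\in R$); - $qr_{ij}(a)=\mathrm{I}_{2n}+ae_{i\rho(j)}-\lambda\bar a e_{j\rho(i)}$ ($i\neq j$, $a\in R$), $qr_{ii}(a)=\mathrm{I}_{2n}+ae_{i\rho(i)}$ ($a\in\Lambda$); - $ql_{ij}(a)=\mathrm{I}_{2n}+ae_{\rho(i)j}-\bar\lambda\bar a e_{\rho(j)i}$ ($i\ne j$, $a\in R$), $ql_{ii}(a)=\mathrm{I}_{2n}+ae_{\rho(i)i}$ ($\bar a\in\Lambda$). **Hermitian case.** Let $r\ge1$, $n>r$, and let $a_1,\dots,a_r\in\{c+\lambda\bar c: c\in R\}$ with $a_1=0$; let $A_1=\mathrm{diag}(a_1,\dots,a_r)$ and $A=A_1\perp 0_{n-r}$ ($n\times n$). $\psi^h_n=\begin{pmatrix}A&\lambda \mathrm{I}_n\\ \mathrm{I}_n&0\end{pmatrix}$ and $\mathrm{GH}(2n,R,a_1,\dots,a_r,\Lambda)=\{\sigma\in\mathrm{GL}_{2n}(R):\bar\sigma\psi^h_n\sigma=\psi^h_n\}$. Let $C=\{(x_1,\dots,x_r)^t\in R^r:\sum_i\bar x_ia_ix_i\in\{c+\lambda\bar c:c\in R\}\}$ (under the assumption on the $a_i$,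 $C=R^r$). For $\zeta=(x_1,\dots,x_r)^t\in C$, $\zeta_f\in R$ denotes any element with $\zeta_f+\lambda\bar\zeta_f=\sum_i\bar x_ia_ix_i$. $\mathrm{EH}(2n,R,a_1,\dots,a_r,\Lambda)$ is the subgroup generated by: - $h\varepsilon_{ij}(a)=\mathrm{I}_{2n}+ae_{ij}-\bar ae_{\rho(j)\rho(i)}$ ($r+1\le i\le n$, $1\le j\le n$, $i\ne j$, $a\in R$); - $hr_{ij}(a)=\mathrm{I}_{2n}+ae_{i\rho(j)}-\lambda\bar ae_{j\rho(i)}$ ($r+1\le i\neq j\le n$, $a\in R$), $hr_{ii}(a)=\mathrm{I}_{2n}+ae_{i\rho(i)}$ ($r+1\le i\le n$, $a\in\Lambda_{\max}$); - $hl_{ij}(a)=\mathrm{I}_{2n}+ae_{\rho(i)j}-\bar\lambda\bar ae_{\rho(j)i}$ ($1\le i\ne j\le n$, $a\in R$), $hl_{ii}(a)=\mathrm{I}_{2n}+ae_{\rho(i)i}$ ($1\le i\le n$, $\bar a\in\Lambda_{\max}$); - for $\zeta\in C$, $r+1\le i\le n$, in block sizes $r,n-r,r,n-r$: $$hm_i(\zeta)=\begin{pmatrix}\mathrm I_r&\alpha_{12}&0&0\\0&\mathrm I_{n-r}&0&0\\0&-\bar A_1\alpha_{12}&\mathrm I_r&0\\0&\gamma_{22}&-\bar\alpha_{12}&\mathrm I_{n-r}\end{pmatrix},\qquad hr_i(\zeta)=\begin{pmatrix}\mathrm I_r&0&0&\beta_{12}\\0&\mathrm I_{n-r}&-\lambda\bar\beta_{12}&\beta_{22}\\0&0&\mathrm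 I_r&-\bar A_1\beta_{12}\\0&0&0&\mathrm I_{n-r}\end{pmatrix},$$ where $\alpha_{12}$ (resp. $\beta_{12}$) is the $r\times(n-r)$ matrix with $(i-r)$-th column $\zeta$ and other columns $0$, $\gamma_{22}$ (resp. $\beta_{22}$) has $(i-r,i-r)$ entry $\bar\zeta_f$ (resp. $\lambda\bar\zeta_f$) and zeros elsewhere. Over $R[X]$ and $R_{\mathfrak m}[X]$ the Hermitian groups are taken with respect to (the images of) the same $a_1,\dots,a_r\in R$. *)

(* Defs.v *)
From HB Require Import structures.
From mathcomp Require Import all_boot all_order all_algebra.
From mathcomp Require Import generic_quotient ring_quotient.
From mathcomp Require Import boolp classical_sets.
From mathcomp Require Import ring.

Set Implicit Arguments.
Unset Strict Implicit.
Unset Printing Implicit Defensive.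

Import GRing.Theory.
Local Open Scope ring_scope.

Definition involution (R : pzRingType) (bar : R -> R) : Prop :=
  [/\ {morph bar : x y / x + y},
      forall x y, bar (x * y) = bar y * bar x
    & involutive bar].

Definition central (R : pzRingType) (z : R) : Prop :=
  forall x : R, z * x = x * z.

Section FormParameters.
Variables (R : pzRingType) (bar : R -> R) (lam : R).
Local Open Scope classical_set_scope.

Definition Lambda_max : set R := [set a | a = - (lam * bar a)].
Definition Lambda_min : set R := [set a | exists c, a = c - lam * bar c].

Definition form_parameter (L : set R) : Prop :=
  [/\ [/\ L 0, forall x y, L x -> L y -> L (x + y) & forall x, L x -> L (- x)],
      Lambda_min `<=` L,
      L `<=` Lambda_max
    & forall x a, L a -> L (bar x * a * x)].

(* The smallest form parameter containing A, for A included in Lambda_max. *)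
Definition form_parameter_gen (A : set R) : set R :=
  [set x | forall L, form_parameter L -> A `<=` L -> L x].

End FormParameters.

Definition ctmx (R : pzRingType) (bar : R -> R) p q (M : 'M[R]_(p, q)) :
  'M[R]_(q, p) := (map_mx bar M)^T.

Section MatrixGroups.
Variables (R : pzRingType) (N : nat).
Implicit Types s t : 'M[R]_N.

(* R need not be commutative, so that unitmx is not available. *)
Definition mx_inverse s t : Prop := s *m t = 1%:M /\ t *m s = 1%:M.

Definition GLmx : set 'M[R]_N := fun s => exists t, mx_inverse s t.

Inductive subgroup_gen (X : set 'M[R]_N) : set 'M[R]_N :=
| sgen_base s : X s -> subgroup_gen X s
| sgen_one : subgroup_gen X 1%:M
| sgen_mul s t : subgroup_gen X s -> subgroup_gen X t -> subgroup_gen X (s *m t)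
| sgen_inv s t : subgroup_gen X s -> mx_inverse s t -> subgroup_gen X t.

Definition is_subgroup (H : set 'M[R]_N) : Prop :=
  [/\ forall s, H s -> GLmx s,
      H 1%:M,
      forall s t, H s -> H t -> H (s *m t)
    & forall s t, H s -> mx_inverse s t -> H t].

Definition normal_subgroup (H G : set 'M[R]_N) : Prop :=
  [/\ is_subgroup H,
      forall s, H s -> G s
    & forall g g' s, G g -> mx_inverse g g' -> H s -> H (g *m s *m g')].

End MatrixGroups.

Section Quadratic.
Variables (R : pzRingType) (bar : R -> R) (lam : R) (Lam : set R) (n : nat).

Local Notation lo := (@lshift n n).
Local Notation rho := (@rshift n n).

Definition psiQ : 'M[R]_(n + n) := block_mx 0 lam%:M 1%:M 0.

Definition GQ : set 'M[R]_(n + n) := fun s =>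
  [/\ GLmx s,
      ctmx bar s *m psiQ *m s = psiQ,
      forall i, Lam ((ctmx bar (dlsubmx s) *m ulsubmx s) i i)
    & forall i, Lam ((ctmx bar (drsubmx s) *m ursubmx s) i i)].

Inductive EQ_gen : set 'M[R]_(n + n) :=
| q_eps (i j : 'I_n) (a : R) : i != j ->
    EQ_gen (1%:M + a *: delta_mx (lo i) (lo j)
                 - bar a *: delta_mx (rho j) (rho i))
| q_r (i j : 'I_n) (a : R) : i != j ->
    EQ_gen (1%:M + a *: delta_mx (lo i) (rho j)
                 - (lam * bar a) *: delta_mx (lo j) (rho i))
| q_rd (i : 'I_n) (a : R) : Lam a ->
    EQ_gen (1%:M + a *: delta_mx (lo i) (rho i))
| q_l (i j : 'I_n) (a : R) : i != j ->
    EQ_gen (1%:M + a *: delta_mx (rho i) (lo j)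
                 - (bar lam * bar a) *: delta_mx (rho j) (lo i))
| q_ld (i : 'I_n) (a : R) : Lam (bar a) ->
    EQ_gen (1%:M + a *: delta_mx (rho i) (lo i)).

Definition EQ : set 'M[R]_(n + n) := subgroup_gen EQ_gen.

End Quadratic.

(* The rank is n = r + s, so that matrices come in blocks of sizes r, s, r, s;
   the row vector a lists a_1, ..., a_r. Indices start at 0: "r <= i" below is
   the condition r + 1 <= i <= n of the 1-based numbering. The form parameter
   does not enter these groups: the diagonal generators use Lambda_max. *)
Section Hermitian.
Variables (R : pzRingType) (bar : R -> R) (lam : R) (r s : nat) (a : 'rV[R]_r).

Local Notation n := (r + s)%N.
Local Notation lo := (@lshift n n).
Local Notation rho := (@rshift n n).

Definition herm_trace : set R := fun b => exists c, b = c + lam * bar c.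

Definition A1mx : 'M[R]_r := diag_mx a.
Definition Amx : 'M[R]_n := block_mx A1mx 0 0 0.

Definition psiH : 'M[R]_(n + n) := block_mx Amx lam%:M 1%:M 0.

Definition GH : set 'M[R]_(n + n) := fun g =>
  GLmx g /\ ctmx bar g *m psiH *m g = psiH.

Definition herm_val (z : 'cV[R]_r) : R := \sum_i bar (z i 0) * a 0 i * z i 0.

Definition herm_C : set 'cV[R]_r := fun z => herm_trace (herm_val z).

Definition single_col (i : 'I_s) (z : 'cV[R]_r) : 'M[R]_(r, s) :=
  \matrix_(p, q) (if q == i then z p 0 else 0).

Definition hm_mx (i : 'I_s) (z : 'cV[R]_r) (zf : R) : 'M[R]_(n + n) :=
  let al12 := single_col i z in
  block_mx (block_mx 1%:M al12 0 1%:M)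
           0
           (block_mx 0 (- (ctmx bar A1mx *m al12)) 0 (bar zf *: delta_mx i i))
           (block_mx 1%:M 0 (- ctmx bar al12) 1%:M).

Definition hr_mx (i : 'I_s) (z : 'cV[R]_r) (zf : R) : 'M[R]_(n + n) :=
  let be12 := single_col i z in
  block_mx 1%:M
           (block_mx 0 be12 (- (lam *: ctmx bar be12))
                     ((lam * bar zf) *: delta_mx i i))
           0
           (block_mx 1%:M (- (ctmx bar A1mx *m be12)) 0 1%:M).

(* In h_m and h_rz the element zf ranges over all solutions of the equation
   zf + lam * bar zf = herm_val z; herm_C z says that there is one. *)
Inductive EH_gen : set 'M[R]_(n + n) :=
| h_eps (i j : 'I_n) (b : R) : (r <= i)%N -> i != j ->
    EH_gen (1%:M + b *: delta_mx (lo i) (lo j)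
                 - bar b *: delta_mx (rho j) (rho i))
| h_r (i j : 'I_n) (b : R) : (r <= i)%N -> (r <= j)%N -> i != j ->
    EH_gen (1%:M + b *: delta_mx (lo i) (rho j)
                 - (lam * bar b) *: delta_mx (lo j) (rho i))
| h_rd (i : 'I_n) (b : R) : (r <= i)%N -> Lambda_max bar lam b ->
    EH_gen (1%:M + b *: delta_mx (lo i) (rho i))
| h_l (i j : 'I_n) (b : R) : i != j ->
    EH_gen (1%:M + b *: delta_mx (rho i) (lo j)
                 - (bar lam * bar b) *: delta_mx (rho j) (lo i))
| h_ld (i : 'I_n) (b : R) : Lambda_max bar lam (bar b) ->
    EH_gen (1%:M + b *: delta_mx (rho i) (lo i))
| h_m (i : 'I_s) (z : 'cV[R]_r) (zf : R) :
    herm_C z -> zf + lam * bar zf = herm_val z -> EH_gen (hm_mx i z zf)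
| h_rz (i : 'I_s) (z : 'cV[R]_r) (zf : R) :
    herm_C z -> zf + lam * bar zf = herm_val z -> EH_gen (hr_mx i z zf).

Definition EH : set 'M[R]_(n + n) := subgroup_gen EH_gen.

End Hermitian.

Section PolyForm.
Variables (R : nzRingType) (bar : R -> R) (lam : R).

(* The extension of bar with bar 'X = 'X. *)
Definition poly_bar : {poly R} -> {poly R} := map_poly bar.

Definition poly_Lambda (L : set R) : set {poly R} :=
  form_parameter_gen poly_bar lam%:P (image L polyC).

End PolyForm.

(* idealr_closed includes properness: it requires 1 \notin m. *)
Record maximal_ideal (k : comNzRingType) := MaximalIdeal {
  mideal : {pred k};
  mideal_ideal : idealr_closed mideal;
  mideal_max : forall J : {pred k},
    idealr_closed J -> {subset mideal <= J} -> {subset J <= mideal}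
}.

Section Denominators.
Variables (k : comNzRingType) (m : maximal_ideal k).

Definition in_den : {pred k} := fun s => s \notin mideal m.

Lemma in_den1 : in_den 1.
Proof. by rewrite /in_den; case: (mideal_ideal m). Qed.

Lemma in_denM s t : in_den s -> in_den t -> in_den (s * t).
Proof.
rewrite /in_den => sm tm; apply/negP => stm.
case: (mideal_ideal m) => m0 m1 mD.
pose J : {pred k} := fun x => `[< exists c y, y \in mideal m /\ x = c * s + y >].
have JP x : reflect (exists c y, y \in mideal m /\ x = c * s + y) (x \in J).
  exact: asboolP.
have mM a x : x \in mideal m -> a * x \in mideal m.
  by move=> xm; rewrite -[_ * _]addr0; apply: mD.
have [J1|J1] := boolP (1 \in J).
  have [c [y [ym e]]] := JP _ J1.
  move: tm; rewrite -[t]mul1r e mulrDl -mulrA [y * t]mulrC.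
  by rewrite mD // mM.
have sJ : s \in J by apply/JP; exists 1, 0; rewrite mul1r addr0.
move: sm; rewrite (@mideal_max _ m J) //.
- split=> //; first by apply/JP; exists 0, 0; rewrite mul0r addr0.
  move=> a x y /JP[c [x' [xm ->]]] /JP[d [y' [ym ->]]]; apply/JP.
  exists (a * c + d), (a * x' + y'); split; first exact: mD.
  by rewrite mulrDl mulrDr -!mulrA addrACA.
- by move=> x xm; apply/JP; exists 0, x; rewrite mul0r add0r.
Qed.

Record den := Den { dval :> k; denP : in_den dval }.

HB.instance Definition _ := [isSub for dval].
HB.instance Definition _ := [Choice of den by <:].

Definition den1 : den := Den in_den1.
Definition denM (s t : den) : den := Den (in_denM (denP s) (denP t)).

End Denominators.

(* S^-1 R for S the complement of m in k, R being possibly noncommutative: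
   fractions x / s with x : R and s : S, where x / s = y / t when
   u t x = u s y for some u : S. It may be the zero ring. *)
Module Localization.
Section Localization.
Variables (k : comNzRingType) (m : maximal_ideal k) (R : algType k).

Local Notation dom := (R * den m)%type.
Implicit Types x y z : dom.
Local Open Scope quotient_scope.

Definition eqfrac x y : bool :=
  `[< exists u : den m,
        (dval u * dval y.2) *: x.1 = (dval u * dval x.2) *: y.1 >].

Lemma eqfracP x y :
  reflect (exists u : den m,
             (dval u * dval y.2) *: x.1 = (dval u * dval x.2) *: y.1)
          (eqfrac x y).
Proof. exact: asboolP. Qed.

Lemma eqfrac_refl : reflexive eqfrac.
Proof. by move=> x; apply/eqfracP; exists (den1 m). Qed.

Lemma eqfrac_sym : symmetric eqfrac.
Proof.
by move=> x y; apply/eqfracP/eqfracP => -[u e]; exists u; rewrite e.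
Qed.

Lemma eqfrac_trans : transitive eqfrac.
Proof.
move=> [y t] [x s] [z w] /eqfracP[u /= e] /eqfracP[v /= f].
apply/eqfracP; exists (denM u (denM v t)) => /=.
rewrite (_ : _ * dval w = (dval v * dval w) * (dval u * dval t)); last by ring.
rewrite -scalerA e scalerA.
rewrite (_ : _ * _ = (dval u * dval s) * (dval v * dval w)); last by ring.
rewrite -scalerA f scalerA; congr (_ *: _); ring.
Qed.

Canonical eqfrac_equiv := EquivRel eqfrac eqfrac_refl eqfrac_sym eqfrac_trans.

Definition type := {eq_quot eqfrac}.

HB.instance Definition _ : EqQuotient _ eqfrac type := EqQuotient.on type.
HB.instance Definition _ := Choice.on type.

Lemma pi_eqP x y :
  reflect (exists u : den m,
             (dval u * dval y.2) *: x.1 = (dval u * dval x.2) *: y.1)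
          (x == y %[mod type]).
Proof. by rewrite eqmodE; exact: eqfracP. Qed.

Lemma reprP x : exists u : den m,
  (dval u * dval x.2) *: (repr (\pi_type x)).1 =
  (dval u * dval (repr (\pi_type x)).2) *: x.1.
Proof. by apply/pi_eqP; rewrite reprK. Qed.

Definition frac_add x y : dom :=
  (dval y.2 *: x.1 + dval x.2 *: y.1, denM x.2 y.2).
Definition frac_opp x : dom := (- x.1, x.2).
Definition frac_mul x y : dom := (x.1 * y.1, denM x.2 y.2).

Definition zero : type := lift_cst type (0, den1 m).
Definition one : type := lift_cst type (1, den1 m).
Definition add := lift_op2 type frac_add.
Definition opp := lift_op1 type frac_opp.
Definition mul := lift_op2 type frac_mul.

Canonical pi_zero_morph := PiConst zero.
Canonical pi_one_morph := PiConst one.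

Lemma pi_add : {morph \pi : x y / frac_add x y >-> add x y}.
Proof.
move=> x y; unlock add; apply/eqP/pi_eqP.
have [u eu] := reprP x; have [v ev] := reprP y.
exists (denM u v); rewrite /frac_add /= !scalerDr !scalerA.
set x' := repr _ in eu *; set y' := repr _ in ev *.
congr (_ + _).
- rewrite (_ : _ * _ = (dval v * dval y.2 * dval y'.2) * (dval u * dval x'.2));
    last by ring.
  rewrite -scalerA -eu scalerA; congr (_ *: _); ring.
- rewrite (_ : _ * _ = (dval u * dval x.2 * dval x'.2) * (dval v * dval y'.2));
    last by ring.
  rewrite -scalerA -ev scalerA; congr (_ *: _); ring.
Qed.
Canonical pi_add_morph := PiMorph2 pi_add.

Lemma pi_opp : {morph \pi : x / frac_opp x >-> opp x}.
Proof.
move=> x; unlock opp; apply/eqP/pi_eqP; have [u eu] := reprP x.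
by exists u; rewrite /= !scalerN eu.
Qed.
Canonical pi_opp_morph := PiMorph1 pi_opp.

Lemma pi_mul : {morph \pi : x y / frac_mul x y >-> mul x y}.
Proof.
move=> x y; unlock mul; apply/eqP/pi_eqP.
have [u eu] := reprP x; have [v ev] := reprP y.
exists (denM u v); rewrite /frac_mul /=.
set x' := repr _ in eu *; set y' := repr _ in ev *.
rewrite (_ : _ * _ = (dval u * dval x'.2) * (dval v * dval y'.2)); last by ring.
rewrite (_ : _ * (dval x.2 * _) = (dval u * dval x.2) * (dval v * dval y.2));
  last by ring.
have sM (c d : k) (p q : R) : (c * d) *: (p * q) = (c *: p) * (d *: q).
  by rewrite -scalerAr -scalerAl scalerA mulrC.
by rewrite !sM eu ev.
Qed.
Canonical pi_mul_morph := PiMorph2 pi_mul.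

Lemma eq_fracE x y : x.1 = y.1 -> dval x.2 = dval y.2 ->
  \pi_type x = \pi_type y.
Proof. by move=> e1 e2; apply/eqP/pi_eqP; exists (den1 m); rewrite e1 e2. Qed.

Lemma addA : associative add.
Proof.
elim/quotW=> x; elim/quotW=> y; elim/quotW=> z; rewrite !piE.
apply: eq_fracE; last by rewrite /= mulrA.
rewrite /= !scalerDr !scalerA addrA; congr (_ *: _ + _ *: _ + _ *: _);
  rewrite /=; ring.
Qed.

Lemma addC : commutative add.
Proof.
elim/quotW=> x; elim/quotW=> y; rewrite !piE.
by apply: eq_fracE; rewrite /= ?(mulrC (dval x.2)) // addrC.
Qed.

Lemma add0 : left_id zero add.
Proof.
elim/quotW=> x; rewrite !piE.
by apply: eq_fracE; rewrite /= ?mul1r // scaler0 add0r scale1r.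
Qed.

Lemma addN : left_inverse zero opp add.
Proof.
elim/quotW=> x; rewrite !piE; apply/eqP/pi_eqP; exists (den1 m).
by rewrite /= scalerN addNr !scaler0.
Qed.

HB.instance Definition _ := GRing.isZmodule.Build type addA addC add0 addN.

Lemma mulA : associative mul.
Proof.
elim/quotW=> x; elim/quotW=> y; elim/quotW=> z; rewrite !piE.
by apply: eq_fracE; rewrite /= mulrA.
Qed.

Lemma mul1 : left_id one mul.
Proof.
by elim/quotW=> x; rewrite !piE; apply: eq_fracE; rewrite /= mul1r.
Qed.

Lemma mulx1 : right_id one mul.
Proof.
by elim/quotW=> x; rewrite !piE; apply: eq_fracE; rewrite /= mulr1.
Qed.

Lemma mulDl : left_distributive mul add.
Proof.
elim/quotW=> x; elim/quotW=> y; elim/quotW=> z; rewrite !piE.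
apply/eqP/pi_eqP; exists (den1 m); rewrite /= mulrDl !scalerDr.
rewrite -!scalerAl !scalerA; congr (_ *: _ + _ *: _); rewrite /=; ring.
Qed.

Lemma mulDr : right_distributive mul add.
Proof.
elim/quotW=> x; elim/quotW=> y; elim/quotW=> z; rewrite !piE.
apply/eqP/pi_eqP; exists (den1 m); rewrite /= mulrDr !scalerDr.
rewrite -!scalerAr !scalerA; congr (_ *: _ + _ *: _); rewrite /=; ring.
Qed.

HB.instance Definition _ :=
  GRing.Zmodule_isPzRing.Build type mulA mul1 mulx1 mulDl mulDr.

Definition frac (x : R) (s : den m) : type := \pi_type (x, s).

Definition of_base (x : R) : type := frac x (den1 m).

Lemma of_base_is_zmod_morphism : zmod_morphism of_base.
Proof.
move=> x y; rewrite /of_base /frac -[X in _ = _ + X]pi_opp -[RHS]pi_add.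
by apply: eq_fracE; rewrite /= ?mulr1 // !scale1r.
Qed.
HB.instance Definition _ := GRing.isZmodMorphism.Build R type of_base
  of_base_is_zmod_morphism.

Lemma of_base_is_monoid_morphism : monoid_morphism of_base.
Proof.
split=> [|x y]; rewrite /of_base /frac; first by rewrite -[RHS]/one piE.
by rewrite -[RHS]pi_mul; apply: eq_fracE; rewrite /= ?mulr1.
Qed.
HB.instance Definition _ := GRing.isMonoidMorphism.Build R type of_base
  of_base_is_monoid_morphism.

(* Well defined on fractions when bar is k-linear, see loc_barE. *)
Definition frac_bar (bar : R -> R) x : dom := (bar x.1, x.2).
Definition loc_bar (bar : R -> R) := lift_op1 type (frac_bar bar).

Lemma eq_frac (x y : R) (s t : den m) : frac x s = frac y t <->
  exists u : den m, (dval u * dval t) *: x = (dval u * dval s) *: y.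
Proof.
by split=> [/eqP/pi_eqP|e]; last by apply/eqP/pi_eqP.
Qed.

Lemma loc_barE (bar : {linear R -> R}) (x : R) (s : den m) :
  loc_bar bar (frac x s) = frac (bar x) s.
Proof.
rewrite /frac /loc_bar; unlock; apply/esym/eqP/pi_eqP.
have [u eu] := reprP (x, s); exists u.
by rewrite /= -!linearZ eu.
Qed.

Lemma fracP (x : type) : exists (y : R) (s : den m), x = frac y s.
Proof. by elim/quotW: x => -[y s]; exists y, s. Qed.

Definition type_nz (nz : (1 : type) != 0) : nzRingType :=
  HB.pack type (GRing.PzSemiRing_isNonZero.Build type nz).

End Localization.
End Localization.
HB.export Localization.

Notation loc_ring m R := (Localization.type m R).
Notation loc_map m := (@Localization.of_base _ m _).
Notation loc_bar m bar := (@Localization.loc_bar _ m _ bar).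
Notation loc_nz := Localization.type_nz.

Definition loc_Lambda (k : comNzRingType) (m : maximal_ideal k) (R : algType k)
    (bar : R -> R) (lam : R) (L : set R) : set (loc_ring m R) :=
  form_parameter_gen (loc_bar m bar) (loc_map m lam) (image L (loc_map m)).
Arguments loc_Lambda {k} m {R}.

(* If R_m is the zero ring, then so is R_m[X], and the condition on the image
   of al is void. As {poly _} requires a nontrivial coefficient ring, only the
   m with 1 != 0 in R_m are quantified over. *)
Section LocalGlobal.
Variables (k : comNzRingType) (R : algType k) (bar : R -> R) (lam : R).

Definition local_global_Q (L : set R) (n : nat) : Prop :=
  forall al : 'M[{poly R}]_(n + n),
    GQ (poly_bar bar) lam%:P (poly_Lambda bar lam L) al ->
    map_mx (fun p : {poly R} => p.[0]) al = 1%:M ->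
    (forall (m : maximal_ideal k) (nz : (1 : loc_ring m R) != 0),
       let Rm : nzRingType := loc_nz nz in
       let barm : Rm -> Rm := loc_bar m bar in
       let lamm : Rm := loc_map m lam in
       let Lm : set Rm := loc_Lambda m bar lam L in
       let alm : 'M[{poly Rm}]_(n + n) :=
         map_mx (map_poly (loc_map m : R -> Rm)) al in
       EQ (poly_bar barm) lamm%:P (poly_Lambda barm lamm Lm) alm) ->
    EQ (poly_bar bar) lam%:P (poly_Lambda bar lam L) al.

Definition local_global_H (r s : nat) (a : 'rV[R]_r) : Prop :=
  forall al : 'M[{poly R}]_((r + s) + (r + s)),
    GH (poly_bar bar) lam%:P (map_mx polyC a) al ->
    map_mx (fun p : {poly R} => p.[0]) al = 1%:M ->
    (forall (m : maximal_ideal k) (nz : (1 : loc_ring m R) != 0),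
       let Rm : nzRingType := loc_nz nz in
       let barm : Rm -> Rm := loc_bar m bar in
       let lamm : Rm := loc_map m lam in
       let am : 'rV[Rm]_r := map_mx (loc_map m : R -> Rm) a in
       let alm : 'M[{poly Rm}]_((r + s) + (r + s)) :=
         map_mx (map_poly (loc_map m : R -> Rm)) al in
       EH (poly_bar barm) lamm%:P (map_mx polyC am) alm) ->
    EH (poly_bar bar) lam%:P (map_mx polyC a) al.

End LocalGlobal.

Definition fin_gen_module (k : comNzRingType) (V : lmodType k) : Prop :=
  exists (d : nat) (g : 'I_d -> V),
    forall x : V, exists c : 'I_d -> k, x = \sum_i c i *: g i.

(* Main.v *)
Require Import Defs.
From HB Require Import structures.
From mathcomp Require Import all_boot all_order all_algebra.
From mathcomp Require Import generic_quotient ring_quotient.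
From mathcomp Require Import boolp classical_sets ring.

Set Implicit Arguments.
Unset Strict Implicit.
Unset Printing Implicit Defensive.

Import GRing.Theory.
Local Open Scope ring_scope.

(** Both conditions of each equivalence always hold.

    Local-global principle. Fix alpha(X) with alpha(0) = 1. The b in k such that
    alpha(u + b v) alpha(u)^-1 is elementary for all central u, v in R[X] fixed
    by the involution form an ideal. If alpha is elementary over R_m[X], this
    ideal meets k \ m: conjugation by an elementary matrix over S^-1 A maps the
    elementary subgroup of a high level t in S into that of a given level s, so
    that an elementary beta(T) with beta(0) = 1 becomes elementary over A[T]
    after the dilation T := t T. Hence the ideal contains 1.

    Normality. R_m is finite over k_m, so it has absolute stable range one and
    its left inverses are two-sided. Therefore a quadratic matrix g over R_m can
    be multiplied by an elementary one to map a basis vector e_i to e_i x, with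
    x invertible. Elementary matrices are products of transvections along basis
    vectors, so that g normalizes the elementary group, even over R_m[X]. For g
    over R and b with entries in R, this makes g up(X^2 b) g^-1 locally
    elementary; it is elementary by the local-global principle.

    Hermitian case. Write a_i = c_i + lambda c_i^bar and C = diag(c_i, 0).
    Conjugation by [[1, 0], [-C^*, 1]] identifies GH and EH with GQ and EQ for
    the maximal form parameter. *)

(** * Subgroups generated by matrices, conjugate transposes *)

(** A form parameter is stable under a -> x^bar a x only, so a scalar z acts on it through z^2. This
    is why denominators are squares and why normality is tested on X^2 b instead of X b.

    Absolute stable range is available over R_m but not over R_m[X]. A matrix over R is constant in
    X, however: its column is reduced over R_m, and only the transvection that it conjugates has
    polynomial entries.

    Elements of k \ m may be zero divisors in R. An identity over the localization holds below only
    after multiplication by some element of k \ m, and a second dilation supplies that factor.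

    Modulo its radical, R_m is a finite-dimensional space over k/m on which R_m acts by right
    multiplication. Divisibility becomes inclusion of row spaces, and the stable range condition
    becomes a statement about ranks, without the structure theory of semisimple rings. *)

Section SubgroupGen.
Variables (R : pzRingType) (N : nat).
Implicit Types (s t : 'M[R]_N) (X Y : set 'M[R]_N).

Lemma mx_inverse_uniq s t t' : mx_inverse s t -> mx_inverse s t' -> t = t'.
Proof.
by move=> [_ ts] [st' _]; rewrite -[t]mulmx1 -st' mulmxA ts mul1mx.
Qed.

Lemma mx_inverse_sym s t : mx_inverse s t -> mx_inverse t s.
Proof. by case. Qed.

Lemma mx_inverse1 : mx_inverse (1%:M : 'M[R]_N) 1%:M.
Proof. by split; rewrite mulmx1. Qed.

Lemma mx_inverseM s s' t t' :
  mx_inverse s s' -> mx_inverse t t' -> mx_inverse (s *m t) (t' *m s').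
Proof.
move=> [a b] [c d]; split.
  by rewrite mulmxA -(mulmxA s) c mulmx1.
by rewrite mulmxA -(mulmxA t') b mulmx1.
Qed.

Lemma sgen_sub X (H : set 'M[R]_N) : is_subgroup H ->
  (forall s, X s -> H s) -> forall s, subgroup_gen X s -> H s.
Proof.
move=> [_ H1 HM HV] XH s; elim=> // [u v _ Hu _ Hv|u v _ Hu uv].
- exact: HM.
- exact: HV Hu uv.
Qed.

Lemma sgen_sgen X Y : (forall s, X s -> subgroup_gen Y s) ->
  forall s, subgroup_gen X s -> subgroup_gen Y s.
Proof.
move=> XY s; elim=> [u Xu|||].
- exact: XY.
- exact: sgen_one.
- by move=> u v _ Hu _ Hv; apply: sgen_mul.
- by move=> u v _ Hu uv; apply: sgen_inv uv.
Qed.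

Lemma sgen_GL X : (forall s, X s -> GLmx s) ->
  forall s, subgroup_gen X s -> GLmx s.
Proof.
move=> XG s; elim=> [u Xu||u v _ [u' hu] _ [v' hv]|u v _ [u' hu] uv].
- exact: XG.
- by exists 1%:M; apply: mx_inverse1.
- by exists (v' *m u'); apply: mx_inverseM.
- by exists u; apply: mx_inverse_sym.
Qed.

Lemma sgen_subgroup X : (forall s, X s -> GLmx s) ->
  is_subgroup (subgroup_gen X).
Proof.
move=> XG; split; [exact: sgen_GL| exact: sgen_one| |].
  by move=> s t; apply: sgen_mul.
by move=> s t; apply: sgen_inv.
Qed.

Lemma sgen_conj X Y (g g' : 'M[R]_N) : mx_inverse g g' ->
  (forall s, X s -> subgroup_gen Y (g *m s *m g')) ->
  forall s, subgroup_gen X s -> subgroup_gen Y (g *m s *m g').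
Proof.
move=> gg' XY s; elim=> [u Xu||u v _ Hu _ Hv|u v _ Hu uv].
- exact: XY.
- by rewrite mulmx1; case: gg' => -> _; apply: sgen_one.
- rewrite (_ : _ *m g' = (g *m u *m g') *m (g *m v *m g')); first exact: sgen_mul.
  by rewrite !mulmxA -(mulmxA _ g' g) (proj2 gg') mulmx1.
- apply: sgen_inv Hu _; rewrite -(mulmxA g u).
  have g'g := mx_inverse_sym gg'.
  by do 2!apply: mx_inverseM => //.
Qed.

End SubgroupGen.

Section MapSubgroup.
Variables (R R' : pzRingType) (f : {rmorphism R -> R'}) (N : nat).

Lemma map_mx_inverse (s t : 'M[R]_N) :
  mx_inverse s t -> mx_inverse (map_mx f s) (map_mx f t).
Proof. by case=> a b; split; rewrite -map_mxM ?a ?b map_mx1. Qed.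

Lemma sgen_map (X : set 'M[R]_N) (Y : set 'M[R']_N) :
  (forall s, X s -> subgroup_gen Y (map_mx f s)) ->
  forall s, subgroup_gen X s -> subgroup_gen Y (map_mx f s).
Proof.
move=> XY s; elim=> [u Xu||u v _ Hu _ Hv|u v _ Hu uv].
- exact: XY.
- by rewrite map_mx1; apply: sgen_one.
- by rewrite map_mxM; apply: sgen_mul.
- by apply: sgen_inv Hu _; apply: map_mx_inverse.
Qed.

End MapSubgroup.

Section Involution.
Variables (R : pzRingType) (bar : R -> R) (barI : involution bar).

Lemma barD : {morph bar : x y / x + y}. Proof. by case: barI. Qed.
Lemma barM x y : bar (x * y) = bar y * bar x. Proof. by case: barI. Qed.
Lemma barK : involutive bar. Proof. by case: barI. Qed.

Lemma bar0 : bar 0 = 0.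
Proof. by apply: (addrI (bar 0)); rewrite -barD !addr0. Qed.

Lemma barN : {morph bar : x / - x}.
Proof. by move=> x; apply: (addrI (bar x)); rewrite -barD !addrN bar0. Qed.

Lemma bar1 : bar 1 = 1.
Proof. by rewrite -[LHS]mulr1 -{2}[1]barK -barM mulr1 barK. Qed.

Lemma bar_sum I (r : seq I) (P : pred I) (F : I -> R) :
  bar (\sum_(i <- r | P i) F i) = \sum_(i <- r | P i) bar (F i).
Proof. exact: (big_morph bar barD bar0). Qed.

Lemma ctmxE p q (M : 'M[R]_(p, q)) i j : ctmx bar M i j = bar (M j i).
Proof. by rewrite !mxE. Qed.

Lemma ctmxM p q r (M : 'M[R]_(p, q)) (N : 'M[R]_(q, r)) :
  ctmx bar (M *m N) = ctmx bar N *m ctmx bar M.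
Proof.
apply/matrixP => i j; rewrite ctmxE !mxE bar_sum.
by apply: eq_bigr => l _; rewrite barM !ctmxE.
Qed.

Lemma ctmxD p q (M N : 'M[R]_(p, q)) : ctmx bar (M + N) = ctmx bar M + ctmx bar N.
Proof. by apply/matrixP => i j; rewrite !mxE barD. Qed.

Lemma ctmxN p q (M : 'M[R]_(p, q)) : ctmx bar (- M) = - ctmx bar M.
Proof. by apply/matrixP => i j; rewrite !mxE barN. Qed.

Lemma ctmxB p q (M N : 'M[R]_(p, q)) : ctmx bar (M - N) = ctmx bar M - ctmx bar N.
Proof. by rewrite ctmxD ctmxN. Qed.

Lemma ctmx0 p q : ctmx bar (0 : 'M[R]_(p, q)) = 0.
Proof. by apply/matrixP => i j; rewrite !mxE bar0. Qed.

Lemma ctmx1 p : ctmx bar (1%:M : 'M[R]_p) = 1%:M.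
Proof.
by apply/matrixP => i j; rewrite !mxE eq_sym; case: eqP; rewrite ?bar1 ?bar0.
Qed.

Lemma ctmxK p q (M : 'M[R]_(p, q)) : ctmx bar (ctmx bar M) = M.
Proof. by apply/matrixP => i j; rewrite !mxE barK. Qed.

Lemma ctmx_delta p q (i : 'I_p) (j : 'I_q) (a : R) :
  ctmx bar (a *: delta_mx i j) = bar a *: delta_mx j i.
Proof.
by apply/matrixP => x y; rewrite !mxE barM [in bar _%:R]andbC; case: (_ && _); rewrite ?bar1 ?bar0 ?mulr1 ?mul1r ?mulr0 ?mul0r.
Qed.

Lemma bar_central c : central c -> central (bar c).
Proof. by move=> cC x; rewrite -[x]barK -!barM cC. Qed.

Lemma ctmx_scale p q (c : R) (M : 'M[R]_(p, q)) : central c ->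
  ctmx bar (c *: M) = bar c *: ctmx bar M.
Proof.
by move=> cC; apply/matrixP => i j; rewrite !mxE barM (bar_central cC).
Qed.

Lemma ctmx_block p1 p2 q1 q2 (a : 'M[R]_(p1, q1)) (b : 'M[R]_(p1, q2))
    (c : 'M[R]_(p2, q1)) (d : 'M[R]_(p2, q2)) :
  ctmx bar (block_mx a b c d) =
  block_mx (ctmx bar a) (ctmx bar c) (ctmx bar b) (ctmx bar d).
Proof. by rewrite /ctmx map_block_mx tr_block_mx. Qed.

End Involution.

Lemma scalemx_centralr (R : pzRingType) p q r (z : R) (A : 'M_(p, q))
    (B : 'M_(q, r)) : central z -> A *m (z *: B) = z *: (A *m B).
Proof.
move=> zC; apply/matrixP => i j; rewrite !mxE mulr_sumr.
by apply: eq_bigr => l _; rewrite !mxE mulrA -zC mulrA.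
Qed.

Lemma mul_scale_delta (R : pzRingType) p q r (a b : R) (i : 'I_p) (j l : 'I_q)
    (m : 'I_r) :
  (a *: delta_mx i j) *m (b *: delta_mx l m) =
  (if j == l then (a * b) *: delta_mx i m else 0).
Proof.
have [->|jl] := eqVneq j l; last first.
  apply/matrixP => x y; rewrite !mxE big1 // => h _; rewrite !mxE.
  case: (eqVneq h j) => [->|_]; last by rewrite andbF mulr0 mul0r.
  by rewrite (negPf jl) mulr0 mulr0.
apply/matrixP => x y; rewrite mxE (bigD1 l) //= big1 ?addr0 => [|h hj].
  rewrite !mxE !eqxx andbT /=.
  by case: (x == i); case: (y == m); rewrite /= ?mulr1 ?mulr0 ?mul0r.
by rewrite !mxE (negPf hj) andbF mulr0 mul0r.
Qed.

(** * Elementary matrices *)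

(* The common structure of R, R[X], R_m and R_m[X]. *)
Record uring (k : comNzRingType) := URing {
  ucar :> nzRingType;
  ubar : ucar -> ucar;
  ulam : ucar;
  uin : {rmorphism k -> ucar};
  ubarI : involution ubar;
  ulamC : central ulam;
  ulamU : ulam * ubar ulam = 1;
  uinC : forall c, central (uin c);
  ubar_in : forall c, ubar (uin c) = uin c
}.

Definition mx01E := (mulmx0, mul0mx, mulmx1, mul1mx, addr0, add0r).

Section Blocks.
Variables (k : comNzRingType) (A : uring k) (n : nat).
Local Notation bar := (@ubar k A).
Local Notation lam := (ulam A).
Local Notation "M ^h" := (ctmx bar M) (at level 8, format "M ^h").
Implicit Types (a b c d : 'M[A]_n) (L : set A).

Let bI := ubarI A.
Let lC := @ulamC k A.

Lemma ulamVC : central (bar lam). Proof. exact: bar_central. Qed.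
Lemma ulamVU : bar lam * lam = 1. Proof. by rewrite -ulamC ulamU. Qed.

Lemma ulamK p q (M : 'M[A]_(p, q)) : lam *: (bar lam *: M) = M.
Proof. by rewrite scalerA ulamU scale1r. Qed.
Lemma ulamVK p q (M : 'M[A]_(p, q)) : bar lam *: (lam *: M) = M.
Proof. by rewrite scalerA ulamVU scale1r. Qed.

Lemma ctmx_lam p q (M : 'M[A]_(p, q)) : (lam *: M)^h = bar lam *: M^h.
Proof. by rewrite ctmx_scale. Qed.
Lemma ctmx_lamV p q (M : 'M[A]_(p, q)) : (bar lam *: M)^h = lam *: M^h.
Proof. by rewrite ctmx_scale ?(barK bI) //; apply: ulamVC. Qed.
Lemma ctmx_in p q z (M : 'M[A]_(p, q)) : (uin A z *: M)^h = uin A z *: M^h.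
Proof. by rewrite ctmx_scale ?ubar_in //; apply: uinC. Qed.

Definition up b : 'M[A]_(n + n) := block_mx 1%:M b 0 1%:M.
(* With the factor bar lam, the matrices b for which up b and lo b preserve the
   quadratic form are the same, and swap exchanges up b and lo b. *)
Definition lo b : 'M[A]_(n + n) := block_mx 1%:M 0 (bar lam *: b) 1%:M.
(** The Levi factor. [a'] stands for the inverse of [a] and is passed along, since no inverse is
    computed over a noncommutative ring. *)
Definition hyp a a' : 'M[A]_(n + n) := block_mx a 0 0 a'^h.
Definition swap : 'M[A]_(n + n) := block_mx 0 1%:M (bar lam)%:M 0.
Definition swapV : 'M[A]_(n + n) := block_mx 0 lam%:M 1%:M 0.

Lemma up0 : up 0 = 1%:M. Proof. by rewrite /up -scalar_mx_block. Qed.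
Lemma lo0 : lo 0 = 1%:M. Proof. by rewrite /lo scaler0 -scalar_mx_block. Qed.

Lemma upD b c : up (b + c) = up b *m up c.
Proof.
by rewrite /up mulmx_block !mx01E addrC.
Qed.

Lemma loD b c : lo (b + c) = lo b *m lo c.
Proof.
by rewrite /lo mulmx_block !mx01E scalerDr.
Qed.

Lemma up_inv b : mx_inverse (up b) (up (- b)).
Proof. by split; rewrite -upD ?addNr ?addrN up0. Qed.
Lemma lo_inv b : mx_inverse (lo b) (lo (- b)).
Proof. by split; rewrite -loD ?addNr ?addrN lo0. Qed.

Lemma swap_inv : mx_inverse swap swapV.
Proof.
split; rewrite /swap /swapV mulmx_block ?mx01E;
  by rewrite -scalar_mxM ?ulamU ?ulamVU -scalar_mx_block.
Qed.

Lemma mul_mx_lam b : b *m lam%:M = lam *: b.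
Proof. by rewrite -[lam%:M]scalemx1 scalemx_centralr // mulmx1. Qed.

Lemma swap_up b : swap *m up b *m swapV = lo b.
Proof.
rewrite /swap /swapV /up /lo !mulmx_block !mx01E.
by rewrite -scalar_mxM ulamVU mul_scalar_mx.
Qed.

Lemma swap_lo b : swap *m lo b *m swapV = up b.
Proof.
rewrite /swap /swapV /up /lo !mulmx_block !mx01E.
by rewrite -scalar_mxM ulamVU mul_mx_lam ulamK.
Qed.

Lemma swapV_up b : swapV *m up b *m swap = lo b.
Proof.
rewrite -(swap_lo b) !mulmxA (proj2 swap_inv) mul1mx -mulmxA.
by rewrite (proj2 swap_inv) mulmx1.
Qed.

Lemma swapV_lo b : swapV *m lo b *m swap = up b.
Proof.
rewrite -(swap_up b) !mulmxA (proj2 swap_inv) mul1mx -mulmxA.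
by rewrite (proj2 swap_inv) mulmx1.
Qed.

Lemma hyp_inv a a' : mx_inverse a a' -> mx_inverse (hyp a a') (hyp a' a).
Proof.
move=> [aa' a'a]; split; rewrite /hyp mulmx_block !mx01E.
  by rewrite -ctmxM // aa' ctmx1 // -scalar_mx_block.
by rewrite -ctmxM // a'a ctmx1 // -scalar_mx_block.
Qed.

Lemma hypM a a' b b' : hyp a a' *m hyp b b' = hyp (a *m b) (b' *m a').
Proof. by rewrite /hyp mulmx_block !mx01E -ctmxM. Qed.

Lemma hyp_up a a' b : mx_inverse a a' ->
  hyp a a' *m up b *m hyp a' a = up (a *m b *m a^h).
Proof.
move=> [aa' a'a]; rewrite /hyp /up !mulmx_block !mx01E.
by rewrite -!ctmxM // aa' ctmx1.
Qed.

Lemma hyp_lo a a' b : mx_inverse a a' ->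
  hyp a a' *m lo b *m hyp a' a = lo (a'^h *m b *m a').
Proof.
move=> [aa' a'a]; rewrite /hyp /lo !mulmx_block !mx01E.
rewrite -!ctmxM // aa' ctmx1 //.
by rewrite scalemx_centralr -?scalemxAl //; apply: ulamVC.
Qed.

(** For a form parameter [L], the form parameter that it induces on the matrix ring with involution
    [ctmx]. *)
Definition LamMat L : set 'M[A]_n := fun b => b = - (lam *: b^h) /\ forall i, L (b i i).

(** The upper right block of the product is a multiple of b c b. Once it vanishes, the product is
    block lower triangular and splits into a Levi factor and a [lo]; the same relation gives (b c)^2
    = 0. *)
Lemma up_lo b c : b *m c *m b = 0 ->
  b = - (lam *: b^h) -> c = - (lam *: c^h) ->
  up b *m lo c *m up (- b) =
  hyp (1%:M + bar lam *: (b *m c)) (1%:M - bar lam *: (b *m c)) *m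
  lo (c + bar lam *: (c *m b *m c)).
Proof.
move=> bcb hb hc.
have hb' : b^h = - (bar lam *: b).
  by rewrite {2}hb scalerN ulamVK opprK.
have hc' : c^h = - (bar lam *: c).
  by rewrite {2}hc scalerN ulamVK opprK.
have lV := ulamVC.
have E : (1%:M - bar lam *: (b *m c))^h = 1%:M - bar lam *: (c *m b).
  rewrite ctmxB // ctmx1 // ctmx_lamV ctmxM // hb' hc' mulNmx mulmxN opprK.
  by rewrite -scalemxAl scalemx_centralr // ulamK.
rewrite /hyp E /up /lo !mulmx_block !mx01E.
have E1 : b *m (bar lam *: c) = bar lam *: (b *m c) by rewrite scalemx_centralr.
rewrite !E1 mulmxDl mul1mx -scalemxAl !mulmxN bcb oppr0 scaler0 addr0 addNr.
congr block_mx; last by rewrite -scalemxAl addrC.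
rewrite mulmxBl mul1mx -scalemxAl scalemx_centralr // -scalerBr mulmxDr.
rewrite scalemx_centralr // -(mulmxA c b c) -(mulmxA c b) (mulmxA b c) (mulmxA (b *m c)) bcb.
by rewrite mul0mx mulmx0 scaler0 addr0 mulmxA addrK.
Qed.

Inductive lam_gen L : set 'M[A]_n :=
| lam_short i j (a : A) : i != j ->
    lam_gen L (a *: delta_mx i j - (lam * bar a) *: delta_mx j i)
| lam_long i (a : A) : L a -> lam_gen L (a *: delta_mx i i).

Lemma LamMat_ind L (P : 'M[A]_n -> Prop) :
  P 0 -> (forall b c, P b -> P c -> P (b + c)) ->
  (forall b, lam_gen L b -> P b) -> forall b, LamMat L b -> P b.
Proof.
move=> P0 PD Pg b [hb Lb].
pose F (p : 'I_n * 'I_n) := b p.1 p.2 *: delta_mx p.1 p.2.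
(* Each entry above the diagonal is grouped with its mirror image, which the symmetry of [b]
   determines. *)
have -> : b = \sum_(p : 'I_n * 'I_n | p.1 == p.2) F p +
    \sum_(p : 'I_n * 'I_n | (p.1 < p.2)%N) (F p + F (p.2, p.1)).
  rewrite [LHS]matrix_sum_delta pair_bigA /= (bigID (fun p : 'I_n * 'I_n => p.1 == p.2)) /=.
  congr (_ + _); rewrite (bigID (fun p : 'I_n * 'I_n => (p.1 < p.2)%N)) /= big_split /=.
  congr (_ + _); first by apply: eq_bigl => p; rewrite -val_eqE neq_ltn; case: ltngtP.
  rewrite (reindex_onto (fun p : 'I_n * 'I_n => (p.2, p.1)) (fun p => (p.2, p.1))) /=; last by case.
  by apply: eq_bigl => -[i j] /=; rewrite eqxx andbT -val_eqE /=; case: ltngtP.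
have Psum (Q : pred ('I_n * 'I_n)) G : (forall p, Q p -> P (G p)) -> P (\sum_(p | Q p) G p).
  by move=> QG; apply: big_ind => //.
apply: PD; apply: Psum => -[i j] /=.
  by move=> /eqP <-; rewrite /F /=; apply/Pg/lam_long/Lb.
move=> ij; rewrite /F /= {2}hb !mxE scaleNr.
by  apply/Pg/lam_short; rewrite -val_eqE neq_ltn ij.
Qed.

Section FormParameter.
Variables (L : set A) (LF : form_parameter bar lam L).

Lemma fp0 : L 0. Proof. by case: LF => -[]. Qed.
Lemma fpD x y : L x -> L y -> L (x + y). Proof. by case: LF => -[] _ h _ _ _ _; apply: h. Qed.
Lemma fpN x : L x -> L (- x). Proof. by case: LF => -[] _ _ h _ _ _; apply: h. Qed.
Lemma fp_min x : L (x - lam * bar x).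
Proof. by case: LF => _ h _ _; apply: h; exists x. Qed.
Lemma fp_max x : L x -> x = - (lam * bar x). Proof. by case: LF => _ _ h _; apply: h. Qed.
Lemma fp_conj x (a : A) : L a -> L (bar x * a * x). Proof. by case: LF => _ _ _; apply. Qed.

Lemma LamMat0 : LamMat L 0.
Proof. by split=> [|i]; rewrite ?mxE ?ctmx0 // ?scaler0 ?oppr0 //; apply: fp0. Qed.

Lemma LamMatD b c : LamMat L b -> LamMat L c -> LamMat L (b + c).
Proof.
move=> [hb Lb] [hc Lc]; split=> [|i]; last by rewrite mxE; apply: fpD.
by rewrite ctmxD // scalerDr opprD -hb -hc.
Qed.

Lemma LamMatN b : LamMat L b -> LamMat L (- b).
Proof.
move=> [hb Lb]; split=> [|i]; last by rewrite mxE; apply: fpN.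
by rewrite ctmxN // scalerN -hb.
Qed.

Lemma lam_gen_LamMat b : lam_gen L b -> LamMat L b.
Proof.
case=> [i j a ij|i a La]; split.
- rewrite ctmxB // !ctmx_delta // (barM bI) (barK bI) scalerBr !scalerA opprB.
  by rewrite -ulamVC mulrA ulamU mul1r.
- by move=> l; rewrite !mxE; case: (eqVneq l i) => [->|_]; rewrite ?(negPf ij) ?andbF ?mulr0 ?subr0; apply: fp0.
- by rewrite ctmx_delta // scalerA -scaleNr -fp_max.
- by move=> l; rewrite !mxE; case: (_ && _); rewrite ?mulr1 ?mulr0 //; apply: fp0.
Qed.

(** The symmetry is formal. On the diagonal, a short generator contributes an element y - lam y^bar
    of the minimal form parameter, and a long one contributes some x^bar a x. *)
Lemma LamMat_conj (x b : 'M[A]_n) : LamMat L b -> LamMat L (x^h *m b *m x).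
Proof.
have E (c : 'M[A]_n) : c = - (lam *: c^h) ->
    x^h *m c *m x = - (lam *: (x^h *m c *m x)^h).
  move=> hc; rewrite !ctmxM // ctmxK // mulmxA [in LHS]hc.
  by rewrite mulmxN mulNmx scalemx_centralr // -scalemxAl.
elim/LamMat_ind=> [|c d|c cg]; first by rewrite mulmx0 mul0mx; apply: LamMat0.
  by rewrite mulmxDr mulmxDl; apply: LamMatD.
split=> [|l]; first by apply: E; case: (lam_gen_LamMat cg).
have mD (y : A) i j : (x^h *m (y *: delta_mx i j) *m x) l l = bar (x i l) * y * x j l.
  rewrite mxE (bigD1 j) //= big1 ?addr0 => [|h hj].
    rewrite mxE (bigD1 i) //= big1 ?addr0 => [|h hi]; last first.
      by rewrite !mxE (negPf hi) /= !mulr0.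
    by rewrite !mxE !eqxx mulr1.
  rewrite mxE big1 ?mul0r // => h' _; rewrite !mxE (negPf hj) andbF.
  by rewrite !mulr0.
case: cg => [i j a ij|i a La]; last by rewrite mD; apply: fp_conj.
rewrite mulmxBr mulmxBl !mxE.
have := mD a i j; rewrite mxE => ->.
have := mD (lam * bar a) j i; rewrite mxE => ->.
rewrite (_ : bar (x j l) * _ * _ = lam * bar (bar (x i l) * a * x j l)).
  exact: fp_min.
by rewrite !(barM bI) (barK bI) !mulrA ulamC.
Qed.

Lemma LamMat_conj' (x b : 'M[A]_n) : LamMat L b -> LamMat L (x *m b *m x^h).
Proof. by move=> /(LamMat_conj x^h); rewrite ctmxK. Qed.

Lemma LamMat_in z b : LamMat L b -> LamMat L (uin A z ^+ 2 *: b).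
Proof.
move=> /(LamMat_conj (uin A z)%:M).
have -> : (uin A z)%:M^h = (uin A z)%:M :> 'M[A]_n.
  by rewrite -[(uin A z)%:M]scalemx1 ctmx_in ctmx1.
rewrite mul_scalar_mx -scalemxAl -[(uin A z)%:M]scalemx1.
by rewrite scalemx_centralr ?mulmx1 ?scalerA //; apply: uinC.
Qed.

Inductive ulgen (X : set 'M[A]_n) : set 'M[A]_(n + n) :=
| ul_up b : X b -> ulgen X (up b)
| ul_lo b : X b -> ulgen X (lo b).

(* Squares, because z^2 L, unlike z L, is contained in L for z in k. For z = 1
   this is EQ, see EQ_Esub. *)
Definition Esub (z : k) : set 'M[A]_(n + n) :=
  subgroup_gen (ulgen (fun b => exists2 b0, LamMat L b0 & b = uin A z ^+ 2 *: b0)).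

Lemma Esub_up z b : LamMat L b -> Esub z (up (uin A z ^+ 2 *: b)).
Proof. by move=> Lb; apply/sgen_base/ul_up; exists b. Qed.
Lemma Esub_lo z b : LamMat L b -> Esub z (lo (uin A z ^+ 2 *: b)).
Proof. by move=> Lb; apply/sgen_base/ul_lo; exists b. Qed.

Lemma Esub_mulr z y s : Esub (y * z) s -> Esub y s.
Proof.
apply: sgen_sgen => _ [] _ [b0 Lb0 ->];
rewrite rmorphM /= exprMn_comm; try (by apply: uinC);
rewrite -scalerA; [apply: Esub_up|apply: Esub_lo]; exact: LamMat_in.
Qed.

Lemma Esub_swap z s : Esub z s -> Esub z (swap *m s *m swapV).
Proof.
apply: sgen_conj swap_inv _ _ => _ [] _ [b Lb ->].
  by rewrite swap_up; apply: Esub_lo.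
by rewrite swap_lo; apply: Esub_up.
Qed.

Lemma Esub_swapV z s : Esub z s -> Esub z (swapV *m s *m swap).
Proof.
apply: (sgen_conj (mx_inverse_sym swap_inv)) => _ [] _ [b Lb ->].
  by rewrite swapV_up; apply: Esub_lo.
by rewrite swapV_lo; apply: Esub_up.
Qed.

Lemma Esub_GL z s : Esub z s -> GLmx s.
Proof.
apply: sgen_GL => _ [] b _; [exists (up (- b))|exists (lo (- b))].
  exact: up_inv.
exact: lo_inv.
Qed.

(** A commutator of an [up] and a [lo] through a third index, which exists because n is at least 3.
    Each of the two has level z^2, whence the exponent 4. *)
Lemma hyp_elem z i j y : (2 < n)%N -> i != j ->
  Esub z (hyp (1%:M + (uin A z ^+ 4 * y) *: delta_mx i j)
              (1%:M - (uin A z ^+ 4 * y) *: delta_mx i j)).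
Proof.
move=> n3 ij.
have [l [li lj]] : exists l : 'I_n, i != l /\ l != j.
  have /card_gt0P[l] : (0 < #|~: [set i; j]|)%N.
    by rewrite cardsCs finset.setCK cards2 card_ord ij subn_gt0.
  by rewrite !inE negb_or => /andP[a b]; exists l; rewrite eq_sym.
pose b := y *: delta_mx i l - (lam * bar y) *: delta_mx l i : 'M[A]_n.
pose c := lam *: delta_mx l j - (lam * bar lam) *: delta_mx j l : 'M[A]_n.
have Lb : LamMat L b by apply/lam_gen_LamMat/lam_short.
have Lc : LamMat L c by apply/lam_gen_LamMat/lam_short.
have bc : b *m c = (y * lam) *: delta_mx i j.
  rewrite /b /c mulmxBl !mulmxBr !mul_scale_delta !eqxx (negPf ij) (negPf lj).
  by rewrite (negPf li) !subr0.
have bcb : b *m c *m b = 0.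
  by rewrite bc /b mulmxBr !mul_scale_delta eq_sym (negPf ij) eq_sym (negPf lj) subr0.
have cbc : c *m b *m c = 0.
  by rewrite -mulmxA bc /c mulmxBl !mul_scale_delta eq_sym (negPf ij) eq_sym (negPf li) subr0.
set u := uin A z ^+ 2.
have uC : central u by move=> x; rewrite /u -rmorphXn; apply: uinC.
have := @up_lo (u *: b) (u *: c).
rewrite -!scalemxAl !scalemx_centralr // -!scalemxAl bcb !scaler0 => /(_ erefl).
move=> /(_ (proj1 (LamMat_in z Lb)) (proj1 (LamMat_in z Lc))).
rewrite cbc !scaler0 addr0 bc !scalerA.
have -> : bar lam * u * u * (y * lam) = uin A z ^+ 4 * y.
  by rewrite mulrA -lC !mulrA ulamU mul1r /u !exprS expr0 mulr1 !mulrA.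
move=> E.
(* As c b c = 0, [E] equates the conjugate with the Levi factor times [lo]; dividing by this [lo]
   isolates the Levi factor. *)
rewrite -[X in Esub _ X]mulmx1 -(proj1 (lo_inv (u *: c))) mulmxA -E -scalerN -scalerN.
apply: sgen_mul; last by apply/Esub_lo/LamMatN.
apply: sgen_mul; last by apply/Esub_up/LamMatN.
by apply: sgen_mul; [apply: Esub_up | apply: Esub_lo].
Qed.

(** Matrices with rows in [I] and columns outside [I] have product zero. So N -> 1 + N turns sums
    into products, and single entries suffice. *)
Lemma hyp_unip z (I : {pred 'I_n}) (N : 'M[A]_n) : (2 < n)%N ->
  (forall i j, ~~ ((i \in I) && (j \notin I)) -> N i j = 0) ->
  Esub z (hyp (1%:M + uin A z ^+ 4 *: N) (1%:M - uin A z ^+ 4 *: N)).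
Proof.
move=> n3 N0; set u := uin A z ^+ 4.
have uC : central u by move=> x; rewrite /u -rmorphXn; apply: uinC.
pose S (M : 'M[A]_n) := forall i j, ~~ ((i \in I) && (j \notin I)) -> M i j = 0.
pose P M := S M /\ Esub z (hyp (1%:M + u *: M) (1%:M - u *: M)).
have S_mul M M' : S M -> S M' -> M *m M' = 0.
  move=> SM SM'; apply/matrixP => i j; rewrite !mxE big1 // => l _.
  have [lI|lI] := boolP (l \in I); first by rewrite SM ?mul0r // lI andbF.
  by rewrite SM' ?mulr0 // (negPf lI).
suff [] : P N by [].
rewrite [N]matrix_sum_delta pair_bigA /=.
have P0 : P 0.
  split=> [i j _|]; first by rewrite mxE.
  by rewrite scaler0 addr0 subr0 /hyp ctmx1 // -scalar_mx_block; apply: sgen_one.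
apply: big_ind => // [M M' [SM PM] [SM' PM']|[i j] _ /=].
  split=> [i j h|]; first by rewrite mxE SM ?SM' ?addr0.
  rewrite (_ : hyp _ _ = hyp (1%:M + u *: M) (1%:M - u *: M) *m
                         hyp (1%:M + u *: M') (1%:M - u *: M')).
    exact: sgen_mul.
  have MM (X Y : 'M[A]_n) : S X -> S Y -> (u *: X) *m (u *: Y) = 0.
    by move=> SX SY; rewrite -scalemxAl scalemx_centralr // S_mul // !scaler0.
  rewrite hypM; congr hyp.
    by rewrite mulmxDl mul1mx mulmxDr mulmx1 MM // addr0 scalerDr addrA addrAC.
  by rewrite mulmxBl mul1mx mulmxBr mulmx1 MM // subr0 scalerDr opprD addrA.
have [/andP[iI jI]|h] := boolP ((i \in I) && (j \notin I)); last first.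
  by rewrite N0 // scale0r.
split=> [i' j' h'|].
  rewrite !mxE; case: eqP => [e|_]; last by rewrite mulr0.
  case: eqP => [e'|_]; last by rewrite mulr0.
  by move: h'; rewrite e e' iI jI.
rewrite !scalerA; apply: hyp_elem => //.
by apply: contraNneq jI => <-.
Qed.

End FormParameter.
End Blocks.

(** * General quadratic groups *)

Section Groups.
Variables (k : comNzRingType) (A : uring k) (n : nat).
Local Notation bar := (@ubar k A).
Local Notation lam := (ulam A).
Local Notation "M ^h" := (ctmx bar M) (at level 8, format "M ^h").
Implicit Types (a b c d : 'M[A]_n).
Variables (L : set A) (LF : form_parameter bar lam L).

Let bI := ubarI A.
Let lC := @ulamC k A.
Let lVC := @ulamVC k A.

Lemma ul_delta i j (a : A) : a *: delta_mx (lshift n i) (rshift n j) =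
  block_mx 0 (a *: delta_mx i j) 0 0 :> 'M_(n + n).
Proof.
by rewrite delta_mx_ushift delta_mx_rshift -(row_mx0 _ _ n n) /block_mx scale_col_mx !scale_row_mx !scaler0.
Qed.

Lemma dl_delta i j (a : A) : a *: delta_mx (rshift n i) (lshift n j) =
  block_mx 0 0 (a *: delta_mx i j) 0 :> 'M_(n + n).
Proof.
by rewrite delta_mx_dshift delta_mx_lshift -(row_mx0 _ _ n n) /block_mx scale_col_mx !scale_row_mx !scaler0.
Qed.

Lemma ll_delta i j (a : A) : a *: delta_mx (lshift n i) (lshift n j) =
  block_mx (a *: delta_mx i j) 0 0 0 :> 'M_(n + n).
Proof.
by rewrite delta_mx_ushift delta_mx_lshift -(row_mx0 _ _ n n) /block_mx scale_col_mx !scale_row_mx !scaler0.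
Qed.

Lemma rr_delta i j (a : A) : a *: delta_mx (rshift n i) (rshift n j) =
  block_mx 0 0 0 (a *: delta_mx i j) :> 'M_(n + n).
Proof.
by rewrite delta_mx_dshift delta_mx_rshift -(row_mx0 _ _ n n) /block_mx scale_col_mx !scale_row_mx !scaler0.
Qed.

Lemma upE b : up b = 1%:M + block_mx 0 b 0 0.
Proof. by rewrite (scalar_mx_block n n) add_block_mx !addr0 add0r. Qed.

Lemma loE b : lo b = 1%:M + block_mx 0 0 (bar lam *: b) 0.
Proof. by rewrite (scalar_mx_block n n) add_block_mx !addr0 add0r. Qed.

Lemma up_short i j (a : A) :
  up (a *: delta_mx i j - (lam * bar a) *: delta_mx j i) =
  1%:M + a *: delta_mx (lshift n i) (rshift n j)
       - (lam * bar a) *: delta_mx (lshift n j) (rshift n i).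
Proof.
by rewrite upE !ul_delta -addrA -scaleNr -ul_delta scaleNr ul_delta opp_block_mx add_block_mx !oppr0 !addr0.
Qed.

Lemma up_long i (a : A) :
  up (a *: delta_mx i i) = 1%:M + a *: delta_mx (lshift n i) (rshift n i).
Proof. by rewrite upE ul_delta. Qed.

Lemma lo_short i j (a : A) :
  lo (a *: delta_mx i j - (lam * bar a) *: delta_mx j i) =
  1%:M + (bar lam * a) *: delta_mx (rshift n i) (lshift n j)
       - (bar lam * bar (bar lam * a)) *: delta_mx (rshift n j) (lshift n i).
Proof.
rewrite loE !dl_delta -addrA opp_block_mx add_block_mx !oppr0 !addr0.
rewrite scalerBr !scalerA (barM bI) (barK bI) mulrA ulamVU mul1r.
by rewrite -lC mulrA ulamVU mul1r.
Qed.

Lemma lo_long i (a : A) :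
  lo (a *: delta_mx i i) =
  1%:M + (bar lam * a) *: delta_mx (rshift n i) (lshift n i).
Proof. by rewrite loE dl_delta scalerA. Qed.

Lemma hyp_short i j (a : A) :
  hyp (1%:M + a *: delta_mx i j) (1%:M - a *: delta_mx i j) =
  1%:M + a *: delta_mx (lshift n i) (lshift n j)
       - bar a *: delta_mx (rshift n j) (rshift n i).
Proof.
rewrite /hyp ctmxB // ctmx1 // ctmx_delta // ll_delta rr_delta.
by rewrite (scalar_mx_block n n) opp_block_mx !add_block_mx !oppr0 !addr0 ?add0r.
Qed.

Lemma Esub1_up b : LamMat L b -> Esub L 1 (up b).
Proof. by move=> /(Esub_up 1) h; rewrite rmorph1 expr1n scale1r in h. Qed.

Lemma Esub1_lo b : LamMat L b -> Esub L 1 (lo b).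
Proof. by move=> /(Esub_lo 1) h; rewrite rmorph1 expr1n scale1r in h. Qed.

Lemma hyp_unip1 (I : {pred 'I_n}) (N : 'M[A]_n) : (2 < n)%N ->
  (forall i j, ~~ ((i \in I) && (j \notin I)) -> N i j = 0) ->
  Esub L 1 (hyp (1%:M + N) (1%:M - N)).
Proof.
by move=> n3 /(hyp_unip LF 1 n3) h; rewrite rmorph1 expr1n scale1r in h.
Qed.

(** The generators [q_eps] are products of the others by [hyp_elem]; conversely, [LamMat_ind] splits
    [up b] and [lo b] into root elements. *)
Lemma EQ_Esub (s : 'M[A]_(n + n)) : (2 < n)%N -> EQ bar lam L s <-> Esub L 1 s.
Proof.
move=> n3; split.
  have lup b : lam_gen L b -> Esub L 1 (up b).
    by move=> /(lam_gen_LamMat LF); apply: Esub1_up.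
  have llo b : lam_gen L b -> Esub L 1 (lo b).
    by move=> /(lam_gen_LamMat LF); apply: Esub1_lo.
  apply: sgen_sgen => _ [i j a ij|i j a ij|i a La|i j a ij|i a La].
  - rewrite -hyp_short; have H := hyp_elem LF 1 a n3 ij.
    by rewrite rmorph1 expr1n mul1r in H.
  - by rewrite -up_short; apply/lup/lam_short.
  - by rewrite -up_long; apply/lup/lam_long.
  - have -> : a = bar lam * (lam * a) by rewrite mulrA ulamVU mul1r.
    by rewrite -lo_short; apply/llo/lam_short.
  - have -> : a = bar lam * (lam * a) by rewrite mulrA ulamVU mul1r.
    rewrite -lo_long; apply/llo/lam_long.
    (* [L (bar a)] implies bar a = - lam a, so lam a is the negative of an element of [L]. *)
    by rewrite -[lam * a]opprK -[a](barK bI) -(fp_max LF La); apply: fpN.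
apply: sgen_sgen => _ [] _ [b Lb ->]; rewrite rmorph1 expr1n scale1r.
  move: b Lb; apply: LamMat_ind => [|b c Hb Hc|_ [i j a ij|i a La]].
  - by rewrite up0; apply: sgen_one.
  - by rewrite upD; apply: sgen_mul.
  - by rewrite up_short; apply/sgen_base/q_r.
  - by rewrite up_long; apply/sgen_base/q_rd.
move: b Lb; apply: LamMat_ind => [|b c Hb Hc|_ [i j a ij|i a La]].
- by rewrite lo0; apply: sgen_one.
- by rewrite loD; apply: sgen_mul.
- by rewrite lo_short; apply/sgen_base/q_l.
- rewrite lo_long; apply/sgen_base/q_ld; rewrite (barM bI) (barK bI) -lC.
  by rewrite -[X in L X]opprK -(fp_max LF La); apply: fpN.
Qed.

(** A sesquilinear form whose symmetrization is [psiQ] and whose values on the diagonal, modulo the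
    form parameter, are the quadratic form. *)
Definition Qmx : 'M[A]_(n + n) := block_mx 0 0 1%:M 0.

Lemma psiQE : psiQ lam n = Qmx + lam *: Qmx^h.
Proof.
rewrite /psiQ /Qmx ctmx_block ctmx1 // !ctmx0 // scale_block_mx !scaler0.
by rewrite add_block_mx !addr0 !add0r scalemx1.
Qed.

Lemma psiQ_preserved (s : 'M[A]_(n + n)) : s^h *m psiQ lam n *m s = psiQ lam n <->
  s^h *m Qmx *m s - Qmx = - (lam *: (s^h *m Qmx *m s - Qmx)^h).
Proof.
rewrite ctmxB // !ctmxM // ctmxK // psiQE mulmxDr mulmxDl scalemx_centralr //.
rewrite -scalemxAl mulmxA scalerBr opprB; split=> [e|e].
  by apply/(addIr (lam *: (s^h *m Qmx^h *m s))); rewrite subrK addrAC e addrAC addrN add0r.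
by move/eqP: e; rewrite subr_eq => /eqP ->; rewrite addrAC subrK addrC.
Qed.

(** The Hermitian and the quadratic condition become one condition on s^h Q s - Q, so that products
    and inverses are handled by [LamMat_conj]. *)
Lemma GQ_LamMat (s : 'M[A]_(n + n)) : GQ bar lam L s <->
  GLmx s /\ LamMat (n := n + n) L (s^h *m Qmx *m s - Qmx).
Proof.
have E := psiQ_preserved s.
have D : [/\ forall i, (s^h *m Qmx *m s - Qmx) (lshift n i) (lshift n i) =
             ((dlsubmx s)^h *m ulsubmx s) i i &
             forall i, (s^h *m Qmx *m s - Qmx) (rshift n i) (rshift n i) =
             ((drsubmx s)^h *m ursubmx s) i i].
  rewrite -[s]submxK ctmx_block /Qmx !mulmx_block !mx01E opp_block_mx add_block_mx.
  rewrite !oppr0 !addr0 !block_mxKul !block_mxKdl !block_mxKdr !block_mxKur.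
  by split=> i; rewrite ?block_mxEul ?block_mxEdr.
split=> [[sG /E sE s1 s2]|[sG [/E sE sL]]]; split=> //.
- split=> // i; case: (split_ordP i) => j ->; [rewrite D.1|rewrite D.2] => //.
- by move=> i; rewrite -D.1.
- by move=> i; rewrite -D.2.
Qed.

Lemma GQ1 : GQ bar lam L (1%:M : 'M[A]_(n + n)).
Proof.
apply/GQ_LamMat; split; first by exists 1%:M; apply: mx_inverse1.
by rewrite ctmx1 // mulmx1 mul1mx addrN; apply: LamMat0.
Qed.

Lemma GQM (s t : 'M[A]_(n + n)) : GQ bar lam L s -> GQ bar lam L t -> GQ bar lam L (s *m t).
Proof.
move=> /GQ_LamMat[[s' ss'] Ls] /GQ_LamMat[[t' tt'] Lt]; apply/GQ_LamMat; split.
  by exists (t' *m s'); apply: mx_inverseM.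
rewrite (_ : _ - _ = t^h *m (s^h *m Qmx *m s - Qmx) *m t + (t^h *m Qmx *m t - Qmx)).
  by apply: LamMatD => //; apply: LamMat_conj.
by rewrite mulmxBr mulmxBl addrA subrK ctmxM // !mulmxA.
Qed.

Lemma GQV (s s' : 'M[A]_(n + n)) : GQ bar lam L s -> mx_inverse s s' -> GQ bar lam L s'.
Proof.
move=> /GQ_LamMat[_ Ls] ss'; apply/GQ_LamMat.
split; first by exists s; apply: mx_inverse_sym.
rewrite (_ : _ - _ = - (s'^h *m (s^h *m Qmx *m s - Qmx) *m s')).
  by apply/LamMatN => //; apply: LamMat_conj.
rewrite mulmxBr mulmxBl opprB; congr (_ - _).
rewrite !mulmxA -ctmxM // ss'.1 ctmx1 // mul1mx -mulmxA ss'.1 mulmx1 //.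
Qed.

Lemma GQ_subgroup : is_subgroup (GQ bar lam L (n := n)).
Proof.
split; [by move=> s [] | exact: GQ1 | exact: GQM | exact: GQV].
Qed.

Lemma GQ_up b : GQ bar lam L (up b) <-> LamMat L b.
Proof.
have E : (up b)^h *m Qmx *m up b - Qmx = block_mx 0 0 0 b.
  rewrite /up /Qmx ctmx_block ctmx1 // !ctmx0 // !mulmx_block !mx01E.
  by rewrite opp_block_mx add_block_mx !subrr subr0.
have cE : (block_mx 0 0 0 b)^h = block_mx 0 0 0 b^h :> 'M[A]_(n + n).
  by rewrite ctmx_block !ctmx0.
split=> [/GQ_LamMat[_]|[hb Lb]]; rewrite ?E.
  rewrite /LamMat cE => -[e Lb].
  split=> [|i]; last by have := Lb (rshift n i); rewrite block_mxEdr.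
  by move: e; rewrite scale_block_mx opp_block_mx => /eq_block_mx[_ _ _].
apply/GQ_LamMat; split; first by exists (up (- b)); apply: up_inv.
rewrite E; split; first by rewrite cE scale_block_mx opp_block_mx !scaler0 !oppr0 -hb.
move=> i; case: (split_ordP i) => j ->; rewrite ?block_mxEul ?block_mxEdr //.
by rewrite mxE; apply: fp0.
Qed.

Lemma GQ_hyp a a' : mx_inverse a a' -> GQ bar lam L (hyp a a').
Proof.
move=> aa'; apply/GQ_LamMat; split; first by exists (hyp a' a); apply: hyp_inv.
rewrite /hyp ctmx_block !ctmx0 // ctmxK // /Qmx !mulmx_block !mx01E aa'.2.
rewrite opp_block_mx add_block_mx !subrr /block_mx row_mx0 col_mx0.
exact: LamMat0.
Qed.

Lemma GQ_swap : GQ bar lam L (swap A n).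
Proof.
apply/GQ_LamMat; split; first by exists (swapV A n); apply: swap_inv.
have E : (swap A n)^h *m Qmx *m swap A n - Qmx = block_mx 0 lam%:M (- 1%:M) 0 :> 'M[A]_(n + n).
  rewrite /swap ctmx_block !ctmx0 // ctmx1 // -(scalemx1 _ (bar lam)) ctmx_lamV ctmx1 // scalemx1.
  by rewrite /Qmx !mulmx_block !mx01E opp_block_mx add_block_mx !subrr subr0 sub0r scalemx1.
rewrite E; split.
  rewrite ctmx_block ctmxN // !ctmx0 // ctmx1 // -(scalemx1 _ lam) ctmx_lam ctmx1 //.
  by rewrite scale_block_mx opp_block_mx !scaler0 ulamK scalerN opprK !oppr0.
move=> i; case: (split_ordP i) => j ->; rewrite ?block_mxEul ?block_mxEdr //.
  by rewrite mxE; apply: fp0.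
by rewrite mxE; apply: fp0.
Qed.

Lemma Esub_GQ z (s : 'M[A]_(n + n)) : Esub L z s -> GQ bar lam L s.
Proof.
apply: sgen_sub; first exact: GQ_subgroup.
have Gup b : LamMat L b -> GQ bar lam L (up (uin A z ^+ 2 *: b)).
  by move=> Lb; apply/GQ_up/LamMat_in.
move=> _ [] _ [b Lb ->]; first exact: Gup.
rewrite -swap_up; apply: GQM; first apply: GQM; [exact: GQ_swap|exact: Gup|].
by apply: GQV GQ_swap _; apply: swap_inv.
Qed.

(** The upper right block of the equation for [psiQ] reads a^h lam d = lam, which forces [d] to be
    the inverse of [a^h]. *)
Lemma GQ_uptri a a' b d : mx_inverse a a' -> GQ bar lam L (block_mx a b 0 d) ->
  block_mx a b 0 d = up (b *m a^h) *m hyp a a' /\ LamMat L (b *m a^h).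
Proof.
move=> aa' gG.
have E : block_mx a b 0 d = up (b *m a^h) *m hyp a a'.
  case: gG => _ + _ _; rewrite /psiQ ctmx_block !ctmx0 // !mulmx_block !mx01E.
  move=> /eq_block_mx[_ e _ _].
  have e1 : a^h *m d = 1%:M.
    rewrite -[LHS]ulamVK -scalemx_centralr //; move: e.
    rewrite mul_mx_lam -scalemxAl scalemx_centralr // => ->.
    by rewrite -(scalemx1 _ lam) ulamVK.
  have -> : d = a'^h by rewrite -[LHS]mul1mx -(ctmx1 bI) -aa'.1 ctmxM // -mulmxA e1 mulmx1.
  by rewrite -mulmxA -ctmxM // aa'.2 ctmx1 // mulmx1.
split=> //; apply/GQ_up.
rewrite -[up _]mulmx1 -(hyp_inv aa').1 mulmxA -E.
by apply: GQM => //; apply: GQ_hyp; apply: mx_inverse_sym.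
Qed.

Lemma LamMat_min (M : 'M[A]_n) : LamMat L (M - lam *: M^h).
Proof.
split=> [|i]; last by rewrite !mxE; apply: fp_min LF _.
by rewrite ctmxB // ctmx_lam ctmxK // scalerBr ulamK opprB.
Qed.

End Groups.

(** * Transvections *)

Definition uhom (k : comNzRingType) (A B : uring k) (f : A -> B) : Prop :=
  [/\ forall x, f (ubar x) = ubar (f x), f (ulam A) = ulam B
    & forall c, f (uin A c) = uin B c].

Section Functoriality.
Variables (k : comNzRingType) (A B : uring k) (f : {rmorphism A -> B}) (n : nat).
Hypothesis fU : uhom f.
Variables (LA : set A) (LB : set B).
Hypotheses (LFA : form_parameter (@ubar k A) (ulam A) LA)
           (LFB : form_parameter (@ubar k B) (ulam B) LB).
Hypothesis fL : forall x, LA x -> LB (f x).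

Let fbar x : f (ubar x) = ubar (f x). Proof. by case: fU. Qed.
Let flam : f (ulam A) = ulam B. Proof. by case: fU. Qed.
Let fin c : f (uin A c) = uin B c. Proof. by case: fU. Qed.

Lemma map_ctmx p q (M : 'M[A]_(p, q)) :
  map_mx f (ctmx (@ubar k A) M) = ctmx (@ubar k B) (map_mx f M).
Proof. by apply/matrixP => i j; rewrite !mxE fbar. Qed.

Lemma map_up (b : 'M[A]_n) : map_mx f (up b) = up (map_mx f b).
Proof. by rewrite map_block_mx !map_mx1 map_mx0. Qed.

Lemma map_lo (b : 'M[A]_n) : map_mx f (lo b) = lo (map_mx f b).
Proof. by rewrite map_block_mx !map_mx1 map_mx0 map_mxZ /= fbar flam. Qed.

Lemma map_hyp (a a' : 'M[A]_n) :
  map_mx f (hyp a a') = hyp (map_mx f a) (map_mx f a').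
Proof. by rewrite map_block_mx !map_mx0 map_ctmx. Qed.

Lemma map_swap : map_mx f (swap A n) = swap B n.
Proof. by rewrite map_block_mx !map_mx0 map_mx1 map_scalar_mx /= fbar flam. Qed.

Lemma map_swapV : map_mx f (swapV A n) = swapV B n.
Proof. by rewrite map_block_mx !map_mx0 map_mx1 map_scalar_mx /= flam. Qed.

Lemma map_in z (b : 'M[A]_n) m :
  map_mx f (uin A z ^+ m *: b) = uin B z ^+ m *: map_mx f b.
Proof. by rewrite map_mxZ /= rmorphXn fin. Qed.

Lemma LamMat_map (b : 'M[A]_n) : LamMat LA b -> LamMat LB (map_mx f b).
Proof.
move=> [hb Lb]; split=> [|i]; last by rewrite mxE; apply/fL/Lb.
by rewrite {1}hb map_mxN map_mxZ /= map_ctmx flam.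
Qed.

Lemma Esub_map z (s : 'M[A]_(n + n)) : Esub LA z s -> Esub LB z (map_mx f s).
Proof.
apply: sgen_map => _ [] _ [b Lb ->]; rewrite ?map_up ?map_lo map_in.
  by apply/Esub_up/LamMat_map.
by apply/Esub_lo/LamMat_map.
Qed.

End Functoriality.

Lemma GQ_map (k : comNzRingType) (A B : uring k) (f : {rmorphism A -> B})
    (n : nat) (LA : set A) (LB : set B) (s : 'M[A]_(n + n)) : uhom f ->
  form_parameter (@ubar k A) (ulam A) LA ->
  form_parameter (@ubar k B) (ulam B) LB ->
  (forall x, LA x -> LB (f x)) ->
  GQ (@ubar k A) (ulam A) LA s -> GQ (@ubar k B) (ulam B) LB (map_mx f s).
Proof.
move=> fU LFA LFB fL /GQ_LamMat[[t st] Ls]; apply/GQ_LamMat.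
split; first by exists (map_mx f t); apply: map_mx_inverse.
have := LamMat_map fU fL Ls.
rewrite map_mxB !map_mxM map_ctmx //.
by rewrite /Qmx map_block_mx !map_mx0 map_mx1.
Qed.

Lemma mx_inverse_sq0 (R : pzRingType) n (N : 'M[R]_n) :
  N *m N = 0 -> mx_inverse (1%:M + N) (1%:M - N).
Proof.
move=> NN; split; rewrite mulmxDr mulmx1 ?mulmxN mulmxDl mul1mx ?mulNmx NN.
  by rewrite addr0 addrK.
by rewrite subr0 subrK.
Qed.

Section Transvections.
Variables (k : comNzRingType) (A : uring k) (n : nat).
Local Notation bar := (@ubar k A).
Local Notation lam := (ulam A).
Local Notation "M ^h" := (ctmx bar M) (at level 8, format "M ^h").
Variables (L : set A) (LF : form_parameter bar lam L).

Let bI := ubarI A.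
Let lC := @ulamC k A.
Let lVC := @ulamVC k A.

Definition star (u : 'cV[A]_(n + n)) : 'rV[A]_(n + n) := u^h *m psiQ lam n.

(* The Eichler-Siegel-Dickson transvection
   x |-> x + v h(u, x) - lam^-1 u h(v, x) + u c h(u, x). *)
Definition esd (u v : 'cV[A]_(n + n)) (c : 'M[A]_1) : 'M[A]_(n + n) :=
  1%:M + v *m star u - bar lam *: (u *m star v) + u *m c *m star u.

Lemma star_col (u1 u2 : 'cV[A]_n) :
  star (col_mx u1 u2) = row_mx u2^h (lam *: u1^h).
Proof.
rewrite /star /ctmx map_col_mx tr_col_mx /psiQ mul_row_block.
by rewrite !mx01E -scalemx1 scalemx_centralr // mulmx1.
Qed.

(** A transvection is built from two vectors and the form alone, so an isometry only moves the
    vectors. Elementary generators have no such rule, which is why they are rewritten as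
    transvections. *)
Lemma esd_conj (g g' : 'M[A]_(n + n)) (u v : 'cV_(n + n)) c : GQ bar lam L g -> mx_inverse g g' ->
  g *m esd u v c *m g' = esd (g *m u) (g *m v) c.
Proof.
move=> [_ gpsi _ _] gg'.
have sg w : star w *m g' = star (g *m w).
  rewrite /star ctmxM // -!mulmxA; congr (_ *m _).
  by rewrite -[in LHS]gpsi -!mulmxA gg'.1 mulmx1.
rewrite /esd !(mulmxDr, mulmxDl) mulmx1 gg'.1 -!sg !mulmxN !mulNmx.
by rewrite scalemx_centralr // -scalemxAl !mulmxA.
Qed.

Lemma star_conj (g : 'M[A]_(n + n)) (u v : 'cV_(n + n)) : GQ bar lam L g ->
  star (g *m u) *m (g *m v) = star u *m v.
Proof.
move=> [_ gpsi _ _]; rewrite /star ctmxM //.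
by rewrite -[in RHS]gpsi -!mulmxA.
Qed.

Lemma esd_block (u1 v1 v2 : 'cV[A]_n) c :
  esd (col_mx u1 0) (col_mx v1 v2) c =
  block_mx (1%:M - bar lam *: (u1 *m v2^h))
    (lam *: (v1 *m u1^h) - u1 *m v1^h + lam *: (u1 *m c *m u1^h))
    0 (1%:M + lam *: (v2 *m u1^h)).
Proof.
rewrite /esd !star_col ctmx0 // (scalar_mx_block n n) (mul_col_mx _ _ c) mul0mx !mul_col_row.
rewrite scale_block_mx opp_block_mx !add_block_mx !mx01E.
rewrite ?scaler0 ?oppr0 ?addr0 ?add0r.
by rewrite !scalemx_centralr // ulamVK.
Qed.

Definition basis_lo (i : 'I_n) : 'cV[A]_(n + n) := col_mx (delta_mx i 0) 0.

Lemma esd_elementary i (x x' c : 'M[A]_1) (v : 'cV[A]_(n + n)) : (2 < n)%N ->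
  x *m x' = 1%:M -> star (basis_lo i *m x) *m v = 0 ->
  GQ bar lam L (esd (basis_lo i *m x) v c) -> Esub L 1 (esd (basis_lo i *m x) v c).
Proof.
move=> n3 xx'; rewrite -[v]vsubmxK; set v1 := usubmx v; set v2 := dsubmx v.
rewrite /basis_lo mul_col_mx mul0mx star_col ctmx0 // mul_row_col mul0mx add0r.
rewrite ctmxM // -[delta_mx i 0](scale1r) ctmx_delta // bar1 // !scale1r => v0.
have v2i : delta_mx 0 i *m v2 = 0 :> 'M[A]_1.
  (* [x'^h] is a left inverse of [x^h], which can therefore be cancelled. *)
  apply: (can_inj (g := fun M => bar lam *: (x'^h *m M))
           (f := fun M => lam *: (x^h *m M))) => [M|].
    by rewrite scalemx_centralr // ulamVK mulmxA -ctmxM // xx' ctmx1 // mul1mx.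
  by rewrite !mulmx0 scaler0 mulmxA -v0 -scalemxAl.
have v2i' : v2^h *m delta_mx i 0 = 0 :> 'M[A]_1.
  rewrite -[LHS](ctmxK bI) ctmxM // ctmxK // -[delta_mx i 0](scale1r) ctmx_delta //.
  by rewrite bar1 // scale1r v2i ctmx0.
pose N := - (bar lam *: (delta_mx i 0 *m x *m v2^h)) : 'M[A]_n.
rewrite esd_block -/N; set b := (X in block_mx _ X); set d := (X in block_mx _ _ _ X).
have NN : N *m N = 0.
  rewrite /N mulNmx mulmxN opprK -scalemxAl scalemx_centralr //.
  rewrite -!mulmxA (mulmxA _ (delta_mx i 0)) v2i' mul0mx !mulmx0 !scaler0 //.
have aa' := mx_inverse_sq0 NN.
move=> /(GQ_uptri LF aa')[-> Lb].
apply: sgen_mul; first exact: Esub1_up.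
apply: (hyp_unip1 LF (I := pred1 i)) => // p q; rewrite !inE.
have -> : N p q = - (bar lam * ((p == i)%:R * (x 0 0 * bar (v2 q 0)))).
  by rewrite /N -mulmxA !mxE big_ord1 !mxE big_ord1 !mxE andbT.
have [_|_] := eqVneq p i; last by rewrite mul0r mulr0 oppr0.
rewrite /= negbK => /eqP ->.
have := congr1 (fun M : 'M_1 => M 0 0) v2i; rewrite mxE (bigD1 i) //= big1 ?addr0.
  by rewrite !mxE !eqxx mul1r => ->; rewrite bar0 // !mulr0 oppr0.
by move=> h hi; rewrite mxE (negPf hi) mul0r.
Qed.

(** The vector [v] is taken without lower half: then the diagonal blocks of [esd_block] are trivial,
    and the orthogonality to e_i is automatic. *)
Lemma up_esd b : lam_gen L b -> exists i v c,
  up b = esd (basis_lo i) v c /\ star (basis_lo i) *m v = 0.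
Proof.
have H i (v1 : 'cV[A]_n) c : esd (basis_lo i) (col_mx v1 0) c =
    up (lam *: (v1 *m delta_mx 0 i) - delta_mx i 0 *m v1^h
        + lam *: (delta_mx i 0 *m c *m delta_mx 0 i)) /\
    star (basis_lo i) *m col_mx v1 0 = 0.
  rewrite /basis_lo esd_block star_col !ctmx0 // -[delta_mx i 0](scale1r).
  rewrite ctmx_delta // bar1 // !scale1r; split; last first.
    by rewrite mul_row_col mul0mx mulmx0 addr0.
  by rewrite mulmx0 mul0mx !scaler0 subr0 addr0.
case=> [i j a ij|i a La].
  exists i, (col_mx (- bar a *: delta_mx j 0) 0), 0; case: (H i (- bar a *: delta_mx j 0) 0) => -> ->.
  split=> //; congr up; rewrite mulmx0 mul0mx scaler0 addr0 ctmx_delta // (barN bI) (barK bI).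
  rewrite -[delta_mx 0 i](scale1r) -[delta_mx i 0](scale1r) !mul_scale_delta !eqxx scalerA.
  by rewrite mulr1 mul1r mulrN !scaleNr opprK addrC.
exists i, (col_mx 0 0), ((bar lam * a) *: delta_mx 0 0).
case: (H i 0 ((bar lam * a) *: delta_mx 0 0)) => -> ->.
split=> //; congr up; rewrite mul0mx scaler0 ctmx0 // mulmx0 subr0 add0r.
rewrite -[delta_mx 0 i](scale1r) -[delta_mx i 0](scale1r) !mul_scale_delta !eqxx.
by rewrite scalerA mulr1 mul1r mulrA ulamU mul1r.
Qed.

End Transvections.

Section Normalization.
Variables (k : comNzRingType) (A B : uring k) (f : {rmorphism A -> B}) (n : nat).
Hypothesis fU : uhom f.
Variables (LA : set A) (LB : set B).
Hypotheses (LFA : form_parameter (@ubar k A) (ulam A) LA)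
           (LFB : form_parameter (@ubar k B) (ulam B) LB).
Hypothesis fL : forall x, LA x -> LB (f x).
Hypothesis n3 : (2 < n)%N.

Definition column_reducible : Prop :=
  forall (al : 'M[A]_(n + n)) (i : 'I_n), GQ (@ubar k A) (ulam A) LA al ->
  exists (eps : 'M[A]_(n + n)) (x x' : 'M[A]_1), [/\ Esub LA 1 eps, x *m x' = 1%:M
    & eps *m al *m basis_lo A i = basis_lo A i *m x].

(** Over [A] an elementary [eps] brings al e_i to e_i x. By [esd_conj], eps al then carries a
    transvection along e_i over [B] to one along e_i x, still orthogonal and still in the quadratic
    group, hence elementary. *)
Lemma GQ_normalizes_Esub : column_reducible ->
  forall al al' (s : 'M[B]_(n + n)), GQ (@ubar k A) (ulam A) LA al -> mx_inverse al al' ->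
  Esub LB 1 s -> Esub LB 1 (map_mx f al *m s *m map_mx f al').
Proof.
move=> red.
have Gup al al' (b : 'M[B]_n) : GQ (@ubar k A) (ulam A) LA al -> mx_inverse al al' ->
    LamMat LB b -> Esub LB 1 (map_mx f al *m up b *m map_mx f al').
  move=> alG al_inv; have fal_inv := map_mx_inverse f al_inv.
  move: b; apply: LamMat_ind => [|b c Hb Hc|b].
  - by rewrite up0 mulmx1 fal_inv.1; apply: sgen_one.
  - rewrite (_ : _ *m _ = (map_mx f al *m up b *m map_mx f al') *m
        (map_mx f al *m up c *m map_mx f al')); first exact: sgen_mul.
    by rewrite upD !mulmxA -(mulmxA _ (map_mx f al') (map_mx f al)) fal_inv.2 mulmx1.
  move=> bL; have upG : GQ (@ubar k B) (ulam B) LB (up b).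
    by apply/GQ_up => //; apply: lam_gen_LamMat.
  have [i [v [c [eb v0]]]] := up_esd bL.
  have [eps [x [x' [epsE xx' col]]]] := red al i alG.
  have [eps' eps_inv] := Esub_GL epsE; have feps_inv := map_mx_inverse f eps_inv.
  have fepsE : Esub LB 1 (map_mx f eps) by apply: Esub_map epsE.
  set g := map_mx f eps *m map_mx f al.
  have g_inv : mx_inverse g (map_mx f al' *m map_mx f eps') by apply: mx_inverseM.
  have gG : GQ (@ubar k B) (ulam B) LB g.
    by rewrite /g -map_mxM; apply: (GQ_map fU LFA) => //; apply: GQM => //; apply: Esub_GQ epsE.
  have fb : map_mx f (basis_lo A i) = basis_lo B i.
    by rewrite map_col_mx map_mx0 map_delta_mx.
  have gcol : g *m basis_lo B i = basis_lo B i *m map_mx f x.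
    by rewrite -fb /g -!map_mxM col.
  (* Since [eps] is elementary, eps al may replace al. *)
  suff H : Esub LB 1 (g *m up b *m (map_mx f al' *m map_mx f eps')).
    rewrite (_ : _ *m _ = map_mx f eps' *m (g *m up b *m
        (map_mx f al' *m map_mx f eps')) *m map_mx f eps).
      apply: sgen_mul; last by [].
      by apply: sgen_mul; first by apply: sgen_inv fepsE feps_inv.
    rewrite /g !mulmxA feps_inv.2 mul1mx -!mulmxA feps_inv.2 mulmx1 //.
  have HG : GQ (@ubar k B) (ulam B) LB (g *m up b *m (map_mx f al' *m map_mx f eps')).
    by apply: (GQM LFB); [exact: (GQM LFB) | apply: (GQV LFB) gG g_inv].
  move: HG; rewrite eb (esd_conj _ _ _ gG g_inv) gcol => HG.
  apply: (esd_elementary LFB (x' := map_mx f x')) => //.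
    by rewrite -map_mxM xx' map_mx1.
  by rewrite -gcol (star_conj _ _ gG).
move=> al al' s alG al_inv.
apply: sgen_conj; first exact: map_mx_inverse.
have E (b : 'M[B]_n) : uin B 1 ^+ 2 *: b = b by rewrite rmorph1 expr1n scale1r.
move=> _ [] _ [b Lb ->]; rewrite E; first exact: Gup.
(* [lo b] is the conjugate of [up b] by [swap], and al times [swap] is again in the quadratic
   group. *)
have swG : GQ (@ubar k A) (ulam A) LA (al *m swap A n) by apply: GQM => //; apply: GQ_swap.
have sw_inv := mx_inverseM al_inv (swap_inv A n).
have := Gup _ _ b swG sw_inv Lb.
have -> : map_mx f (al *m swap A n) = map_mx f al *m swap B n.
  by rewrite map_mxM map_swap.
have -> : map_mx f (swapV A n *m al') = swapV B n *m map_mx f al'.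
  by rewrite map_mxM map_swapV.
by rewrite -(swap_up b) !mulmxA.
Qed.

End Normalization.

(** * Absolute stable range *)

Section ResidueField.
Variables (k : comNzRingType) (m : maximal_ideal k).

Lemma mideal0 : 0 \in mideal m. Proof. by case: (mideal_ideal m). Qed.

Lemma midealMr a u : u \in mideal m -> a * u \in mideal m.
Proof.
by case: (mideal_ideal m) => m0 _ mD um; rewrite -[_ * _]addr0; apply: mD.
Qed.

Lemma midealD u v : u \in mideal m -> v \in mideal m -> u + v \in mideal m.
Proof. by case: (mideal_ideal m) => _ _ mD um vm; rewrite -[u]mul1r; apply: mD. Qed.

Lemma mideal_inv s : s \notin mideal m -> exists t, t * s - 1 \in mideal m.
Proof.
move=> sm; pose J : {pred k} := fun x => `[< exists c y, y \in mideal m /\ x = c * s + y >].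
have JP x : reflect (exists c y, y \in mideal m /\ x = c * s + y) (x \in J).
  exact: asboolP.
have [/JP[c [y [ym e]]]|J1] := boolP (1 \in J).
  exists c; rewrite e opprD addrA subrr add0r -mulN1r; exact: midealMr.
have sJ : s \in J by apply/JP; exists 1, 0; rewrite mul1r addr0 mideal0.
case/negP: sm; apply: (@mideal_max _ m J) => // [|x xm].
  split=> //; first by apply/JP; exists 0, 0; rewrite mul0r addr0 mideal0.
  move=> a x y /JP[c [x' [xm ->]]] /JP[d [y' [ym ->]]]; apply/JP.
  exists (a * c + d), (a * x' + y'); split; first by apply: midealD => //; apply: midealMr.
  by rewrite mulrDl mulrDr -!mulrA addrACA.
by apply/JP; exists 0, x; rewrite mul0r add0r.
Qed.

Definition mpred : k -> bool := fun x => x \in mideal m.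
Lemma mpred_ideal : idealr_closed mpred. Proof. exact: mideal_ideal. Qed.
HB.instance Definition _ := isIdealr.Build k mpred mpred_ideal.

Definition mideal_idealr : idealr k := mpred.
Definition residue_ring : comNzRingType := {ideal_quot mideal_idealr}.

Lemma residue_inv_ex (x : residue_ring) : x != 0 -> exists y, y * x = 1.
Proof.
have [y ->] : exists y, x = \pi_({ideal_quot mideal_idealr})%qT y.
  by exists (repr x); rewrite reprK.
rewrite -[0](rmorph0 (\pi_({ideal_quot mideal_idealr})%qT)) -Quotient.idealrBE subr0.
move=> /mideal_inv[t ht]; exists (\pi_({ideal_quot mideal_idealr})%qT t).
rewrite -rmorphM -[1](rmorph1 (\pi_({ideal_quot mideal_idealr})%qT)); apply/eqP.
by rewrite -Quotient.idealrBE.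
Qed.

(** The default value 0 gives the inverse of 0 that the field structure prescribes. *)
Definition residue_inv (x : residue_ring) : residue_ring :=
  xget 0 [set y | y * x = 1]%classic.

Lemma residue_mulVf (x : residue_ring) : x != 0 -> residue_inv x * x = 1.
Proof. by move=> /residue_inv_ex[y yx]; apply: (@xgetPex _ 0 [set y | y * x = 1]%classic); exists y. Qed.

Lemma residue_inv0 : residue_inv 0 = 0.
Proof.
rewrite /residue_inv xgetPN // => y /=; rewrite mulr0 => /esym/eqP.
by rewrite oner_eq0.
Qed.

Definition residue_field : fieldType :=
  HB.pack {ideal_quot mideal_idealr} (GRing.ComNzRing_isField.Build
    {ideal_quot mideal_idealr} residue_mulVf residue_inv0).

(** Hides the quotient: kernel and surjectivity are all that the later arguments see of it. *)
Lemma residue_mapE : exists f : {rmorphism k -> residue_field},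
  (forall x, f x = 0 <-> x \in mideal m) /\ (forall y, exists x, f x = y).
Proof.
exists (\pi_({ideal_quot mideal_idealr})%qT : {rmorphism k -> residue_field}); split.
  move=> x; have H := Quotient.idealrBE mideal_idealr x 0; rewrite subr0 rmorph0 in H.
  have {}H : (x \in mideal m) = (\pi_({ideal_quot mideal_idealr})%qT x == 0) by exact: H.
  by rewrite H; split=> [e|/eqP e]; [apply/eqP; exact: e | exact: e].
by move=> y; exists (repr (y : {ideal_quot mideal_idealr})); exact: reprK.
Qed.
End ResidueField.

(** * The Jacobson radical of a noncommutative ring *)

Section Jacobson.
Variable B : pzRingType.
Implicit Types x y z : B.

(** The Jacobson radical in its description by left quasi-regular elements, which mentions no
    maximal left ideal. *)
Definition jac : set B := fun x => forall y, exists z, z * (1 + y * x) = 1.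

Definition left_ideal (P : set B) : Prop :=
  [/\ P 0, forall x y, P x -> P y -> P (x + y) & forall b x, P x -> P (b * x)].

Lemma jac0 : jac 0. Proof. by move=> y; exists 1; rewrite mulr0 addr0 mulr1. Qed.

Lemma jacMl b x : jac x -> jac (b * x).
Proof. by move=> jx y; rewrite mulrA; apply: jx. Qed.

(** If z is a left inverse of 1 + b x, then z (1 + b (x + y)) = 1 + z b y. *)
Lemma jacD x y : jac x -> jac y -> jac (x + y).
Proof.
move=> jx jy b; have [z hz] := jx b; have [w hw] := jy (z * b).
by exists (w * z); rewrite (mulrDr b) addrA -mulrA mulrDr hz (mulrA z).
Qed.

Lemma jacN x : jac x -> jac (- x).
Proof. by move=> jx y; rewrite mulrN -mulNr. Qed.

(** The passage from 1 + b (y x) to 1 + (y x) b: a left inverse z of the former yields the left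
    inverse 1 - y x z b of the latter. *)
Lemma jacMr b x : jac x -> jac (x * b).
Proof.
move=> jx y; have [z hz] := jx (b * y).
exists (1 - y * x * z * b); rewrite mulrDr mulr1 mulrBl mul1r.
have -> : y * x * z * b * (y * (x * b)) = y * x * (z * (1 + b * y * x)) * b - y * x * z * b.
  by rewrite mulrDr mulr1 mulrDr mulrDl !mulrA addrAC subrr add0r.
by rewrite hz mulr1 opprB !mulrA [X in _ + X]addrC subrK subrK.
Qed.

Lemma jac_left_inv u z : jac (1 - z * u) -> exists z', z' * u = 1.
Proof.
move=> /(_ (-1))[w hw]; exists (w * z); rewrite -mulrA -[RHS]hw.
by rewrite mulN1r opprB addrC subrK.
Qed.

End Jacobson.

(** * Rings that are finite-dimensional over a field modulo the radical *)

Section Coordinates.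
Variables (B : pzRingType) (F : fieldType) (d : nat).
Variables (co : B -> 'rV[F]_d) (rho : B -> 'M[F]_d).
Hypotheses (coD : {morph co : x y / x + y}) (coM : forall x y, co (x * y) = co x *m rho y)
           (co_surj : forall v, exists x, co x = v) (co_ker : forall x, co x = 0 <-> jac x).
Implicit Types (x y z : B) (P : set B).

Lemma eq_rho (M N : 'M[F]_d) : (forall x, co x *m M = co x *m N) -> M = N.
Proof.
move=> h; apply/row_matrixP => i; rewrite !rowE.
by have [x <-] := co_surj (delta_mx 0 i).
Qed.

Lemma rhoM x y : rho (x * y) = rho x *m rho y.
Proof. by apply: eq_rho => z; rewrite -coM mulrA !coM mulmxA. Qed.

Lemma rhoD x y : rho (x + y) = rho x + rho y.
Proof. by apply: eq_rho => z; rewrite mulmxDr -!coM -coD mulrDr. Qed.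

Lemma rho1 : rho 1 = 1%:M.
Proof. by apply: eq_rho => z; rewrite -coM mulr1 mulmx1. Qed.

Lemma rhoN x : rho (- x) = - rho x.
Proof.
have r0 : rho 0 = 0 by apply: (addrI (rho 0)); rewrite -rhoD !addr0.
by apply: (addrI (rho x)); rewrite -rhoD !subrr.
Qed.

Lemma rho_eq0 x : rho x = 0 <-> jac x.
Proof.
split=> [h|jx]; first by rewrite -co_ker -[x]mul1r coM h mulmx0.
by apply: eq_rho => z; rewrite mulmx0 -coM; apply/co_ker/jacMl.
Qed.

Lemma rho_eq x y : rho x = rho y <-> jac (x - y).
Proof.
rewrite -rho_eq0 rhoD rhoN; split=> [->|/eqP]; first by rewrite subrr.
by rewrite subr_eq0 => /eqP.
Qed.

(** The row space of [rho x] is the image under [co] of the left ideal generated by x, so inclusion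
    of row spaces is left divisibility modulo the radical. *)
Lemma rho_sub x z : (rho z <= rho x)%MS <-> exists b, rho z = rho b *m rho x.
Proof.
split=> [h|[b ->]]; last exact: submxMl.
have : (co z <= rho x)%MS by rewrite -[z]mul1r coM (submx_trans _ h) ?submxMl.
case/submxP=> v; have [b <-] := co_surj v; rewrite -coM => e; exists b.
rewrite -rhoM; apply/rho_eq/co_ker.
have coN y : co (- y) = - co y.
  have c0 : co 0 = 0 by apply/co_ker/jac0.
  by apply: (addrI (co y)); rewrite -coD !subrr.
by rewrite coD coN e subrr.
Qed.

Lemma left_inv_full x : (1%:M <= rho x)%MS -> exists z, z * x = 1.
Proof.
rewrite -rho1 => /rho_sub[b]; rewrite -rhoM => /rho_eq.
exact: jac_left_inv.
Qed.

(** One-sided inverses of square matrices over a field are two-sided. Hence z has a left inverse as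
    well, and this must be x. *)
Lemma left_inv_inv x z : z * x = 1 -> x * z = 1.
Proof.
move=> zx; have : rho z *m rho x = 1%:M by rewrite -rhoM zx rho1.
move=> /mulmx1C e; have [w wz] : exists w, w * z = 1.
  by apply: left_inv_full; rewrite -e submxMl.
by rewrite (_ : x = w) // -[w]mulr1 -zx mulrA wz mul1r.
Qed.

Lemma max_rank P x0 : P x0 ->
  exists2 x, P x & forall y, P y -> (\rank (rho y) <= \rank (rho x))%N.
Proof.
move=> Px0; pose p n := `[< exists2 x, P x & \rank (rho x) = n >].
have ex_p : exists n, p n by exists (\rank (rho x0)); apply/asboolP; exists x0.
have ub n : p n -> (n <= d)%N by move=> /asboolP[x _ <-]; apply: rank_leq_row.
case: (ex_maxnP ex_p ub) => n /asboolP[x Px <-] max; exists x => // y Py.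
by apply: max; apply/asboolP; exists y.
Qed.

Lemma min_rank P x0 : P x0 ->
  exists2 x, P x & forall y, P y -> (\rank (rho x) <= \rank (rho y))%N.
Proof.
move=> Px0; pose p n := `[< exists2 x, P x & \rank (rho x) = n >].
have ex_p : exists n, p n by exists (\rank (rho x0)); apply/asboolP; exists x0.
case: (ex_minnP ex_p) => n /asboolP[x Px <-] min; exists x => // y Py.
by apply: min; apply/asboolP; exists y.
Qed.

(** Fitting's argument. Some a0 = y x has 1 + a0 without left inverse; take a power a of a0 of least
    rank. It is nonzero modulo the radical, and a and a^2 have the same rank, so a = b a^2 there and
    b a is the idempotent. *)
Lemma ex_idempotent P x : left_ideal P -> P x -> ~ jac x ->
  exists e, [/\ P e, rho e <> 0 & rho e *m rho e = rho e].
Proof.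
move=> [_ _ PM] Px /existsNP[y ny].
pose a0 := y * x; pose Q a := exists i, a = a0 ^+ i.+1.
have [a [i ai] mina] := @min_rank Q a0 (ex_intro _ 0%N (expr1 _)).
have Pa : P a by rewrite ai exprSr mulrA; apply: PM.
have ranka : \rank (rho a *m rho a) = \rank (rho a).
  apply/eqP; rewrite eqn_leq mxrankM_maxl -rhoM; apply: mina.
  by exists (i + i).+1; rewrite ai -exprD addnS.
have rhoX j : rho (a0 ^+ j.+1) = rho a0 *m rho (a0 ^+ j) by rewrite exprS rhoM.
have a_neq0 : rho a <> 0.
  move=> a00; apply: ny; have [z] : exists z, z * (1 + a0) = 1; last by exists z.
  apply: left_inv_full; rewrite sub1mx row_full_unit -row_free_unit -kermx_eq0; apply/rowV0P => v.
  move=> /sub_kermxP; rewrite rhoD rho1 mulmxDr mulmx1 => /eqP; rewrite addr_eq0 => /eqP e.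
  (* A kernel vector satisfies v = - v a0; iterating reaches the vanishing power of a0. *)
  have {}e j : v = v *m rho ((- a0) ^+ j).
    elim: j => [|j IH]; first by rewrite expr0 rho1 mulmx1.
    by rewrite exprSr rhoM mulmxA -IH rhoN mulmxN -e.
  rewrite (e i.+1) exprNn; have -> : rho ((-1) ^+ i.+1 * a0 ^+ i.+1) = 0.
    by rewrite rhoM -ai a00 mulmx0.
  by rewrite mulmx0.
have sub : (rho a <= rho a *m rho a)%MS.
  by have := mxrank_leqif_sup (submxMl (rho a) (rho a)); rewrite ranka => -[_ <-].
have [b eb] : exists b, rho a = rho b *m rho (a * a) by apply/rho_sub; rewrite rhoM.
exists (b * a); split; first exact: PM.
  by move=> e0; apply: a_neq0; rewrite eb rhoM mulmxA -rhoM e0 mul0mx.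
(* The ranks of a and a^2 agree, so the row space of a meets the kernel of a trivially, and one
   factor a can be cancelled. *)
have ker (M : 'M[F]_d) : M *m rho a *m rho a = 0 -> M *m rho a = 0.
  move=> M0; have : (rho a :&: kermx (rho a))%MS == 0.
    by rewrite -mxrank_eq0 -(eqn_add2l (\rank (rho a *m rho a))) mxrank_mul_ker ranka addn0.
  move/eqP => cap; apply/eqP; rewrite -submx0 -cap sub_capmx submxMl.
  exact/sub_kermxP.
apply/eqP; rewrite -subr_eq0; apply/eqP; rewrite rhoM.
have E : rho b *m rho a *m rho a = rho a by rewrite -mulmxA -rhoM -eb.
set M := rho b *m rho a *m rho b - rho b.
have -> : rho b *m rho a *m (rho b *m rho a) - rho b *m rho a = M *m rho a.
  by rewrite mulmxBl !mulmxA.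
by rewrite -mulmxA in E; apply: ker; rewrite /M !mulmxBl -!mulmxA !E subrr.
Qed.

(** Take an idempotent e of maximal rank in P. If some p (1 - e) were not in the radical, P (1 - e)
    would contain an idempotent f with f e = 0, and e + f - e f would be an idempotent of P with a
    larger row space. *)
Lemma left_ideal_idempotent P : left_ideal P ->
  exists e, [/\ P e, rho e *m rho e = rho e & forall p, P p -> rho p = rho p *m rho e].
Proof.
move=> PL; have [P0 PD PM] := PL.
have rho0 : rho 0 = 0 by apply/rho_eq0/jac0.
have [e [Pe ee] maxe] := @max_rank (fun e => P e /\ rho e *m rho e = rho e) 0
  (conj P0 (etrans (congr1 (mulmx^~ _) rho0) (etrans (mul0mx _ _) (esym rho0)))).
exists e; split=> // p Pp; apply: contrapT => npe.
pose P' x := exists2 p', P p' & x = p' * (1 - e).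
have P'L : left_ideal P'.
  split; [by exists 0; rewrite ?mul0r| |].
    by move=> _ _ [x Px ->] [y Py ->]; exists (x + y); rewrite ?mulrDl //; apply: PD.
  by move=> b _ [x Px ->]; exists (b * x); rewrite ?mulrA //; apply: PM.
have nj : ~ jac (p * (1 - e)).
  by rewrite -rho_eq0 mulrDr mulr1 mulrN rhoD rhoN rhoM => /eqP; rewrite subr_eq0 => /eqP.
have [f [[p' Pp' ef] nf ff]] := ex_idempotent P'L (ex_intro2 _ _ p Pp erefl) nj.
have fe : rho f *m rho e = 0.
  by rewrite ef rhoM -mulmxA rhoD rhoN rho1 mulmxBl mul1mx ee subrr mulmx0.
have Pf : P f.
  by rewrite ef mulrDr mulr1 mulrN -mulNr; apply: PD => //; apply: PM.
pose g := e + f - e * f.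
have rg : rho g = rho e + rho f - rho e *m rho f by rewrite !rhoD rhoN rhoM.
have eg : rho e *m rho g = rho e.
  by rewrite rg mulmxBr mulmxDr mulmxA ee addrK.
have fg : rho f *m rho g = rho f.
  by rewrite rg mulmxBr mulmxDr mulmxA fe ff mul0mx add0r subr0.
have gg : rho g *m rho g = rho g.
  by rewrite {1}rg mulmxBl mulmxDl eg fg -mulmxA fg -rg.
have Pg : P g.
  by rewrite /g -mulNr; exact: PD (PD _ _ Pe Pf) (PM _ _ Pf).
have sub : (rho e <= rho g)%MS by rewrite -eg submxMl.
have := mxrank_leqif_sup sub => -[_ E].
have le := maxe g (conj Pg gg).
have : (rho g <= rho e)%MS by rewrite -E eqn_leq le mxrankS.
move=> /(submx_trans (submxMl (rho f) (rho g))); rewrite fg => /rho_sub[b fb].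
by apply: nf; rewrite fb -ee mulmxA -fb fe.
Qed.

(** For a left ideal N this is a two-sided ideal. *)
Inductive right_span (N : set B) : set B :=
| rs_base n b : N n -> right_span N (n * b)
| rs_add x y : right_span N x -> right_span N y -> right_span N (x + y).

(* Maximizing the rank of x + l leaves a complement on which x + l is
   injective, hence surjective; on the rest, generated by the annihilator of
   x + l, the maximality applies. *)
Lemma absolute_stable_range (x : B) (L : set B) : left_ideal L ->
  exists2 l, L l & forall z, L z -> exists b, jac (z - b * (x + l)).
Proof.
move=> LL; have [L0 LD LM] := LL.
have [x' [l Ll ex'] max] := @max_rank (fun y => exists2 l, L l & y = x + l) x
  (ex_intro2 _ _ 0 L0 (esym (addr0 x))).
exists l => // m Lm; rewrite -ex'; apply: contrapT => nm.
have {}nm : ~ (rho m <= rho x')%MS.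
  by move=> /rho_sub[b]; rewrite -rhoM => /rho_eq h; apply: nm; exists b.
pose N n := rho n *m rho x' = 0.
have NL : left_ideal N.
  split; first by rewrite /N (rho_eq0 0).2 ?mul0mx //; apply: jac0.
    by move=> a b; rewrite /N rhoD mulmxDl => -> ->; rewrite addr0.
  by move=> b a; rewrite /N rhoM -mulmxA => ->; rewrite mulmx0.
have [e [Ne ee Nr]] := left_ideal_idempotent NL.
(* As e x' = 0, multiplying x' + e l1 by 1 - e and by e recovers x' and e l1. Its row space thus
   contains that of x', and equals it by maximality. *)
have claim1 l1 : L l1 -> (rho (e * l1) <= rho x')%MS.
  move=> Ll1; pose x'' := x' + e * l1.
  have s1 : (rho x' <= rho x'')%MS.
    apply/rho_sub; exists (1 - e); rewrite /x'' !rhoD rhoN rhoM rho1 mulmxDr.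
    by rewrite !mulmxBl !mul1mx Ne mulmxA ee subrr subr0 addr0.
  have s2 : (rho (e * l1) <= rho x'')%MS.
    apply/rho_sub; exists e; rewrite /x'' rhoD mulmxDr Ne add0r !rhoM mulmxA.
    by rewrite ee.
  apply: (submx_trans s2).
  have [_ <-] := mxrank_leqif_sup s1; rewrite eqn_leq mxrankS //=.
  apply: max; exists (l + e * l1); last by rewrite addrA -ex'.
  by apply: LD => //; apply: LM.
pose W := right_span N.
have WL : left_ideal W.
  split; [by rewrite -[0](mulr0 0); apply: rs_base; case: NL | exact: rs_add |].
  move=> b w; elim=> [n c Nn|u v _ Hu _ Hv]; last by rewrite mulrDr; apply: rs_add.
  by rewrite mulrA; apply: rs_base; case: NL => _ _; apply.
have Wr w b : W w -> W (w * b).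
  elim=> [n c Nn|u v _ Hu _ Hv]; last by rewrite mulrDl; apply: rs_add.
  by rewrite -mulrA; apply: rs_base.
have claim2 w : W w -> (rho (w * m) <= rho x')%MS.
  elim=> [n b Nn|u v _ Hu _ Hv]; last by rewrite mulrDl rhoD addmx_sub.
  rewrite -mulrA rhoM (Nr n Nn) -mulmxA -rhoM mulmx_sub //.
  by apply: claim1; apply: LM.
(* Modulo the radical, g generates the two-sided ideal W; [gch] and [hbg] together say that g is
   central there. *)
have [g [Wg gg Wgr]] := left_ideal_idempotent WL.
pose h := 1 - g.
have rh : rho h = 1%:M - rho g by rewrite rhoD rhoN rho1.
have gch c : rho g *m rho c *m rho h = 0.
  by rewrite rh mulmxBr mulmx1 -rhoM -Wgr ?subrr //; apply: Wr.
(* The left ideal generated by h b g squares to zero because of [gch], so it contains no nonzero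
   idempotent. *)
have hbg b : rho h *m rho b *m rho g = 0.
  have [//|] := pselect (rho h *m rho b *m rho g = 0).
  rewrite -!rhoM => /rho_eq0 nj.
  pose P x := exists c, x = c * (h * b * g).
  have PL : left_ideal P.
    split; [by exists 0; rewrite mul0r | |].
      by move=> _ _ [u ->] [v ->]; exists (u + v); rewrite (mulrDl u v).
    by move=> u _ [v ->]; exists (u * v); rewrite (mulrA u v).
  have [f [[c ->] nf ff]] := ex_idempotent PL (ex_intro _ 1 (esym (mul1r _))) nj.
  case: nf; rewrite -ff !rhoM.
  by rewrite !mulmxA -(mulmxA _ (rho g) (rho c)) -(mulmxA _ _ (rho h)) gch mulmx0 !mul0mx.
have hbh b : rho h *m rho b = rho h *m rho b *m rho h.
  by rewrite {3}rh mulmxBr mulmx1 hbg subr0.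
(* If b h x' vanishes, then b h lies in N, hence in W, so b h = b h g = 0. Multiplication by x' is
   therefore injective on the row space of h. *)
have hx_rank : \rank (rho h *m rho x') = \rank (rho h).
  rewrite -(mxrank_mul_ker (rho h) (rho x')).
  suff -> : (rho h :&: kermx (rho x'))%MS = 0 by rewrite mxrank0 addn0.
  apply/eqP/rowV0P => v; rewrite sub_capmx => /andP[/submxP[u ->] /sub_kermxP].
  have [b <-] := co_surj u; rewrite -!coM => /co_ker jb.
  have Nb : N (b * h) by rewrite /N -rhoM; apply/rho_eq0.
  apply/co_ker/rho_eq0; rewrite (Wgr (b * h)).
    rewrite rhoM -mulmxA; have := hbg 1; rewrite rho1 mulmx1 => ->.
    by rewrite mulmx0.
  by rewrite -[b * h]mulr1; apply: rs_base.
have hx : (rho h <= rho x')%MS.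
  have s : (rho h *m rho x' <= rho h)%MS by rewrite hbh submxMl.
  apply: submx_trans (submxMl (rho h) (rho x')).
  by have [_ <-] := mxrank_leqif_sup s; rewrite hx_rank.
apply: nm; have -> : rho m = rho (g * m) + rho (h * m).
  by rewrite !rhoM -mulmxDl rh addrC subrK mul1mx.
apply: addmx_sub; first exact: claim2.
by rewrite rhoM hbh; apply: submx_trans hx; apply: submxMl.
Qed.

End Coordinates.

(** * Coordinates over the residue field *)

Section FiniteOverMaximalIdeal.
Variables (k : comNzRingType) (m : maximal_ideal k) (B : pzRingType).
Variable io : {rmorphism k -> B}.
Hypothesis io_jac : forall c, c \in mideal m -> jac (io c).

Definition spans_mod_jac d (g : 'I_d -> B) : Prop :=
  forall x, exists c : 'I_d -> k, jac (x - \sum_i io (c i) * g i).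

Hypothesis span : exists d (g : 'I_d -> B), spans_mod_jac g.

(** The ideal m acts as zero modulo the radical. A spanning family of least size is independent over
    the residue field: a coefficient outside m is invertible modulo m, and would allow its generator
    to be dropped. *)
Lemma jac_coordinates : exists (F : fieldType) (d : nat) (co : B -> 'rV[F]_d)
    (rho : B -> 'M[F]_d),
  [/\ {morph co : x y / x + y}, forall x y, co (x * y) = co x *m rho y,
      forall v, exists x, co x = v & forall x, co x = 0 <-> jac x].
Proof.
have [f [f0 f_surj]] := residue_mapE m.
pose p d := `[< exists g : 'I_d -> B, spans_mod_jac g >].
have ex_p : exists d, p d by case: span => d hd; exists d; apply/asboolP.
case: (ex_minnP ex_p) => d /asboolP[g gS] dmin.
have indep (c : 'I_d -> k) : jac (\sum_i io (c i) * g i) -> forall i, f (c i) = 0.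
  move=> jc i0; apply/f0; apply: contrapT => /negP /mideal_inv[t ht].
  case: d g gS dmin c jc i0 t ht => [|d] g gS dmin c jc i0 t ht; first by case: (i0) => [].

  suff : p d by move/dmin; rewrite ltnn.
  apply/asboolP; exists (fun j => g (lift i0 j)) => x.
  have [c' hc'] := gS x.
  (* The relation, multiplied by t, expresses the generator of index i0 by the others modulo the
     radical, since t c_i0 - 1 lies in m. *)
  exists (fun j => c' (lift i0 j) - c' i0 * t * c (lift i0 j)).
  have -> : x - \sum_i io (c' (lift i0 i) - c' i0 * t * c (lift i0 i)) * g (lift i0 i) =
     (x - \sum_i io (c' i) * g i) + io (c' i0) * (io t * (\sum_i io (c i) * g i) -
       io (t * c i0 - 1) * g i0).
    pose S := \sum_(i < d) io (c (lift i0 i)) * g (lift i0 i).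
    have -> : io t * (\sum_i io (c i) * g i) - io (t * c i0 - 1) * g i0 =
        g i0 + io t * S.
      rewrite (bigD1_ord i0) //= -/S rmorphB rmorphM rmorph1 mulrBl mul1r mulrDr.
      by rewrite opprB mulrA [_ + io t * S]addrC -addrA [_ + (g i0 - _)]addrC subrK addrC.
    have -> : \sum_i io (c' (lift i0 i) - c' i0 * t * c (lift i0 i)) * g (lift i0 i) =
        \sum_i io (c' (lift i0 i)) * g (lift i0 i) - io (c' i0) * (io t * S).
      rewrite !mulr_sumr -sumrB; apply: eq_bigr => i _.
      by rewrite rmorphB mulrBl !rmorphM !mulrA.
    rewrite (bigD1_ord i0) //= opprB opprD mulrDr -!addrA; congr (_ + _).
    by rewrite [- (\sum_(i < d) _) + _]addrCA addKr addrC.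
  apply: jacD => //; apply: jacMl; apply: jacD; first exact: jacMl.
  by apply: jacN; apply: jacMr; apply: io_jac.
have [cf cfP] := choice gS.
pose co x : 'rV[residue_field m]_d := \row_i f (cf x i).
(* By independence the coordinates do not depend on the chosen coefficients; additivity, scaling and
   the kernel all follow from this. *)
have coE x (c : 'I_d -> k) : jac (x - \sum_i io (c i) * g i) -> co x = \row_i f (c i).
  move=> jc; apply/rowP => i; rewrite !mxE; apply/eqP; rewrite -subr_eq0 -rmorphB.
  apply/eqP; apply: (indep (fun i => cf x i - c i)).
  rewrite (_ : \sum_i _ = (x - \sum_i io (c i) * g i) - (x - \sum_i io (cf x i) * g i)).
    by apply: jacD => //; apply: jacN.
  rewrite opprB [RHS]addrC addrA subrK -sumrB.
  by apply: eq_bigr => j _; rewrite rmorphB mulrBl.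
have coD : {morph co : x y / x + y}.
  move=> x y; rewrite (coE _ (fun i => cf x i + cf y i)).
    by apply/rowP => i; rewrite !mxE rmorphD.
  rewrite (_ : _ - _ = (x - \sum_i io (cf x i) * g i) + (y - \sum_i io (cf y i) * g i)).
    exact: jacD.
  rewrite addrACA -opprD -big_split; congr (_ - _).
  by apply: eq_bigr => j _; rewrite rmorphD mulrDl.
have co_ker x : co x = 0 <-> jac x.
  split=> [e|jx]; last first.
    rewrite (coE _ (fun=> 0)); first by apply/rowP => i; rewrite !mxE rmorph0.
    by rewrite big1 ?subr0 // => i _; rewrite rmorph0 mul0r.
  rewrite -[x](subrK (\sum_i io (cf x i) * g i)); apply: jacD => //.
  apply: (big_ind (@jac B)) => [|u v|i _]; [exact: jac0 | exact: jacD |].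
  apply: jacMr; apply: io_jac; apply/f0.
  by move/rowP/(_ i): e; rewrite !mxE.
have coZ c x : co (io c * x) = f c *: co x.
  rewrite (coE _ (fun i => c * cf x i)); first by apply/rowP => i; rewrite !mxE rmorphM.
  rewrite (_ : _ - _ = io c * (x - \sum_i io (cf x i) * g i)); first exact: jacMl.
  by rewrite mulrBr mulr_sumr; congr (_ - _); apply: eq_bigr => i _; rewrite rmorphM mulrA.
have co_cong x y : jac (x - y) -> co x = co y.
  by move=> /co_ker e; rewrite -[x](subrK y) coD e add0r.
have co_sum (h : 'I_d -> B) : co (\sum_i h i) = \sum_i co (h i).
  apply: (big_morph co coD); exact/co_ker/jac0.
exists (residue_field m), d, co, (fun x => \matrix_(i, j) co (g i * x) 0 j); split=> //.
- move=> x y; rewrite (co_cong (x * y) (\sum_i io (cf x i) * (g i * y))); last first.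
    rewrite (_ : _ - _ = (x - \sum_i io (cf x i) * g i) * y); first exact: jacMr.
    by rewrite mulrBl mulr_suml; congr (_ - _); apply: eq_bigr => i _; rewrite mulrA.
  rewrite co_sum; apply/rowP => j; rewrite !mxE summxE.
  by apply: eq_bigr => i _; rewrite coZ !mxE.
- move=> v; have [c hc] := choice (fun i => f_surj (v 0 i)).
  exists (\sum_i io (c i) * g i); rewrite (coE _ c); last by rewrite subrr; apply: jac0.
  by apply/rowP => i; rewrite mxE.
Qed.

Lemma local_absolute_stable_range (x : B) (L : set B) : left_ideal L ->
  exists2 l, L l & forall z, L z -> exists b, jac (z - b * (x + l)).
Proof.
have [F [d [co [rho [coD coM cos cok]]]]] := jac_coordinates.
exact: (absolute_stable_range coD coM cos cok).
Qed.

Lemma local_left_inv_inv (x z : B) : z * x = 1 -> x * z = 1.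
Proof.
have [F [d [co [rho [coD coM cos cok]]]]] := jac_coordinates.
exact: (left_inv_inv coD coM cos cok).
Qed.

End FiniteOverMaximalIdeal.

(** * Column reduction *)

Section ColumnReduction.
Variables (k : comNzRingType) (A : uring k) (n : nat).
Local Notation bar := (@ubar k A).
Local Notation lam := (ulam A).
Local Notation "M ^h" := (ctmx bar M) (at level 8, format "M ^h").
Variables (L : set A) (LF : form_parameter bar lam L).
Hypothesis n3 : (2 < n)%N.
Hypothesis asr : forall (x : A) (P : set A), left_ideal P ->
  exists2 l, P l & forall z, P z -> exists b, jac (z - b * (x + l)).
Hypothesis left_inv_inv : forall x z : A, z * x = 1 -> x * z = 1.

Let bI := ubarI A.
Let lC := @ulamC k A.
Let lVC := @ulamVC k A.

Lemma ctmx_deltac (i : 'I_n) : (delta_mx i 0 : 'cV_n)^h = delta_mx 0 i.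
Proof. by rewrite -[delta_mx i 0](scale1r) ctmx_delta // bar1 // scale1r. Qed.

Lemma ctmx_deltar (i : 'I_n) : (delta_mx 0 i : 'rV_n)^h = delta_mx i 0.
Proof. by rewrite -[delta_mx 0 i](scale1r) ctmx_delta // bar1 // scale1r. Qed.

Lemma deltac_mulE (i p : 'I_n) q (t : 'M[A]_(1, q)) j :
  (delta_mx i 0 *m t) p j = (p == i)%:R * t 0 j.
Proof. by rewrite mxE big_ord1 !mxE andbT. Qed.

Lemma mul_deltarE (i p : 'I_n) q (t : 'M[A]_(q, 1)) j :
  (t *m delta_mx 0 i) j p = t j 0 * (p == i)%:R.
Proof. by rewrite mxE big_ord1 !mxE. Qed.

Lemma deltar_mulE (i : 'I_n) (y : 'cV[A]_n) :
  (delta_mx 0 i *m y) = (y i 0)%:M.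
Proof.
apply/matrixP => p q; rewrite !ord1 !mxE eqxx mulr1n (bigD1 i) //= big1 ?addr0.
  by rewrite !mxE !eqxx mul1r.
by move=> h hi; rewrite mxE (negPf hi) mul0r.
Qed.

Lemma Esub_row l (t : 'rV[A]_n) : t 0 l = 0 ->
  Esub L 1 (hyp (1%:M + delta_mx l 0 *m t) (1%:M - delta_mx l 0 *m t)).
Proof.
move=> tl; apply: (hyp_unip1 LF (I := pred1 l)) => // p q; rewrite deltac_mulE !inE.
have [_|_] := eqVneq p l; last by rewrite mul0r.
by rewrite /= negbK => /eqP ->; rewrite tl mulr0.
Qed.

Lemma Esub_col l (t : 'cV[A]_n) : t l 0 = 0 ->
  Esub L 1 (hyp (1%:M + t *m delta_mx 0 l) (1%:M - t *m delta_mx 0 l)).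
Proof.
move=> tl; apply: (hyp_unip1 LF (I := predC1 l)) => // p q; rewrite mul_deltarE !inE.
have [_|_] := eqVneq q l; last by rewrite mulr0.
by rewrite andbT negbK => /eqP ->; rewrite tl mul0r.
Qed.

Lemma hyp_row_col l (t : 'rV[A]_n) (x y : 'cV[A]_n) :
  hyp (1%:M + delta_mx l 0 *m t) (1%:M - delta_mx l 0 *m t) *m col_mx x y =
  col_mx (x + delta_mx l 0 *m (t *m x)) (y - t^h *m (y l 0)%:M).
Proof.
rewrite mul_block_col !mul0mx addr0 add0r mulmxDl mul1mx ctmxB // ctmx1 //.
by rewrite ctmxM // ctmx_deltac mulmxBl mul1mx -!mulmxA deltar_mulE.
Qed.

Lemma hyp_col_col l (t : 'cV[A]_n) (x y : 'cV[A]_n) :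
  hyp (1%:M + t *m delta_mx 0 l) (1%:M - t *m delta_mx 0 l) *m col_mx x y =
  col_mx (x + t *m (x l 0)%:M) (y - delta_mx l 0 *m (t^h *m y)).
Proof.
rewrite mul_block_col !mul0mx addr0 add0r mulmxDl mul1mx ctmxB // ctmx1 //.
by rewrite ctmxM // ctmx_deltar mulmxBl mul1mx -!mulmxA deltar_mulE.
Qed.

Lemma combination_left_ideal l (y : 'cV[A]_n) :
  left_ideal (fun z => exists2 t : 'rV[A]_n, t 0 l = 0 & z = (t *m y) 0 0).
Proof.
split.
- by exists 0; rewrite ?mul0mx mxE.
- move=> _ _ [t tl ->] [u ul ->]; exists (t + u); first by rewrite mxE tl ul addr0.
  by rewrite mulmxDl [RHS]mxE.
- move=> b _ [t tl ->]; exists (b *: t); first by rewrite mxE tl mulr0.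
  by rewrite -scalemxAl [RHS]mxE.
Qed.

(** By the stable range condition, a combination of the other entries can be added to y_l so that
    these entries become multiples of y_l modulo the radical. [e1] adds the combination, and [e2]
    subtracts the multiples. *)
Lemma reduce_lower l (x y : 'cV[A]_n) : exists (eps : 'M[A]_(n + n)) x' y',
  [/\ Esub L 1 eps, eps *m col_mx x y = col_mx x' y'
    & forall p, p != l -> jac (y' p 0)].
Proof.
have [_ [t tl ->] gen] := asr (y l 0) (combination_left_ideal l y).
pose y1 := y + delta_mx l 0 *m (t *m y).
have y1l : y1 l 0 = y l 0 + (t *m y) 0 0 by rewrite mxE deltac_mulE eqxx mul1r.
have gen' p : exists b, p != l -> jac (y p 0 - b * y1 l 0).
  have [->|pl] := eqVneq p l; first by exists 0.
  have [|b hb] := gen (y p 0); last by exists b; rewrite y1l.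
  exists (delta_mx 0 p); last by rewrite deltar_mulE mxE eqxx.
  by rewrite mxE eq_sym (negPf pl).
have [b hb] := choice gen'.
pose q : 'rV[A]_n := (\col_p (if p == l then 0 else b p))^h.
have ql : q 0 l = 0 by rewrite ctmxE mxE eqxx bar0.
have th : (- t^h) l 0 = 0 by rewrite mxE ctmxE tl bar0 // oppr0.
(* On the lower half, [hyp a a'] acts by the conjugate transpose of [a']; hence [- t^h] in place of
   [t]. *)
pose e1 := hyp (1%:M + (- t^h) *m delta_mx 0 l) (1%:M - (- t^h) *m delta_mx 0 l).
pose e2 := hyp (1%:M + delta_mx l 0 *m q) (1%:M - delta_mx l 0 *m q).
pose x1 := x + (- t^h) *m (x l 0)%:M.
have e1E : e1 *m col_mx x y = col_mx x1 y1.
  by rewrite hyp_col_col ctmxN // mulNmx mulmxN opprK ctmxK.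
exists (e2 *m e1), (x1 + delta_mx l 0 *m (q *m x1)), (y1 - q^h *m (y1 l 0)%:M).
split.
- by apply: sgen_mul; [exact: Esub_row | exact: Esub_col].
- by rewrite -mulmxA e1E hyp_row_col.
move=> p pl.
have -> : (y1 - q^h *m (y1 l 0)%:M) p 0 = y p 0 - b p * y1 l 0.
  have -> : y p 0 = y1 p 0 by rewrite mxE deltac_mulE (negPf pl) mul0r addr0.
  rewrite [LHS]mxE; congr (_ + _); rewrite [LHS]mxE; congr (- _).
  rewrite mxE big_ord1 [X in _ * X]mxE eqxx mulr1n /q ctmxK //.
  by rewrite [X in X * _]mxE (negPf pl).
exact: hb.
Qed.

(** The stable range condition is applied to x_i and the left ideal generated by the other x_p and
    y_l. The remaining y_p lie in the radical, so the modified x_i generates everything modulo the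
    radical; as the column is unimodular, it is left invertible. *)
Lemma reduce_unit l i (x y : 'cV[A]_n) (w : 'rV[A]_(n + n)) : i != l ->
  (forall p, p != l -> jac (y p 0)) -> w *m col_mx x y = 1%:M ->
  exists (eps : 'M[A]_(n + n)) x' y' u',
  [/\ Esub L 1 eps, eps *m col_mx x y = col_mx x' y', u' * x' i 0 = 1
    & x' i 0 * u' = 1].
Proof.
move=> il yJ w1.
pose P z := exists2 z1, (exists2 t : 'rV[A]_n, t 0 i = 0 & z1 = (t *m x) 0 0) &
  exists b, z = z1 + b * y l 0.
have [C0 CD CM] := combination_left_ideal i x.
have PL : left_ideal P.
  split; first by exists 0 => //; exists 0; rewrite mul0r addr0.
    move=> _ _ [z Cz [b ->]] [z' Cz' [b' ->]]; exists (z + z'); first exact: CD.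
    by exists (b + b'); rewrite mulrDl addrACA.
  move=> c _ [z Cz [b ->]]; exists (c * z); first exact: CM.
  by exists (c * b); rewrite mulrDr mulrA.
have [_ [_ [t ti ->] [b ->]] gen] := asr (x i 0) PL.
set u := x i 0 + _ in gen.
(* The left ideal generated by u and the radical; it will contain all entries of the column, hence
   1. *)
pose I z := exists c, jac (z - c * u).
have ID z z' : I z -> I z' -> I (z + z').
  move=> [c hc] [c' hc']; exists (c + c'); rewrite mulrDl opprD addrACA.
  exact: jacD.
have IM a z : I z -> I (a * z).
  by move=> [c hc]; exists (a * c); rewrite -mulrA -mulrBr; apply: jacMl.
have IJ z : jac z -> I z by move=> jz; exists 0; rewrite mul0r subr0.
have Il : I ((t *m x) 0 0 + b * y l 0).
  by apply: gen; exists ((t *m x) 0 0); [exists t | exists b].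
have Ixi : I (x i 0).
  rewrite -[x i 0](addrK ((t *m x) 0 0 + b * y l 0)) -/u -mulN1r.
  apply: ID; last exact: IM.
  by exists 1; rewrite mul1r subrr; apply: jac0.
have Ix p : I (x p 0).
  have [->//|pi] := eqVneq p i; apply: gen; exists (x p 0); last by exists 0; rewrite mul0r addr0.
  exists (delta_mx 0 p); last by rewrite deltar_mulE mxE eqxx.
  by rewrite mxE eq_sym (negPf pi).
have Iy p : I (y p 0).
  have [->|pl] := eqVneq p l; last by apply/IJ/yJ.
  by apply: gen; exists 0 => //; exists 1; rewrite mul1r add0r.
have I1 : I 1.
  have -> : 1 = (w *m col_mx x y) 0 0 by rewrite w1 mxE.
  rewrite mxE; apply: big_ind => [||p _]; [exact/IJ/jac0|exact: ID|].
  apply: IM; case: (split_ordP p) => p' ->; rewrite ?col_mxEu ?col_mxEd //.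
have [z zu] : exists z, z * u = 1 by case: I1 => c /jac_left_inv.
pose e1 := hyp (1%:M + delta_mx i 0 *m t) (1%:M - delta_mx i 0 *m t).
pose c : 'M[A]_n := b *: delta_mx i l - (lam * bar b) *: delta_mx l i.
pose x1 := x + delta_mx i 0 *m (t *m x); pose y1 := y - t^h *m (y i 0)%:M.
have e1E : e1 *m col_mx x y = col_mx x1 y1 by apply: hyp_row_col.
(* [e1] is meant for the upper half, but changes y_l by a multiple of y_i. This lies in the radical
   because i differs from l. *)
have jy1 : jac (y1 l 0 - y l 0).
  rewrite /y1 !mxE big_ord1 !mxE eqxx mulr1n addrAC subrr add0r.
  by apply/jacN/jacMl/yJ.
have uE : (x1 + c *m y1) i 0 = u + b * (y1 l 0 - y l 0).
  have -> : (x1 + c *m y1) i 0 = x1 i 0 + b * y1 l 0.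
    rewrite mxE; congr (_ + _); rewrite mxE (bigD1 l) //= big1 ?addr0.
      by rewrite !mxE !eqxx (negPf il) mulr1 mulr0 subr0.
    by move=> h hl; rewrite !mxE (negPf hl) (negPf il) !andbF !mulr0 subr0 mul0r.
  rewrite mxE deltac_mulE eqxx mul1r mulrBr /u -!addrA; congr (_ + (_ + _)).
  by rewrite addrCA subrr addr0.
have [z' z'u] : exists z', z' * (x1 + c *m y1) i 0 = 1.
  apply: (@jac_left_inv _ _ z); rewrite uE mulrDr zu opprD addrA subrr add0r.
  by apply/jacN/jacMl/jacMl.
exists (up c *m e1), (x1 + c *m y1), y1, z'; split => //.
- apply: sgen_mul; last exact: Esub_row.
  by apply: Esub1_up; apply: lam_gen_LamMat => //; apply: lam_short.
- by rewrite -mulmxA e1E mul_block_col !mul1mx mul0mx add0r.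
- exact: left_inv_inv.
Qed.

(** The unit x_i clears the upper half, and [lo c] the lower one. Column i of [c] is thereby
    prescribed; its diagonal entry must lie in [L], and it does because the matrix preserves the
    quadratic form. *)
Lemma reduce_final (al : 'M[A]_(n + n)) i (x y : 'cV[A]_n) u' :
  GQ bar lam L al -> al *m basis_lo A i = col_mx x y ->
  u' * x i 0 = 1 -> x i 0 * u' = 1 ->
  exists eps : 'M[A]_(n + n), Esub L 1 eps /\
    eps *m al *m basis_lo A i = basis_lo A i *m (x i 0)%:M.
Proof.
move=> alG alE u'u uu'; set u := x i 0 in u'u uu' *.
pose q : 'cV[A]_n := \col_p (if p == i then 0 else - (x p 0 * u')).
have qi : q i 0 = 0 by rewrite mxE eqxx.
pose e1 := hyp (1%:M + q *m delta_mx 0 i) (1%:M - q *m delta_mx 0 i).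
pose y1 := y - delta_mx i 0 *m (q^h *m y).
have e1E : e1 *m al *m basis_lo A i = col_mx (delta_mx i 0 *m u%:M) y1.
  rewrite -mulmxA alE /e1 hyp_col_col; congr col_mx; apply/colP => p.
  rewrite deltac_mulE !mxE big_ord1 !mxE eqxx !mulr1n.
  have [->|pi] := eqVneq p i; first by rewrite mul0r mul1r addr0.
  by rewrite mul0r mulNr -mulrA u'u mulr1 subrr.
have e1S : Esub L 1 e1 by apply: Esub_col.
have e1G : GQ bar lam L (e1 *m al) by apply: (GQM LF) => //; apply: (Esub_GQ LF) e1S.
(* The value of the quadratic form at column i, where the upper half is already reduced to u. *)
have Ly : L (bar (y1 i 0) * u).
  have /GQ_LamMat[_ [_ /(_ (lshift n i))]] := e1G.
  have Qii : Qmx A n (lshift n i) (lshift n i) = 0 by rewrite block_mxEul mxE.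
  rewrite mxE [X in _ + X]mxE Qii oppr0 addr0.
  have entry (M : 'M[A]_(n + n)) p : M p p =
      ((delta_mx 0 p : 'rV_(n + n)) *m M *m (delta_mx p 0 : 'cV_(n + n))) 0 0.
    by rewrite -colE mxE -rowE mxE.
  have bE : basis_lo A i = delta_mx (lshift n i) 0 :> 'M_(_, 1).
    by rewrite delta_mx_ushift.
  have bhE : (basis_lo A i)^h = delta_mx 0 (lshift n i).
    by rewrite bE -[delta_mx _ _](scale1r) ctmx_delta // bar1 // scale1r.
  have qE (g : 'M[A]_(n + n)) : (basis_lo A i)^h *m (g^h *m Qmx A n *m g) *m basis_lo A i =
      (g *m basis_lo A i)^h *m Qmx A n *m (g *m basis_lo A i).
    by rewrite ctmxM // !mulmxA.
  rewrite entry -bE -bhE qE e1E.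
  rewrite /ctmx map_col_mx tr_col_mx -/(ctmx bar _) -/(ctmx bar y1) mul_row_block !mx01E.
  rewrite mul_row_col mul0mx addr0 mulmxA -ctmx_deltar -ctmxM // deltar_mulE.
  by rewrite !mxE big_ord1 !mxE eqxx !mulr1n.
(* Conjugating bar y_i u by u' gives bar (y_i u'), and an element of [L] equals - lam times its
   conjugate. *)
have Lq : L (- lam * (y1 i 0 * u')).
  have := fp_conj LF u' Ly; rewrite !mulrA -(mulrA _ u) uu' mulr1 => /[dup] h.
  rewrite {1}(fp_max LF h) (barM bI) !(barK bI) => h'.
  by rewrite !mulNr -mulrA.
pose r : 'cV[A]_n := \col_p (if p == i then 0 else - (lam * (y1 p 0 * u'))).
(* Column i away from the diagonal is completed to a skew matrix; the diagonal entry is added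
   separately, as r vanishes at i. *)
pose c : 'M[A]_n := (r *m delta_mx 0 i - lam *: (r *m delta_mx 0 i)^h) +
   (- lam * (y1 i 0 * u')) *: delta_mx i i.
have cL : LamMat L c.
  apply: (LamMatD LF); first exact: LamMat_min.
  by apply: lam_gen_LamMat => //; apply: lam_long.
exists (lo c *m e1); split; first by apply: sgen_mul => //; apply: Esub1_lo.
rewrite -!mulmxA (mulmxA e1) e1E mul_block_col !mul1mx mul0mx addr0 /basis_lo mul_col_mx mul0mx.
congr col_mx; rewrite mulmxA.
have cE p : (c *m (delta_mx i 0 : 'cV_n)) p 0 = - (lam * (y1 p 0 * u')).
  have gen (M N P : 'M[A]_n) (z : A) : (M - z *: N + P) p i = M p i - z * N p i + P p i.
    by rewrite !mxE.
  rewrite -colE [LHS]mxE gen ctmxE !mul_deltarE eqxx [r i 0]mxE eqxx.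
  have gen2 (M : 'M[A]_n) (z : A) : (z *: M) p i = z * M p i by rewrite mxE.
  have deltaE : (delta_mx i i : 'M[A]_n) p i = (p == i)%:R by rewrite mxE eqxx andbT.
  rewrite gen2 deltaE [r p 0]mxE.
  have [->|pi] := eqVneq p i; first by rewrite mul0r bar0 // mulr0 subrr add0r mulr1 mulNr.
  by rewrite mul0r bar0 // mulr0 subr0 mulr0 addr0 mulr1.
rewrite -scalemxAl; apply/colP => p; rewrite [LHS]mxE [RHS]mxE.
have -> : ((bar lam *: (c *m (delta_mx i 0 : 'cV_n))) *m u%:M) p 0 = - y1 p 0.
  rewrite [LHS]mxE big_ord1 [X in X * _]mxE cE [X in _ * X]mxE eqxx mulr1n.
  by rewrite mulrN mulNr !mulrA ulamVU mul1r -mulrA u'u mulr1.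
by rewrite addNr.
Qed.

Theorem columns_reducible : column_reducible n L.
Proof.
move=> al i alG; have [l il] : exists l : 'I_n, i != l.
  have /card_gt0P[l] : (0 < #|~: [set i]|)%N.
    by rewrite cardsCs finset.setCK cards1 card_ord subn_gt0 (ltn_trans _ n3).
  by rewrite !inE => h; exists l; rewrite eq_sym.
have [[al' [aa' a'a]] _ _ _] := alG.
pose x0 := usubmx (al *m basis_lo A i); pose y0 := dsubmx (al *m basis_lo A i).
have c0 : al *m basis_lo A i = col_mx x0 y0 by rewrite vsubmxK.
have [e1 [x1 [y1 [e1S c1 yJ]]]] := reduce_lower l x0 y0.
have [e1' [e1e1' e1'e1]] := Esub_GL e1S.
have bE : delta_mx 0 (lshift n i) *m basis_lo A i = 1%:M.
  rewrite (_ : basis_lo A i = delta_mx (lshift n i) 0); last by rewrite delta_mx_ushift.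
  by rewrite mul_delta_mx; apply/matrixP => p q; rewrite !ord1 !mxE eqxx.
have [|e2 [x2 [y2 [u' [e2S c2 u'u uu']]]]] :=
  @reduce_unit l i x1 y1 (delta_mx 0 (lshift n i) *m al' *m e1') il yJ.
  by rewrite -c1 -c0 -!mulmxA (mulmxA e1') e1'e1 mul1mx (mulmxA al') a'a mul1mx bE.
have a2G : GQ bar lam L (e2 *m e1 *m al).
  apply: (GQM LF) => //; apply: (Esub_GQ LF (z := 1)); exact: sgen_mul.
have c2' : e2 *m e1 *m al *m basis_lo A i = col_mx x2 y2.
  by rewrite -!mulmxA c0 c1 c2.
have [e3 [e3S c3]] := reduce_final a2G c2' u'u uu'.
exists (e3 *m (e2 *m e1)), (x2 i 0)%:M, u'%:M; split.
- by apply: sgen_mul => //; apply: sgen_mul.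
- by rewrite -scalar_mxM uu'.
- by rewrite -c3 !mulmxA.
Qed.

End ColumnReduction.

(** * Conjugation over a localization *)

(** Stated by properties, so that it covers R_m, R_m[X] and R_m[X][T] alike. The kernel need not be
    zero. *)
Definition is_localization (k : comNzRingType) (S : set k) (A B : uring k)
    (f : A -> B) : Prop :=
  (forall x, f x = 0 -> exists2 s, S s & uin A s * x = 0) /\
  (forall y, exists2 s, S s & exists x, uin B s * y = f x).

Definition mul_closed (k : comNzRingType) (S : set k) : Prop :=
  S 1 /\ forall s t, S s -> S t -> S (s * t).

Section Conjugation.
Variables (k : comNzRingType) (S : set k) (SM : mul_closed S).
Variables (A B : uring k) (f : {rmorphism A -> B}) (n : nat).
Hypotheses (fU : uhom f) (f_loc : is_localization S f).
Variables (LA : set A) (LB : set B).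
Hypotheses (LFA : form_parameter (@ubar k A) (ulam A) LA)
           (LFB : form_parameter (@ubar k B) (ulam B) LB).
Hypothesis fL : forall x, LA x -> LB (f x).
Hypothesis clearL : forall q, LB q ->
  exists2 t, S t & exists2 z, LA z & uin B t ^+ 2 * q = f z.
Hypothesis n3 : (2 < n)%N.
Local Notation "M ^f" := (map_mx f M) : ring_scope.

Let fbar x : f (ubar x) = ubar (f x). Proof. by case: fU. Qed.
Let flam : f (ulam A) = ulam B. Proof. by case: fU. Qed.
Let fin c : f (uin A c) = uin B c. Proof. by case: fU. Qed.
Let bIA := ubarI A.
Let bIB := ubarI B.
Let inAC := @uinC k A.
Let inBC := @uinC k B.

(** Written without the inverse of [g], so that successive conjugations compose by associativity. *)
Definition conj_into (g : 'M[B]_(n + n)) s (x : 'M[A]_(n + n)) : Prop :=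
  exists2 y, Esub LA s y & g *m x^f = y^f *m g.

Lemma conj_into1 g s : conj_into g s 1%:M.
Proof. by exists 1%:M; rewrite ?map_mx1 ?mulmx1 ?mul1mx //; apply: sgen_one. Qed.

Lemma conj_intoM g s x x' : conj_into g s x -> conj_into g s x' ->
  conj_into g s (x *m x').
Proof.
move=> [y Ey e] [y' Ey' e']; exists (y *m y'); first exact: sgen_mul.
by rewrite !map_mxM mulmxA e -mulmxA e' mulmxA.
Qed.

Lemma conj_intoV g s x x' : mx_inverse x x' -> conj_into g s x ->
  conj_into g s x'.
Proof.
move=> xx' [y Ey e]; have [y' yy'] := Esub_GL Ey.
exists y'; first exact: sgen_inv Ey yy'.
have [fxx' _] := map_mx_inverse f xx'; have [_ fy'y] := map_mx_inverse f yy'.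
by rewrite -[LHS]mul1mx -fy'y -(mulmxA y'^f) (mulmxA y^f) -e -(mulmxA g) fxx' mulmx1.
Qed.

Lemma conj_into_gen g s t : (forall b, LamMat LA b -> conj_into g s (up (uin A t ^+ 2 *: b))) ->
  (forall b, LamMat LA b -> conj_into g s (lo (uin A t ^+ 2 *: b))) ->
  forall x, Esub LA t x -> conj_into g s x.
Proof.
move=> Hu Hl x; elim=> [_ [] _ [b Lb ->]||u v _ Hu' _ Hv|u v _ Hu' uv].
- exact: Hu.
- exact: Hl.
- exact: conj_into1.
- exact: conj_intoM.
- exact: conj_intoV uv Hu'.
Qed.

Definition supported (R : pzRingType) (I : {pred 'I_n}) (M : 'M[R]_n) : Prop :=
  forall i j, ~~ ((i \in I) && (j \in I)) -> M i j = 0.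

Definition null_block (R : pzRingType) (I : {pred 'I_n}) (M : 'M[R]_n) : Prop :=
  forall i j, i \in I -> j \in I -> M i j = 0.

Section SingleRoot.
Variables (I : {pred 'I_n}) (p : 'M[B]_n) (q : 'M[A]_n) (t0 : k).
Hypotheses (pL : LamMat LB p) (qL : LamMat LA q).
Hypotheses (pI : supported I p) (qI : supported I q).
Hypothesis pq : uin B t0 ^+ 2 *: p = q^f.

(** The support of p and the null block of ga give p ga p = 0, so [up_lo] applies over [B]. In t^2
    the factor t0^2 turns p into q, and the remaining s^4 is the level that [hyp_unip] requires. *)
Lemma conj_up_lo s c (ga : 'M[A]_n) : LamMat LA ga -> null_block I ga ->
  conj_into (up p) s (lo (uin A (s ^+ 2 * t0 * c) ^+ 2 *: ga)).
Proof.
move=> gL g0; set t := s ^+ 2 * t0 * c.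
have tC : central (uin A t ^+ 2) by move=> x; rewrite -rmorphXn; apply: inAC.
have tBC : central (uin B t ^+ 2) by move=> x; rewrite -rmorphXn; apply: inBC.
have lVC := @ulamVC k A; have lVCB := @ulamVC k B.
have gfL : LamMat LB ga^f by apply: LamMat_map gL.
have pgp : p *m ga^f *m p = 0.
  apply/matrixP => i j; rewrite !mxE big1 // => l _.
  have [lI|lI] := boolP (l \in I); last first.
    by rewrite [p l j]pI ?mulr0 // (negPf lI).
  rewrite mxE big1 ?mul0r // => h _.
  have [hI|hI] := boolP (h \in I); first by rewrite mxE g0 // rmorph0 mulr0.
  by rewrite pI ?mul0r // (negPf hI) andbF.
pose N := uin A c ^+ 2 *: (ubar (ulam A) *: (q *m ga)).
have N0 i j : ~~ ((i \in I) && (j \notin I)) -> N i j = 0.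
  move=> ij; rewrite mxE [X in _ * X]mxE mxE big1 ?mulr0 // => l _.
  have [iI|iI] := boolP (i \in I); last by rewrite qI ?mul0r // (negPf iI).
  have [lI|lI] := boolP (l \in I); last by rewrite qI ?mul0r // (negPf lI) andbF.
  by rewrite g0 ?mulr0 //; move: ij; rewrite iI negbK.
pose de := ubar (ulam A) *: (ga *m q *m ga).
have deL : LamMat LA de.
  rewrite (_ : de = - (ctmx (@ubar k A) ga *m q *m ga)).
    by apply/(LamMatN LFA)/(LamMat_conj LFA).
  have e : ctmx (@ubar k A) ga = - (ubar (ulam A) *: ga).
    by rewrite [in RHS]gL.1 scalerN ulamVK opprK.
  by rewrite e !mulNmx opprK /de -!scalemxAl.
exists (hyp (1%:M + uin A s ^+ 4 *: N) (1%:M - uin A s ^+ 4 *: N) *m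
        lo (uin A t ^+ 2 *: (ga + uin A (s ^+ 2 * c) ^+ 2 *: de))).
  apply: sgen_mul; first exact: (hyp_unip LFA s n3 N0).
  apply: (@Esub_mulr _ _ _ _ LFA (s * t0 * c)).
  rewrite (_ : s * _ = t); last by rewrite /t; ring.
  by apply: Esub_lo; apply: (LamMatD LFA) => //; apply: LamMat_in.
have cL : LamMat LB (uin B t ^+ 2 *: ga^f) by apply: LamMat_in.
have pcp : p *m (uin B t ^+ 2 *: ga^f) *m p = 0.
  by rewrite scalemx_centralr // -scalemxAl pgp scaler0.
have E := up_lo pcp pL.1 cL.1.
have tt0 : uin B t ^+ 2 = uin B (s ^+ 2 * c) ^+ 2 * uin B t0 ^+ 2.
  by rewrite -!rmorphXn -rmorphM; congr (uin B _); rewrite /t; ring.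
have fN : (1%:M + uin A s ^+ 4 *: N)^f = 1%:M + ubar (ulam B) *: (p *m (uin B t ^+ 2 *: ga^f)) /\
   (1%:M - uin A s ^+ 4 *: N)^f = 1%:M - ubar (ulam B) *: (p *m (uin B t ^+ 2 *: ga^f)).
  suff e : (uin A s ^+ 4 *: N)^f = ubar (ulam B) *: (p *m (uin B t ^+ 2 *: ga^f)).
    by rewrite map_mxD map_mxB e !map_mx1.
  rewrite (map_in fU) /N (map_in fU) map_mxZ /= fbar flam map_mxM -pq.
  rewrite scalemx_centralr // tt0 -!scalemxAl !scalerA; congr (_ *: _).
  rewrite [RHS]lVCB -mulrA (lVCB (uin B t0 ^+ 2)) mulrA; congr (_ * _).
  by rewrite -!rmorphXn -!rmorphM; congr (uin B _); ring.
rewrite map_mxM (map_hyp fU) fN.1 fN.2 !(map_lo fU) !(map_in fU).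
rewrite -[in RHS]mulmxA; move: E => /(congr1 (mulmx^~ (up p))).
rewrite -[in LHS]mulmxA (up_inv p).2 mulmx1 => ->; rewrite -mulmxA.
congr (_ *m (lo _ *m _)).
rewrite map_mxD (map_in fU) /de map_mxZ /= fbar flam !map_mxM -pq scalerDr.
congr (_ + _); rewrite -!scalemxAl !scalemx_centralr //; last first.
  by move=> x; rewrite -rmorphXn; apply: inBC.
rewrite -!scalemxAl !scalerA; congr (_ *: _).
rewrite -mulrA [LHS]lVCB -[RHS]mulrA (lVCB (uin B t0 ^+ 2)) !mulrA.
by congr (_ * _); rewrite -!rmorphXn -!rmorphM /t; congr (uin B _); ring.
Qed.

(** With a = 1 - e d, passing [up p] across the Levi matrix costs the factor up (p - a p a^h). Every
    term of this difference contains e, which clears the denominator of p and leaves s^2. *)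
Lemma conj_up_hyp s c i j : i != j ->
  conj_into (up p) s (hyp (1%:M - uin A ((s ^+ 2 * t0) ^+ 2 * c) *: delta_mx i j)
                          (1%:M + uin A ((s ^+ 2 * t0) ^+ 2 * c) *: delta_mx i j)).
Proof.
move=> ij; set e := _ * c.
pose y := - uin A (t0 ^+ 2 * c).
have ey : uin A s ^+ 4 * y = - uin A e.
  by rewrite mulrN -!rmorphXn -rmorphM; congr (- uin A _); rewrite /e; ring.
have hE : Esub LA s (hyp (1%:M - uin A e *: delta_mx i j) (1%:M + uin A e *: delta_mx i j)).
  by have := hyp_elem LFA s y n3 ij; rewrite ey scaleNr opprK.
set H := hyp _ _ in hE *; set d : 'M[A]_n := delta_mx i j.
have dd : (uin A e *: d) *m (uin A e *: d) = 0.
  by rewrite mul_scale_delta eq_sym (negPf ij).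
have aa' : mx_inverse (1%:M - uin A e *: d) (1%:M + uin A e *: d).
  exact/mx_inverse_sym/mx_inverse_sq0.
have dh : ctmx (@ubar k A) d = delta_mx j i.
  by rewrite -[d](scale1r) ctmx_delta // bar1 // scale1r.
pose M1 := (uin A (s ^+ 2 * c) *: d) *m q - ulam A *: ctmx (@ubar k A) ((uin A (s ^+ 2 * c) *: d) *m q).
pose M2 := d *m q *m ctmx (@ubar k A) d.
(* s^2 r is mapped to p - a p a^h: [M1] is its part linear in e, and [M2] its quadratic part. *)
pose r := M1 - uin A (s ^+ 3 * t0 * c) ^+ 2 *: M2.
have rL : LamMat LA r.
  apply: (LamMatD LFA); first exact: LamMat_min.
  by apply/(LamMatN LFA)/(LamMat_in LFA)/(LamMat_conj' LFA).
exists (up (uin A s ^+ 2 *: r) *m H); first by apply: sgen_mul => //; apply: Esub_up.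
have E : up p *m (H^f) = up (p - (1%:M - uin A e *: d)^f *m p *m ctmx (@ubar k B) (1%:M - uin A e *: d)^f) *m H^f *m up p.
  have faa' := map_mx_inverse f aa'.
  have h := hyp_up p faa'.
  have {}h := congr1 (mulmx^~ (hyp (1%:M - uin A e *: d)^f (1%:M + uin A e *: d)^f)) h.
  rewrite -mulmxA (hyp_inv faa').2 mulmx1 in h.
  by rewrite /H (map_hyp fU) -mulmxA h mulmxA -upD subrK.
rewrite E map_mxM map_up; congr (up _ *m _ *m _).
have M1E : M1 = uin A (s ^+ 2 * c) *: (d *m q + q *m delta_mx j i).
  rewrite /M1 -!scalemxAl ctmx_in scalerA ulamC -scalerA -scalerBr.
  by congr (_ *: (_ + _)); rewrite ctmxM // dh scalemxAl -mulNmx -qL.1.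
pose D := delta_mx i j : 'M[B]_n; pose D' := delta_mx j i : 'M[B]_n.
have fd : d^f = D by rewrite map_delta_mx.
have fa : (1%:M - uin A e *: d)^f = 1%:M - uin B e *: D.
  by rewrite map_mxB map_mx1 map_mxZ /= fin fd.
have fah : ctmx (@ubar k B) (1%:M - uin B e *: D) = 1%:M - uin B e *: D'.
  by rewrite ctmxB // ctmx1 // ctmx_in -[D](scale1r) ctmx_delta // bar1 // scale1r.
rewrite fa fah mulmxBl mul1mx mulmxBr mulmx1 -!scalemxAl !scalemx_centralr //.
rewrite mulmxBl -scalemxAl scalerBr scalerA.
rewrite (map_in fU) map_mxB (map_in fU) M1E map_mxZ /= fin map_mxD !map_mxM dh fd -pq.
rewrite map_delta_mx -/D' -scalemxAl !scalemx_centralr; try by move=> x; rewrite -rmorphXn; apply: inBC.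
rewrite -!scalemxAl -scalerDr scalerBr !scalerA -!rmorphXn -!rmorphM /=.
rewrite (_ : s ^+ 2 * (s ^+ 2 * c) * t0 ^+ 2 = e); last by rewrite /e; ring.
rewrite (_ : s ^+ 2 * ((s ^+ 3 * t0 * c) ^+ 2 * t0 ^+ 2) = e * e); last by rewrite /e; ring.
rewrite scalerDr !opprB addrCA [p + _]addrC subrK addrC.
by rewrite addrA.
Qed.

(** A Levi conjugate of [lo b1] divided by [lo b2] may have a nonzero block on [I], although [b1]
    and [b2] have none. *)
Lemma conj_up_lo_mul s c i j (b1 b2 : 'M[A]_n) : i != j ->
  LamMat LA b1 -> null_block I b1 -> LamMat LA b2 -> null_block I b2 ->
  let e := (s ^+ 2 * t0) ^+ 2 * c in
  conj_into (up p) s (lo (uin A (s ^+ 2 * t0) ^+ 2 *: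
    ((1%:M + uin A e *: delta_mx j i) *m b1 *m (1%:M + uin A e *: delta_mx i j) - b2))).
Proof.
move=> ij b1L b10 b2L b20 e; set ta := s ^+ 2 * t0.
set d : 'M[A]_n := delta_mx i j.
have taC : central (uin A ta ^+ 2) by move=> x; rewrite -rmorphXn; apply: inAC.
have dd : (uin A e *: d) *m (uin A e *: d) = 0.
  by rewrite mul_scale_delta eq_sym (negPf ij).
have a'a := mx_inverse_sq0 dd; have aa' := mx_inverse_sym a'a.
have a'h : ctmx (@ubar k A) (1%:M + uin A e *: d) = 1%:M + uin A e *: delta_mx j i.
  by rewrite ctmxD // ctmx1 // ctmx_in -[d](scale1r) ctmx_delta // bar1 // scale1r.
have := hyp_lo (uin A ta ^+ 2 *: b1) aa'; rewrite a'h => E.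
rewrite scalerBr addrC loD scalemxAl -scalemx_centralr // -E.
have H2 : conj_into (up p) s (lo (uin A ta ^+ 2 *: b1)).
  by have := conj_up_lo s 1 b1L b10; rewrite mulr1.
have H3 : conj_into (up p) s (lo (- (uin A ta ^+ 2 *: b2))).
  apply: conj_intoV (lo_inv _) _.
  by have := conj_up_lo s 1 b2L b20; rewrite mulr1.
apply: conj_intoM => //; apply: conj_intoM; first apply: conj_intoM => //.
  exact: conj_up_hyp.
by apply: conj_intoV (conj_up_hyp s c ij); apply: hyp_inv.
Qed.

(* If the support of ga lies in I, then ga is produced by conjugating, with
   hyp (1 + e_lj), a matrix that involves the index l outside I. *)
Lemma conj_up_lo_single s l (ga : 'M[A]_n) : l \notin I -> lam_gen LA ga ->
  conj_into (up p) s (lo (uin A (s ^+ 2 * t0 * (s ^+ 2 * t0) ^+ 2) ^+ 2 *: ga)).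
Proof.
move=> lI gg; set ta := s ^+ 2 * t0; set w := ta ^+ 2.
have [nb|nb] := pselect (null_block I ga).
  by apply: conj_up_lo => //; apply: lam_gen_LamMat.
have tw : uin A (ta * w) ^+ 2 *: ga = uin A ta ^+ 2 *: (uin A (w ^+ 2) *: ga).
  by rewrite scalerA -!rmorphXn -rmorphM exprMn.
case: gg nb tw => [i j z ij|i z Lz] nb ->.
  have [iI jI] : i \in I /\ j \in I.
    apply: contrapT => nij; apply: nb => a b aI bI; rewrite !mxE.
    have [ai|_] := eqVneq a i; have [bj|_] := eqVneq b j;
      have [bi|_] := eqVneq b i; have [aj|_] := eqVneq a j;
      rewrite /= ?mulr0 ?subrr ?subr0 //; subst; try (by case: nij);
      by rewrite eqxx in ij.
  have il : i != l by apply: contraNneq lI => <-.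
  have lj : l != j by apply: contraNneq lI => ->.
  (* Conjugation produces, besides b1 itself, the short root (i, j) with factor e = w^2; dividing by
     [lo b1] leaves only that term. *)
  pose b1 : 'M[A]_n := z *: delta_mx i l - (ulam A * ubar z) *: delta_mx l i.
  have b1L : LamMat LA b1 by apply/lam_gen_LamMat/lam_short.
  have b10 : null_block I b1.
    move=> a b aI bI; rewrite !mxE.
    rewrite (_ : b == l = false); last by apply: contraNF lI => /eqP <-.
    rewrite (_ : a == l = false); last by apply: contraNF lI => /eqP <-.
    by rewrite andbF !mulr0 subrr.
  have := conj_up_lo_mul s w lj b1L b10 b1L b10.
  rewrite -/ta -/w; set e := w * w; congr (conj_into _ _ (lo (_ *: _))).
  rewrite mulmxDl mul1mx -scalemxAl mulmxDr mulmx1 !scalemx_centralr //.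
  have -> : delta_mx j l *m b1 = - ((ulam A * ubar z) *: delta_mx j i).
    rewrite /b1 mulmxBr -[delta_mx j l](scale1r) !mul_scale_delta !mul1r eqxx.
    by rewrite eq_sym (negPf il) sub0r.
  rewrite (mulmxDl b1) -scalemxAl mulNmx.
  have -> : b1 *m delta_mx l j = z *: delta_mx i j.
    rewrite /b1 mulmxBl -[delta_mx l j](scale1r) !mul_scale_delta !mulr1 eqxx.
    by rewrite (negPf il) subr0.
  have -> : (ulam A * ubar z) *: delta_mx j i *m delta_mx l j = 0 :> 'M[A]_n.
    by rewrite -[delta_mx l j](scale1r) mul_scale_delta (negPf il).
  rewrite oppr0 scaler0 addr0 [LHS]addrC -(addrA b1) addKr addrC scalerN.
  by rewrite scalerBr /e -expr2.
have iI : i \in I.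
  apply: contrapT => iI; apply: nb => a b aI bI; rewrite !mxE.
  by have [ai|_] := eqVneq a i; rewrite ?mulr0 //; rewrite ai in aI.
have il : i != l by apply: contraNneq lI => <-.
have li : l != i by rewrite eq_sym.
(* Conjugating the long root at l yields w^2 z at (i, i) and the cross terms (i, l) and (l, i),
   which [b2] collects. *)
pose b1 : 'M[A]_n := z *: delta_mx l l.
have b1L : LamMat LA b1 by apply/lam_gen_LamMat/lam_long.
have b10 : null_block I b1.
  move=> a b aI bI; rewrite !mxE.
  rewrite (_ : b == l = false); last by apply: contraNF lI => /eqP <-.
  by rewrite andbF mulr0.
pose b2 : 'M[A]_n := (uin A w * z) *: delta_mx i l - (ulam A * ubar (uin A w * z)) *: delta_mx l i.
have b2L : LamMat LA b2 by apply/lam_gen_LamMat/lam_short.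
have b20 : null_block I b2.
  move=> a b aI bI; rewrite !mxE.
  rewrite (_ : b == l = false); last by apply: contraNF lI => /eqP <-.
  rewrite (_ : a == l = false); last by apply: contraNF lI => /eqP <-.
  by rewrite andbF !mulr0 subrr.
have b12L := LamMatD LFA b1L b2L.
have b120 : null_block I (b1 + b2).
  by move=> a b aI bI; rewrite mxE b10 // b20 // addr0.
have := conj_up_lo_mul s 1 li b1L b10 b12L b120.
rewrite -/ta -/w mulr1; congr (conj_into _ _ (lo (_ *: _))).
rewrite mulmxDl mul1mx -scalemxAl mulmxDr mulmx1 (scalemx_centralr _ _ (inAC w)) (mulmxDl b1) -(scalemxAl (uin A w)).
rewrite -[delta_mx l i](scale1r) -[delta_mx i l](scale1r) /b1 !mul_scale_delta !eqxx !mulr1 !mul1r.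
have zE : ulam A * ubar (uin A w * z) = - (uin A w * z).
  rewrite (barM bIA) ubar_in -(inAC w) mulrA ulamC -mulrA.
  by rewrite [in RHS](fp_max LFA Lz) mulrN opprK.
rewrite /b2 zE scaleNr opprK !mul_scale_delta eqxx mulr1 scalerDr !scalerA !addrA.
by rewrite [LHS]addrC addKr rmorphXn expr2.
Qed.

End SingleRoot.

Lemma clear_entry (a : B) : exists2 t, S t & exists a0, uin B t ^+ 2 * a = f a0.
Proof.
have [_ /(_ a)[t St [a0 e]]] := f_loc; exists t => //; exists (uin A t * a0).
by rewrite expr2 -mulrA e rmorphM fin.
Qed.

(** A root element involves at most two indices, so n at least 3 leaves an index l outside its
    support. *)
Lemma clear_lam_gen (p : 'M[B]_n) : lam_gen LB p ->
  exists (t0 : k) (q : 'M[A]_n) (I : {set 'I_n}) (l : 'I_n),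
  [/\ S t0 /\ LamMat LA q, uin B t0 ^+ 2 *: p = q^f, supported I p, supported I q
    & l \notin I].
Proof.
have ex_l (I : {set 'I_n}) : (#|I| <= 2)%N -> exists l, l \notin I.
  move=> I2; have /card_gt0P[l] : (0 < #|~: I|)%N.
    by rewrite cardsCs finset.setCK card_ord subn_gt0 (leq_ltn_trans I2).
  by rewrite !inE => h; exists l.
case=> [i j a ij|i a La].
  have [t0 St0 [a0 ea]] := clear_entry a.
  have c2 : (#|[set i; j]%SET| <= 2)%N by rewrite cards2 ij.
  have [l lI] := ex_l _ c2.
  have sup (R : pzRingType) (x y : R) : supported [set i; j]%SET (x *: delta_mx i j - y *: delta_mx j i).
    move=> b c; rewrite !inE !mxE.
    by case: (b == i); case: (b == j); case: (c == i); case: (c == j); rewrite //= ?mulr0 ?subrr.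
  exists t0, (a0 *: delta_mx i j - (ulam A * ubar a0) *: delta_mx j i), [set i; j]%SET, l.
  split=> //; first by split=> //; apply/lam_gen_LamMat/lam_short.
  rewrite map_mxB !map_mxZ !map_delta_mx /= rmorphM fbar flam -ea scalerBr !scalerA.
  congr (_ - _ *: _); rewrite (barM bIB) -rmorphXn ubar_in.
  by rewrite inBC -mulrA.
have [t0 St0 [a0 La0 ea]] := clearL La.
have c1 : (#|[set i]%SET| <= 2)%N by rewrite cards1.
have [l lI] := ex_l _ c1.
have sup (R : pzRingType) (x : R) : supported [set i]%SET (x *: delta_mx i i).
  move=> b c; rewrite !inE !mxE.
  by case: (b == i); case: (c == i); rewrite //= ?mulr0.
exists t0, (a0 *: delta_mx i i), [set i]%SET, l; split=> //.
  by split=> //; apply/lam_gen_LamMat/lam_long.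
by rewrite map_mxZ map_delta_mx /= -ea scalerA.
Qed.

Definition conj_bounded (g : 'M[B]_(n + n)) : Prop :=
  forall s, S s -> exists2 t, S t & forall x, Esub LA t x -> conj_into g s x.

Lemma conj_bounded_up_gen p : lam_gen LB p -> conj_bounded (up p).
Proof.
move=> pg; have [t0 [q [I [l [[St0 qL] pq pI qI lI]]]]] := clear_lam_gen pg.
have pL := lam_gen_LamMat LFB pg.
have [S1 SMM] := SM.
(* t = ta^3 is the level demanded by [conj_up_lo_single]. *)
move=> s Ss; set ta := s ^+ 2 * t0; set t := ta * ta ^+ 2.
have Sta : S ta by rewrite /ta expr2; apply: (SMM) => //; apply: SMM.
have St : S t by rewrite /t expr2; apply: (SMM) => //; apply: SMM.
exists t => //; apply: conj_into_gen => b Lb.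
  exists (up (uin A t ^+ 2 *: b)); last by rewrite map_up -!upD addrC.
  apply: (@Esub_mulr _ _ _ _ LFA (s * t0 * ta ^+ 2)).
  rewrite (_ : s * _ = t); last by rewrite /t /ta; ring.
  exact: Esub_up.
move: b Lb; apply: LamMat_ind => [|b c Hb Hc|b bg].
- by rewrite scaler0 lo0; apply: conj_into1.
- by rewrite scalerDr loD; apply: conj_intoM.
- exact: (conj_up_lo_single pL qL pI qI pq s lI bg).
Qed.

Lemma conj_bounded1 : conj_bounded 1%:M.
Proof.
move=> s Ss; exists s => // x Ex; exists x => //.
by rewrite mulmx1 mul1mx.
Qed.

Lemma conj_boundedM g h : conj_bounded g -> conj_bounded h -> conj_bounded (g *m h).
Proof.
move=> Hg Hh s Ss; have [t St Hg'] := Hg s Ss; have [u Su Hh'] := Hh t St.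
exists u => // x /Hh'[y /Hg'[z Ez ez] ey]; exists z => //.
by rewrite -mulmxA ey mulmxA ez mulmxA.
Qed.

Lemma conj_bounded_up p : LamMat LB p -> conj_bounded (up p).
Proof.
move: p; apply: LamMat_ind => [|b c Hb Hc|b bg].
- by rewrite up0; apply: conj_bounded1.
- by rewrite upD; apply: conj_boundedM.
- exact: conj_bounded_up_gen.
Qed.

Lemma conj_bounded_lo p : LamMat LB p -> conj_bounded (lo p).
Proof.
move=> pL s Ss; have [t St H] := conj_bounded_up pL Ss; exists t => // x Ex.
have [y Ey e] := H _ (Esub_swapV Ex).
exists (swap A n *m y *m swapV A n); first exact: Esub_swap.
have [sw1 sw2] := swap_inv B n.
rewrite !map_mxM (map_swap _ fU) (map_swapV _ fU) in e *.
have -> : lo p *m x^f = swap B n *m (up p *m (swapV B n *m x^f *m swap B n)) *m swapV B n.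
  by rewrite -swap_up -!mulmxA sw1 mulmx1.
by rewrite e -swap_up !mulmxA -(mulmxA _ (swapV B n) (swap B n)) sw2 mulmx1.
Qed.

(** Boundedness does not pass formally to inverses, so the induction carries it for g and its
    inverse together. *)
Lemma Esub_conj_bounded g : Esub LB 1 g -> conj_bounded g.
Proof.
move=> Eg.
suff [g' [gg' Hg Hg']] : exists g', [/\ mx_inverse g g', conj_bounded g & conj_bounded g'] by [].
elim: Eg => [_ [] _ [b Lb ->]||u v _ [u' [uu' Hu Hu']] _ [v' [vv' Hv Hv']]|u v _ [u' [uu' Hu Hu']] uv].
- exists (up (- (uin B 1 ^+ 2 *: b))); split; first exact: up_inv.
    by apply/conj_bounded_up/LamMat_in.
  by apply/conj_bounded_up/LamMatN => //; apply: LamMat_in.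
- exists (lo (- (uin B 1 ^+ 2 *: b))); split; first exact: lo_inv.
    by apply/conj_bounded_lo/LamMat_in.
  by apply/conj_bounded_lo/LamMatN => //; apply: LamMat_in.
- by exists 1%:M; split; [exact: mx_inverse1|exact: conj_bounded1|exact: conj_bounded1].
- exists (v' *m u'); split; [exact: mx_inverseM|exact: conj_boundedM|exact: conj_boundedM].
- exists u; have e := mx_inverse_uniq uu' uv; subst v.
  by split=> //; apply: mx_inverse_sym.
Qed.

End Conjugation.

(** * Polynomial extensions and form parameters *)

Section Polynomials.
Variables (k : comNzRingType) (A : uring k).
Local Notation bar := (@ubar k A).

Lemma ubar_is_zmod_morphism : zmod_morphism bar.
Proof. by move=> x y; rewrite (barD (ubarI A)) (barN (ubarI A)). Qed.
HB.instance Definition _ :=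
  GRing.isZmodMorphism.Build A A bar ubar_is_zmod_morphism.

Lemma map_poly_involution : involution (map_poly bar).
Proof.
split=> [p q|p q|p]; apply/polyP => i.
- by rewrite !(coefD, coef_map) raddfD.
- rewrite coef_map coefMr coefM raddf_sum; apply: eq_bigr => j _.
  by rewrite !coef_map; apply: barM (ubarI A) _ _.
- by rewrite !coef_map; apply: barK (ubarI A) _.
Qed.

Lemma polyC_central (c : A) : central c -> central c%:P.
Proof.
by move=> cC p; apply/polyP => i; rewrite coefCM coefMC cC.
Qed.

Lemma map_poly_barC (c : A) : map_poly bar c%:P = (bar c)%:P.
Proof. by rewrite map_polyC. Qed.

Definition poly_in : {rmorphism k -> {poly A}} := polyC \o uin A.

Fact upoly_lamU : (ulam A)%:P * map_poly bar (ulam A)%:P = 1.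
Proof. by rewrite map_poly_barC -polyCM ulamU. Qed.

Fact upoly_inC c : central (poly_in c).
Proof. by apply/polyC_central/uinC. Qed.

Fact upoly_bar_in c : map_poly bar (poly_in c) = poly_in c.
Proof. by rewrite /= map_poly_barC ubar_in. Qed.

Definition upoly : uring k :=
  @URing k {poly A} (map_poly bar) (ulam A)%:P poly_in map_poly_involution
    (polyC_central (@ulamC k A)) upoly_lamU upoly_inC upoly_bar_in.

(** The points at which evaluation of polynomials respects products and the involution. *)
Definition central_fixed (u : A) := central u /\ bar u = u.

Lemma central_fixed_in c : central_fixed (uin A c).
Proof. by split; [apply: uinC | apply: ubar_in]. Qed.

Lemma central_fixedM u v : central_fixed u -> central_fixed v -> central_fixed (u * v).
Proof.
move=> [uC bu] [vC bv]; split; last by rewrite (barM (ubarI A)) bu bv vC.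
by move=> x; rewrite -mulrA vC mulrA uC mulrA.
Qed.

Lemma central_fixedD u v : central_fixed u -> central_fixed v -> central_fixed (u + v).
Proof.
move=> [uC bu] [vC bv]; split; last by rewrite (barD (ubarI A)) bu bv.
by move=> x; rewrite mulrDl mulrDr uC vC.
Qed.

Lemma central_fixed0 : central_fixed 0.
Proof. by split=> [x|]; rewrite ?mul0r ?mulr0 // raddf0. Qed.

Lemma central_fixed1 : central_fixed 1.
Proof. by split=> [x|]; rewrite ?mul1r ?mulr1 // (bar1 (ubarI A)). Qed.

End Polynomials.

Lemma central_fixedX (k : comNzRingType) (A : uring k) :
  central_fixed (A := upoly A) 'X.
Proof.
split=> [p|]; first by rewrite commr_polyX.
apply/polyP => i; rewrite /= coef_map_id0 ?(bar0 (ubarI A)) // !coefX.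
by case: (i == 1)%N; rewrite ?(bar1 (ubarI A)) ?(bar0 (ubarI A)).
Qed.

Lemma central_fixedC (k : comNzRingType) (A : uring k) (u : A) :
  central_fixed u -> central_fixed (A := upoly A) u%:P.
Proof.
move=> [uC bu]; split; first exact: polyC_central.
by rewrite /= map_poly_barC bu.
Qed.

Section Evaluation.
Variables (k : comNzRingType) (A Z : uring k) (phi : {rmorphism A -> Z}).
Hypothesis phiU : uhom phi.
Variables (u : Z) (uF : central_fixed u).

Fact peval_comm : commr_rmorph phi u.
Proof. by move=> x; rewrite /GRing.comm uF.1. Qed.

Definition peval : {rmorphism upoly A -> Z} := horner_morph peval_comm.

Lemma pevalC (c : A) : peval c%:P = phi c.
Proof. exact: horner_morphC. Qed.

Lemma pevalX : peval 'X = u.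
Proof. exact: horner_morphX. Qed.

Lemma peval_uhom : uhom peval.
Proof.
have [phib phil phii] := phiU.
split=> [p|| c]; last 2 first.
- by rewrite -phil; apply: pevalC.
- by rewrite -phii; apply: pevalC.
elim/poly_ind: p => [|p c IH]; first by rewrite !raddf0.
have -> : ubar (u := upoly A) (p * 'X + c%:P) = ubar (u := upoly A) p * 'X + (ubar c)%:P.
  apply/polyP => i; rewrite /= coef_map !coefD !coefMX !coefC coef_map.
  by case: i => [|i] /=; rewrite ?add0r ?addr0 ?raddf0.
rewrite !rmorphD !rmorphM /= [peval 'X]pevalX [X in X * _]IH !pevalC phib.
rewrite (barD (ubarI Z)) (barM (ubarI Z)) uF.2; congr (_ + _).
by rewrite uF.1.
Qed.

End Evaluation.

Section FormParameters.
Variable k : comNzRingType.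

Lemma Lambda_max_form_parameter (Z : uring k) :
  form_parameter (@ubar k Z) (ulam Z) (Lambda_max (@ubar k Z) (ulam Z)).
Proof.
have bI := ubarI Z; have lC := @ulamC k Z.
split=> //.
- split; rewrite /Lambda_max /=; first by rewrite (bar0 bI) mulr0 oppr0.
    by move=> x y hx hy; rewrite (barD bI) mulrDr opprD -hx -hy.
  by move=> x hx; rewrite (barN bI) mulrN -hx.
- move=> _ [c ->]; rewrite /Lambda_max /= (barD bI) (barN bI) (barM bI) (barK bI).
  by rewrite mulrBr (mulrA _ c) (lC c) -(mulrA c) ulamU mulr1 opprB.
- move=> x a ha; rewrite /Lambda_max /= !(barM bI) (barK bI) [in LHS]ha.
  by rewrite mulrN mulNr !mulrA (lC (ubar x)).
Qed.

Variables (R0 : uring k) (L0 : set R0).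
Hypothesis LF0 : form_parameter (@ubar k R0) (ulam R0) L0.

(* The form parameter induced by L0 along phi in the quadratic case, the
   maximal one in the Hermitian case. *)
Definition fparam (gen : bool) (Z : uring k) (phi : R0 -> Z) : set Z :=
  if gen then form_parameter_gen (@ubar k Z) (ulam Z) (image L0 phi)
  else Lambda_max (@ubar k Z) (ulam Z).

Lemma image_Lambda_max (Z : uring k) (phi : {rmorphism R0 -> Z}) : uhom phi ->
  (image L0 phi `<=` Lambda_max (@ubar k Z) (ulam Z))%classic.
Proof.
move=> [phib phil _] _ [a La <-].
by rewrite /Lambda_max /= -phil -phib -rmorphM -rmorphN -(fp_max LF0 La).
Qed.

Lemma fparam_form_parameter gen (Z : uring k) (phi : {rmorphism R0 -> Z}) : uhom phi ->
  form_parameter (@ubar k Z) (ulam Z) (fparam gen phi).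
Proof.
case: gen => [/image_Lambda_max im|_]; last exact: Lambda_max_form_parameter.
split.
- split; first by move=> L LF _; apply: fp0 LF.
    by move=> x y hx hy L LF LA; apply: (fpD LF); [exact: hx|exact: hy].
  by move=> x hx L LF LA; apply: (fpN LF); apply: hx.
- by move=> x [c ->] L LF _; apply: fp_min LF _.
- by move=> x /(_ _ (Lambda_max_form_parameter Z) im).
- by move=> x a ha L LF LA; apply: (fp_conj LF); apply: ha.
Qed.

Lemma fparam_map gen (Z Z' : uring k) (phi : {rmorphism R0 -> Z}) (phi' : R0 -> Z')
    (f : {rmorphism Z -> Z'}) : uhom phi -> uhom f -> (forall r, f (phi r) = phi' r) ->
  forall x, fparam gen phi x -> fparam gen phi' (f x).
Proof.
move=> /image_Lambda_max im [fb fl _] fphi x.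
case: gen => [hx L LF LA|]; last first.
  by rewrite /= /Lambda_max /= -fl -fb -rmorphM -rmorphN => {1}->.
have MF := Lambda_max_form_parameter Z.
(* The preimage of L need not lie in the maximal form parameter; the intersection is a form
   parameter. *)
pose L' : set Z := fun z => L (f z) /\ Lambda_max (@ubar k Z) (ulam Z) z.
suff : L' x by case.
apply: hx; last first.
  move=> _ [a La <-]; split; last by apply: im; exists a.
  by apply: LA; exists a.
split.
- split; first by split; [rewrite rmorph0; apply: fp0 LF | apply: fp0 MF].
    move=> y z [hy my] [hz mz]; split; last exact: fpD MF _ _ my mz.
    by rewrite rmorphD; apply: fpD LF _ _ hy hz.
  by move=> y [hy my]; split; [rewrite rmorphN; apply: fpN LF _ hy | apply: fpN MF _ my].
- move=> y [c ->]; split; last exact: fp_min MF _.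
  by rewrite rmorphB rmorphM fl fb; apply: fp_min LF _.
- by move=> y [].
- move=> y a [ha ma]; split; last exact: fp_conj MF _ _ ma.
  by rewrite !rmorphM fb; apply: fp_conj LF _ _ ha.
Qed.

Inductive fp_span (Z : uring k) (phi : R0 -> Z) : set Z :=
| fs_min c : fp_span phi (c - ulam Z * ubar c)
| fs_base x a : L0 a -> fp_span phi (ubar x * phi a * x)
| fs_add x y : fp_span phi x -> fp_span phi y -> fp_span phi (x + y).

(** These sums already form a form parameter, so elements of the generated one can be treated by
    induction. *)
Lemma fparam_span (Z : uring k) (phi : {rmorphism R0 -> Z}) x : uhom phi ->
  fparam true phi x -> fp_span phi x.
Proof.
move=> phiU; have bI := ubarI Z; have lC := @ulamC k Z.
have im := image_Lambda_max phiU; have MF := Lambda_max_form_parameter Z.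
apply; last first.
  move=> _ [a La <-].
  rewrite (_ : phi a = ubar 1 * phi a * 1); last by rewrite (bar1 bI) mul1r mulr1.
  exact: fs_base.
split.
- split.
      rewrite (_ : 0 = 0 - ulam Z * ubar 0); first exact: fs_min.
      by rewrite (bar0 bI) mulr0 subrr.
    exact: fs_add.
  move=> y; elim=> [c|z a La|u v _ Hu _ Hv]; last by rewrite opprD; apply: fs_add.
    rewrite (_ : - (c - ulam Z * ubar c) = - c - ulam Z * ubar (- c)); first exact: fs_min.
    by rewrite (barN bI) mulrN opprK opprB addrC.
  by rewrite -mulNr -mulrN -rmorphN; apply: fs_base; exact: (fpN LF0).
- by move=> y [c ->]; apply: fs_min.
- move=> y; elim=> [c|z a La|u v _ Hu _ Hv].
  + exact: fp_min MF _.
  + by apply: (fp_conj MF); apply: im; exists a.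
  + exact: fpD MF _ _ Hu Hv.
- move=> y b; elim=> [c|z a La|u v _ Hu _ Hv].
  + rewrite mulrBr mulrBl (_ : _ * (ulam Z * ubar c) * y = ulam Z * ubar (ubar y * c * y)).
      exact: fs_min.
    by rewrite !(barM bI) (barK bI) !mulrA (lC (ubar y)).
  + by rewrite !mulrA -(barM bI) -[_ * z * y]mulrA; apply: fs_base.
  + by rewrite mulrDr mulrDl; apply: fs_add.
Qed.

Lemma uin_sandwich (Z : uring k) c (x a y : Z) :
  uin Z c ^+ 2 * (x * a * y) = x * uin Z c * a * (uin Z c * y).
Proof.
rewrite -(uinC c x) !mulrA -(uinC c (uin Z c * x * a)) expr2.
by rewrite !mulrA.
Qed.

Lemma uin_min (Z : uring k) c (z : Z) :
  uin Z c * (z - ulam Z * ubar z) = uin Z c * z - ulam Z * ubar (uin Z c * z).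
Proof.
rewrite mulrBr (barM (ubarI Z)) ubar_in -(uinC c (ubar z)) !mulrA.
by rewrite (uinC c (ulam Z)).
Qed.

(** * Clearing denominators in polynomials and form parameters *)

Section Clearing.
Variables (S : set k) (SM : mul_closed S).
Variables (A B : uring k) (f : {rmorphism A -> B}).
Hypotheses (fU : uhom f) (f_loc : is_localization S f).
Variable phi : {rmorphism R0 -> A}.
Hypothesis phiU : uhom phi.

Let fbar x : f (ubar x) = ubar (f x). Proof. by case: fU. Qed.
Let flam : f (ulam A) = ulam B. Proof. by case: fU. Qed.
Let fin c : f (uin A c) = uin B c. Proof. by case: fU. Qed.
Let bIA := ubarI A.
Let bIB := ubarI B.

Lemma common_denominator (I : finType) (y : I -> B) :
  exists2 s, S s & exists x : I -> A, forall i, uin B s * y i = f (x i).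
Proof.
have [S1 SMM] := SM; have [_ den] := f_loc.
have [d hd] := choice (fun i => let: ex_intro2 s Ss hx := den (y i) in
   ex_intro (fun s => S s /\ exists x, uin B s * y i = f x) s (conj Ss hx)).
exists (\prod_i d i).
  by apply: (big_ind S) => // i _; case: (hd i).
suff h i : exists x, uin B (\prod_i d i) * y i = f x.
  by have [x hx] := choice h; exists x.
have [Sd [x hx]] := hd i.
exists (uin A (\prod_(j | j != i) d j) * x).
by rewrite (bigD1 i) //= mulrC (rmorphM (uin B)) -mulrA hx rmorphM fin.
Qed.

Lemma common_annihilator (I : finType) (x : I -> A) : (forall i, f (x i) = 0) ->
  exists2 s, S s & forall i, uin A s * x i = 0.
Proof.
move=> fx; have [S1 SMM] := SM; have [ker _] := f_loc.
have [d hd] := choice (fun i => let: ex_intro2 s Ss hx := ker (x i) (fx i) in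
   ex_intro (fun s => S s /\ uin A s * x i = 0) s (conj Ss hx)).
exists (\prod_i d i).
  by apply: (big_ind S) => // i _; case: (hd i).
move=> i; have [_ hx] := hd i.
by rewrite (bigD1 i) //= mulrC (rmorphM (uin A)) -mulrA hx mulr0.
Qed.

Definition umap : {rmorphism upoly A -> upoly B} := map_poly f.

Lemma umap_uhom : uhom umap.
Proof.
split=> [p||c].
- by apply/polyP => i; rewrite !coef_map /= ?coef_map fbar.
- by rewrite /= map_polyC /= flam.
- by rewrite /= map_polyC /= fin.
Qed.

Lemma coef_in (Z : uring k) c (p : {poly Z}) i : (uin (upoly Z) c * p)`_i = uin Z c * p`_i.
Proof. by rewrite coefCM. Qed.

(** A polynomial has finitely many coefficients, which share a denominator and an annihilator. *)
Lemma umap_loc : is_localization S umap.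
Proof.
split=> [p fp0|q].
  have [|s Ss hs] := @common_annihilator 'I_(size p) (fun i => p`_i).
    by move=> i; rewrite -coef_map -/umap fp0 coef0.
  exists s => //; apply/polyP => i; rewrite coef_in coef0.
  have [ip|pi] := ltnP i (size p); first exact: hs (Ordinal ip).
  by rewrite nth_default // mulr0.
have [s Ss [x hx]] := @common_denominator 'I_(size q) (fun i => q`_i).
exists s => //; exists (\sum_(i < size q) (x i)%:P * 'X^i); apply/polyP => i.
rewrite coef_in coef_map coef_sum.
have [iq|qi] := ltnP i (size q).
  rewrite (bigD1 (Ordinal iq)) //= big1 ?addr0 => [|j ji].
    by rewrite coefCM coefXn eqxx mulr1 -hx.
  rewrite coefCM coefXn; case: eqP => [e|]; last by rewrite mulr0.
  by case/eqP: ji; apply: val_inj.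
rewrite nth_default // mulr0 big1; first by rewrite raddf0.
move=> j _.
rewrite coefCM coefXn; case: eqP => [e|]; last by rewrite mulr0.
by have := ltn_ord j; rewrite -e ltnNge qi.
Qed.

Fact polyC_uhom (Z : uring k) : uhom (A := Z) (B := upoly Z) (polyC : Z -> {poly Z}).
Proof. by split=> // x; rewrite /= map_poly_barC. Qed.

Definition pscale_pt (Z : uring k) (t : k) : upoly Z := uin (upoly Z) t * 'X.

Fact pscale_pt_fixed (Z : uring k) t : central_fixed (pscale_pt Z t).
Proof.
apply: central_fixedM; [exact: central_fixed_in | exact: central_fixedX].
Qed.

(* The substitution T := t T. *)
Definition pscale (Z : uring k) (t : k) : {rmorphism upoly Z -> upoly Z} :=
  peval (polyC : {rmorphism Z -> upoly Z}) (pscale_pt_fixed Z t).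

Lemma pscale_uhom Z t : uhom (pscale Z t).
Proof. exact: peval_uhom (polyC_uhom Z) _ (pscale_pt_fixed Z t). Qed.

Lemma coef_pscale (Z : uring k) t (p : {poly Z}) i :
  (pscale Z t p)`_i = uin Z t ^+ i * p`_i.
Proof.
elim/poly_ind: p i => [|p c IH] i; first by rewrite rmorph0 !coef0 mulr0.
rewrite rmorphD rmorphM /= [pscale Z t 'X]pevalX [pscale Z t c%:P]pevalC.
rewrite /pscale_pt /= /poly_in /= mulrA !coefD !coefMX coefMC !coefC.
case: i => [|i] /=; first by rewrite expr0 mul1r.
by rewrite !addr0 IH -uinC mulrA -exprS.
Qed.

(** Formally (p(t T) - p(0)) / t, given by coefficients because t may be a zero divisor. *)
Definition pquot (Z : uring k) (t : k) (p : {poly Z}) : {poly Z} :=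
  \poly_(i < size p) (if i is j.+1 then uin Z t ^+ j * p`_i else 0).

Lemma coef_pquot (Z : uring k) t (p : {poly Z}) i :
  (pquot t p)`_i = if i is j.+1 then uin Z t ^+ j * p`_i else 0.
Proof.
rewrite coef_poly; case: ltnP => // pi; case: i pi => // i pi.
by rewrite nth_default ?mulr0.
Qed.

(** q(t T) - q(0) is divisible by t, and t contains the denominator e of q; the factor t1^2 c is
    left over. *)
Lemma pscale_clear (q : {poly B}) (w : {poly A}) e t1 c :
  uin (upoly B) e * q = umap w ->
  pscale B (t1 ^+ 2 * e * c) q - pscale B 0 q =
  umap (uin (upoly A) t1 ^+ 2 * (uin (upoly A) c * pquot (t1 ^+ 2 * e * c) w)).
Proof.
move=> qw; have {}qw i : uin B e * q`_i = f w`_i.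
  by rewrite -coef_in qw coef_map.
set t := t1 ^+ 2 * e * c.
apply/polyP => i; rewrite coef_map -rmorphXn !coef_in coefB !coef_pscale coef_pquot.
case: i => [|i] /=; first by rewrite !expr0 subrr !mulr0 raddf0.
rewrite (raddf0 (uin B)) expr0n mul0r subr0 -!rmorphXn 3!(rmorphM f) /= !fin -qw.
rewrite !mulrA -!(rmorphM (uin B)); congr (uin B _ * _).
by rewrite exprS {1}/t; ring.
Qed.

Definition phiC : {rmorphism R0 -> upoly A} := polyC \o phi.
Definition phiD : {rmorphism R0 -> upoly B} := umap \o phiC.

Lemma uhom_comp (X Y Z : uring k) (g : {rmorphism X -> Y}) (h : {rmorphism Y -> Z}) :
  uhom g -> uhom h -> uhom (h \o g).
Proof. by move=> [gb gl gi] [hb hl hi]; split=> *; rewrite /= ?gb ?gl ?gi ?hb ?hl ?hi. Qed.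

Lemma phiC_uhom : uhom phiC. Proof. exact: uhom_comp phiU (polyC_uhom A). Qed.
Lemma phiD_uhom : uhom phiD. Proof. exact: uhom_comp phiC_uhom umap_uhom. Qed.

Lemma fp_in (Z : uring k) (L : set Z) c x : form_parameter (@ubar k Z) (ulam Z) L ->
  L x -> L (uin Z c ^+ 2 * x).
Proof.
move=> LF Lx; have := fp_conj LF (uin Z c) Lx.
by rewrite ubar_in -mulrA -uinC mulrA -expr2.
Qed.

Lemma Lambda_max_in (Z : uring k) c x : Lambda_max (@ubar k Z) (ulam Z) x ->
  Lambda_max (@ubar k Z) (ulam Z) (uin Z c * x).
Proof.
rewrite /Lambda_max /= => hx; rewrite (barM (ubarI Z)) ubar_in {1}hx.
by rewrite mulrN -(uinC c (ubar x)) !mulrA (uinC c).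
Qed.

(** A lift w of e q satisfies the defining equation only up to S-torsion; one more factor s removes
    it. *)
Lemma Lambda_max_clear (q : upoly B) : Lambda_max (@ubar k (upoly B)) (ulam (upoly B)) q ->
  exists2 e, S e & exists2 w : upoly A,
    Lambda_max (@ubar k (upoly A)) (ulam (upoly A)) w & uin (upoly B) e * q = umap w.
Proof.
rewrite /Lambda_max /= => hq; have [S1 SMM] := SM.
have [ker den] := umap_loc; have [pb pl pi] := umap_uhom.
have [e Se [w ew]] := den q.
have [|s Ss hs] := ker (w + ulam (upoly A) * ubar (u := upoly A) w).
  rewrite rmorphD rmorphM pl pb -ew (barM (ubarI (upoly B))) ubar_in.
  rewrite mulrA -mulrA -(uinC e) mulrA -(uinC e) -mulrA -mulrDr.
  by rewrite {1}hq addNr mulr0.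
exists (s * e); first exact: SMM.
exists (uin (upoly A) s * w); last by rewrite !rmorphM pi -mulrA ew.
change (uin (upoly A) s * w = - (ulam (upoly A) * ubar (uin (upoly A) s * w))).
apply/eqP; rewrite -addr_eq0 (barM (ubarI (upoly A))) ubar_in.
by rewrite -(uinC s (ubar w)) mulrA -(uinC s (ulam (upoly A))) -mulrA -mulrDr hs.
Qed.

(** Membership in the maximal form parameter is tested coefficientwise, and the factors t^j are
    central and fixed. *)
Lemma Lambda_max_pquot t (w : upoly A) :
  Lambda_max (@ubar k (upoly A)) (ulam (upoly A)) w ->
  Lambda_max (@ubar k (upoly A)) (ulam (upoly A)) (pquot t w).
Proof.
move=> hw; have {}hw i : w`_i = - (ulam A * ubar w`_i).
  by rewrite {1}hw coefN coefCM coef_map.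
apply/polyP => i; rewrite coefN coefCM coef_map !coef_pquot.
case: i => [|i] /=; first by rewrite (bar0 bIA) mulr0 oppr0.
rewrite -rmorphXn (barM bIA) ubar_in {1}hw mulrN -(uinC _ (ubar _)) !mulrA.
by rewrite (uinC _ (ulam A)).
Qed.

(** Denominators are cleared on the spanning elements; for a sum, each lift is multiplied by the
    square of the other denominator, which keeps it in the form parameter. *)
Lemma fparam_clear gen (q : upoly B) : fparam gen phiD q ->
  exists2 t, S t & exists2 z, fparam gen phiC z & uin (upoly B) t ^+ 2 * q = umap z.
Proof.
have [S1 SMM] := SM; have [ker den] := umap_loc; have [pb pl pi] := umap_uhom.
have bIC := ubarI (upoly A); have bID := ubarI (upoly B).
case: gen => [/(fparam_span phiD_uhom)|]; last first.
  move=> /Lambda_max_clear[e Se [w wL ew]]; exists e => //.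
  exists (uin (upoly A) e * w); first exact: Lambda_max_in.
  by rewrite expr2 -mulrA ew rmorphM pi.
have CF := fparam_form_parameter true phiC_uhom.
elim=> [c|x a La|u v _ [t St [z Lz ez]] _ [t' St' [z' Lz' ez']]].
- have [t St [w ew]] := den c; exists t => //.
  exists (uin (upoly A) t * w - ulam (upoly A) * ubar (uin (upoly A) t * w)).
    exact: fp_min CF _.
  rewrite rmorphB (rmorphM umap (ulam _)) pl pb !(rmorphM umap) pi -ew mulrA -expr2.
  rewrite mulrBr; congr (_ - _).
  by rewrite (barM bID) -rmorphXn ubar_in mulrA -uinC mulrA (uinC _ (ulam _)) -!mulrA uinC.
- have [t St [w ew]] := den x; exists t => //.
  exists (ubar w * phiC a * w); first by apply: (fp_conj CF) => L _; apply; exists a.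
  by rewrite uin_sandwich !rmorphM pb -ew (barM bID) ubar_in.
- exists (t * t'); first exact: SMM.
  exists (uin (upoly A) t' ^+ 2 * z + uin (upoly A) t ^+ 2 * z').
    by apply: (fpD CF); apply: (fp_in _ CF).
  rewrite rmorphD !(rmorphM umap) -!rmorphXn !pi -ez -ez' -!rmorphXn mulrDr !mulrA.
  by rewrite -!(rmorphM (uin (upoly B))); congr (uin (upoly B) _ * _ + uin (upoly B) _ * _); ring.
Qed.

Lemma pscaleC t (c : B) : pscale B t c%:P = c%:P.
Proof. exact: pevalC. Qed.

(** For a spanning element x^bar a x, write x(t T) = X0 + V with V divisible by t. The change is m -
    lam m^bar plus V^bar a V, where m = X0^bar a V. *)
Lemma fparam_pscale_clear gen (q : upoly B) t1 : S t1 -> fparam gen phiD q ->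
  exists2 t0, S t0 & forall c, exists2 z, fparam gen phiC z &
    pscale B (t0 * c) q - pscale B 0 q = umap (uin (upoly A) t1 ^+ 2 * z).
Proof.
have [S1 SMM] := SM; have [ker den] := umap_loc; have [pb pl pi] := umap_uhom.
have bIC := ubarI (upoly A); have bID := ubarI (upoly B).
move=> St1; case: gen => [/(fparam_span phiD_uhom)|]; last first.
  move=> /Lambda_max_clear[e Se [w wL ew]]; exists (t1 ^+ 2 * e).
    by rewrite expr2; apply: (SMM) => //; apply: SMM.
  move=> c; exists (uin (upoly A) c * pquot (t1 ^+ 2 * e * c) w).
    by apply/Lambda_max_in/Lambda_max_pquot.
  exact: pscale_clear.
have CF := fparam_form_parameter true phiC_uhom.
elim=> [x|x a La|u v _ [t St Ht] _ [t' St' Ht']].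
- have [e Se [w ew]] := den x; exists (t1 ^+ 2 * e).
    by rewrite expr2; apply: (SMM) => //; apply: SMM.
  move=> c; set t := _ * c; set z := uin (upoly A) c * pquot t w.
  exists (z - ulam (upoly A) * ubar z); first exact: fp_min CF _.
  have [sb sl _] := pscale_uhom B t; have [sb0 sl0 _] := pscale_uhom B 0.
  have Y : pscale B t x - pscale B 0 x = _ := pscale_clear t1 c ew.
  rewrite !rmorphB !(rmorphM (pscale B _)) sb sl sb0 sl0 -rmorphXn uin_min rmorphB.
  rewrite (rmorphM umap (ulam _)) pl pb rmorphXn -Y (barD bID) (barN bID).
  by rewrite mulrBr opprD addrACA -opprD.
- have [e1 Se1 [w ew]] := den x; have [e Se [x0 ex0]] := den (pscale B 0 x).
  exists ((t1 * e) ^+ 2 * e1).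
    by rewrite expr2; apply: (SMM) => //; apply: (SMM); apply: (SMM).
  move=> c; set t := _ * c; set z := uin (upoly A) c * pquot t w.
  have Y : pscale B t x - pscale B 0 x = _ := pscale_clear (t1 * e) c ew.
  rewrite -/z in Y.
  (* X0 is not defined over [A]. One of the factors e contained in V clears its denominator in the
     cross term m; the square term takes the other into [z2]. *)
  pose m := uin (upoly A) e * (ubar x0 * phiC a * z).
  pose z2 := uin (upoly A) (t1 * e ^+ 2) * z.
  have La' : fparam true phiC (phiC a) by move=> L _; apply; exists a.
  exists (m - ulam (upoly A) * ubar m + ubar z2 * phiC a * z2).
    exact: fpD CF _ _ (fp_min CF _) (fp_conj CF _ La').
  have [sb _ _] := pscale_uhom B t; have [sb0 _ _] := pscale_uhom B 0.
  have sPhi u : pscale B u (phiD a) = phiD a.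
    by rewrite /phiD /= map_polyC; apply: pscaleC.
  rewrite !(rmorphM (pscale B _)) sb sb0 !sPhi.
  clearbody z; set Phi := phiD a; set X0 := pscale B 0 x in Y ex0 *.
  set W := pscale B t x - X0 in Y.
  have PhiE : Phi = - (ulam (upoly B) * ubar Phi).
    have [qb ql _] := phiD_uhom.
    by rewrite /Phi -qb -ql -rmorphM -rmorphN -(fp_max LF0 La).
  have PE : ubar X0 * Phi * W = umap (uin (upoly A) t1 ^+ 2 * m).
    rewrite Y /m mulrA -!rmorphXn -(rmorphM (uin _)) !(rmorphM umap) !pi pb -ex0.
    rewrite (barM bID) ubar_in -(uinC e (ubar X0)) mulrA -(uinC _ (ubar X0 * Phi)).
    rewrite !mulrA -(rmorphM (uin _)).
    by congr (uin (upoly B) _ * _ * _ * _); ring.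
  have WE : ubar W * Phi * W = umap (uin (upoly A) t1 ^+ 2 * (ubar z2 * phiC a * z2)).
    have uz : uin (upoly A) (t1 * e) ^+ 2 * z = uin (upoly A) t1 * z2.
      by rewrite /z2 mulrA -rmorphXn -(rmorphM (uin _)); congr (uin _ _ * _); ring.
    rewrite uin_sandwich Y uz -pb (barM bIC) ubar_in.
    by rewrite /Phi -[phiD a]/(umap (phiC a)) -!(rmorphM umap).
  (* Since Phi = - lam Phi^bar, the map y -> - lam y^bar exchanges the two cross terms. *)
  have key X V : X = X0 + V -> ubar X * Phi * X - ubar X0 * Phi * X0 =
      ubar X0 * Phi * V - ulam (upoly B) * ubar (ubar X0 * Phi * V) + ubar V * Phi * V.
    move=> ->; rewrite (barD bID) !mulrDl !mulrDr !(barM bID) (barK bID).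
    have -> : ulam (upoly B) * (ubar V * (ubar Phi * X0)) = - (ubar V * Phi * X0).
      rewrite [in RHS]PhiE mulrN mulNr opprK !mulrA.
      by rewrite (ulamC (ubar V)).
    by rewrite opprK [LHS]addrC !addrA addNr add0r.
  rewrite (key _ W); last by rewrite addrC subrK.
  rewrite (mulrDr (uin (upoly A) t1 ^+ 2)) rmorphD -WE; congr (_ + _).
  by rewrite -rmorphXn uin_min rmorphB (rmorphM umap (ulam _)) pl pb rmorphXn -PE.
- exists (t * t'); first exact: SMM.
  move=> c; have [z Lz ez] := Ht (t' * c); have [z' Lz' ez'] := Ht' (t * c).
  exists (z + z'); first exact: fpD CF _ _ Lz Lz'.
  rewrite mulrA in ez; rewrite mulrA [t' * t]mulrC in ez'.
  by rewrite !rmorphD opprD addrACA ez ez' -rmorphD mulrDr.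
Qed.

End Clearing.
End FormParameters.

(** * Dilation *)

Section Dilation.
Variables (k : comNzRingType) (R0 : uring k) (L0 : set R0).
Hypothesis LF0 : form_parameter (@ubar k R0) (ulam R0) L0.
Variables (S : set k) (SM : mul_closed S).
Variables (A B : uring k) (f : {rmorphism A -> B}).
Hypotheses (fU : uhom f) (f_loc : is_localization S f).
Variable phi : {rmorphism R0 -> A}.
Hypothesis phiU : uhom phi.
Variables (gen : bool) (n : nat).
Hypothesis n3 : (2 < n)%N.

Local Notation phC := (phiC phi).
Local Notation phD := (phiD f phi).
Local Notation F := (umap f).
Local Notation LC := (fparam L0 gen phC).
Local Notation LD := (fparam L0 gen phD).

Let FU : uhom F := umap_uhom fU.
Let CF : form_parameter (@ubar k (upoly A)) (ulam (upoly A)) LC :=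
  fparam_form_parameter LF0 gen (phiC_uhom phiU).
Let DF : form_parameter (@ubar k (upoly B)) (ulam (upoly B)) LD :=
  fparam_form_parameter LF0 gen (phiD_uhom fU phiU).

Lemma fparam_umap x : LC x -> LD (F x).
Proof. exact: (fparam_map LF0 (phiC_uhom phiU) FU). Qed.

Lemma phiD_pscale t r : pscale B t (phD r) = phD r.
Proof. by rewrite /phiD /= map_polyC; apply: pscaleC. Qed.

Lemma phiC_pscale t r : pscale A t (phC r) = phC r.
Proof. exact: pscaleC. Qed.

Lemma fparam_pscaleD t x : LD x -> LD (pscale B t x).
Proof.
exact: (fparam_map LF0 (phiD_uhom fU phiU) (pscale_uhom B t) (phiD_pscale t)).
Qed.

Lemma fparam_pscaleC t x : LC x -> LC (pscale A t x).
Proof.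
exact: (fparam_map LF0 (phiC_uhom phiU) (pscale_uhom A t) (phiC_pscale t)).
Qed.

Lemma umap_pscale t p : F (pscale A t p) = pscale B t (F p).
Proof.
apply/polyP => i; rewrite coef_map !coef_pscale coef_map -!rmorphXn.
by rewrite /= (rmorphM f); case: fU => _ _ ->.
Qed.

Lemma pscale_pscale (Z : uring k) t u p : pscale Z u (pscale Z t p) = pscale Z (t * u) p.
Proof.
apply/polyP => i; rewrite !coef_pscale -!rmorphXn mulrA -rmorphM.
by rewrite exprMn mulrC.
Qed.

Local Notation Dscale t := (map_mx (pscale B t)).

(** The value of g at 0 stays on the right because it need not come from [A]. Quantifying over c
    admits all multiples of t0, so that the factors of a product share one dilation. *)
Definition dilates (g : 'M[upoly B]_(n + n)) : Prop := Esub LD 1 g /\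
  forall s, S s -> exists2 t0, S t0 & forall c, exists2 y, Esub LC s y &
    Dscale (t0 * c) g = map_mx F y *m Dscale 0 g.

Lemma Esub_Dscale t (g : 'M[upoly B]_(n + n)) : Esub LD 1 g -> Esub LD 1 (Dscale t g).
Proof. exact: (Esub_map (pscale_uhom B t) (@fparam_pscaleD t)). Qed.

Lemma conj_boundedD (g : 'M[upoly B]_(n + n)) : Esub LD 1 g ->
  conj_bounded S F LC g.
Proof.
apply: Esub_conj_bounded => //.
- exact: umap_loc.
- exact: fparam_umap.
- exact: fparam_clear.
Qed.

Lemma dilates1 : dilates 1%:M.
Proof.
split=> [|s Ss]; first exact: sgen_one.
exists s => // c; exists 1%:M; first exact: sgen_one.
by rewrite !map_mx1 mulmx1.
Qed.

(** The product is y g(0) y' h(0). Conjugation by g(0) brings y' to its left, provided that y' has a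
    sufficiently high level. *)
Lemma dilatesM (g h : 'M[upoly B]_(n + n)) : dilates g -> dilates h -> dilates (g *m h).
Proof.
move=> [Eg Hg] [Eh Hh]; split=> [|s Ss]; first exact: sgen_mul.
have [t1 St1 Ht1] := Hg s Ss.
have [u Su Hu] := conj_boundedD (Esub_Dscale 0 Eg) Ss.
have [t2 St2 Ht2] := Hh u Su.
exists (t1 * t2) => [|c]; first by case: SM => _; apply.
have [y Ey ey] := Ht1 (t2 * c); have [y' Ey' ey'] := Ht2 (t1 * c).
have [y'' Ey'' ey''] := Hu y' Ey'.
exists (y *m y''); first exact: sgen_mul.
rewrite !map_mxM -{1}mulrA ey [t1 * t2]mulrC -mulrA ey' -!mulmxA; congr (_ *m _).
by rewrite !mulmxA ey''.
Qed.

(** The inverse of y u(0) has its factors in the wrong order; conjugation by v(0) restores it. *)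
Lemma dilatesV u v : mx_inverse u v -> dilates u -> dilates v.
Proof.
move=> uv [Eu Hu]; have Ev : Esub LD 1 v by apply: sgen_inv Eu uv.
split=> // s Ss.
have [t St Ht] := conj_boundedD (Esub_Dscale 0 Ev) Ss.
have [t0 St0 H0] := Hu t St; exists t0 => // c.
have [y Ey ey] := H0 c; have [y' yy'] := Esub_GL Ey.
have Ey' : Esub LC t y' by apply: sgen_inv Ey yy'.
have [y'' Ey'' ey''] := Ht y' Ey'; exists y'' => //; rewrite -ey''.
apply: (mx_inverse_uniq (map_mx_inverse (pscale B (t0 * c)) uv)); rewrite ey.
apply: mx_inverseM; first exact: map_mx_inverse.
exact: map_mx_inverse.
Qed.

Lemma dilates_swap g : dilates g ->
  dilates (swap (upoly B) n *m g *m swapV (upoly B) n).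
Proof.
move=> [Eg Hg]; split=> [|s Ss]; first exact: Esub_swap.
have [t0 St0 H0] := Hg s Ss; exists t0 => // c.
have [y Ey ey] := H0 c; exists (swap (upoly A) n *m y *m swapV (upoly A) n).
  exact: Esub_swap.
rewrite !map_mxM !(map_swap _ (pscale_uhom B _)) !(map_swapV _ (pscale_uhom B _)).
rewrite (map_swap _ FU) (map_swapV _ FU) ey !mulmxA.
by rewrite -(mulmxA _ (swapV _ _) (swap _ _)) (swap_inv _ _).2 mulmx1.
Qed.

(** up b(t T) = up (b(t T) - b(0)) up b(0), and the difference is divisible by t, so a suitable t
    absorbs the denominators. *)
Lemma dilates_up_gen b : lam_gen LD b -> dilates (up b).
Proof.
move=> bg; split=> [|s Ss].
  by apply: Esub1_up; apply: lam_gen_LamMat.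
suff [t0 St0 H0] : exists2 t0, S t0 & forall c, exists2 b', LamMat LC b' &
    map_mx (pscale B (t0 * c)) b - map_mx (pscale B 0) b =
    map_mx F (uin (upoly A) s ^+ 2 *: b').
  exists t0 => // c; have [b' Lb' eb'] := H0 c.
  exists (up (uin (upoly A) s ^+ 2 *: b')); first exact: Esub_up.
  by rewrite !map_up -upD -eb' subrK.
have [S1 SMM] := SM.
case: bg => [i j a ij|i a La].
  have [e Se [w ew]] := (umap_loc SM fU f_loc).2 a.
  exists (s ^+ 2 * e); first by rewrite expr2; apply: (SMM) => //; apply: SMM.
  move=> c; set z := uin (upoly A) c * pquot (s ^+ 2 * e * c) w.
  exists (z *: delta_mx i j - (ulam (upoly A) * ubar z) *: delta_mx j i).
    by apply: lam_gen_LamMat => //; apply: lam_short.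
  have Y : _ = umap f (_ * z) := pscale_clear fU s c ew.
  clearbody z; set t := _ * c in Y *.
  have [sb sl _] := pscale_uhom B t; have [sb0 sl0 _] := pscale_uhom B 0.
  have [pb pl _] := FU.
  have -> : uin (upoly A) s ^+ 2 *: (z *: delta_mx i j - (ulam (upoly A) * ubar z) *: delta_mx j i) =
      (uin (upoly A) s ^+ 2 * z) *: delta_mx i j -
      (ulam (upoly A) * ubar (uin (upoly A) s ^+ 2 * z)) *: delta_mx j i :> 'M_n.
    rewrite scalerBr !scalerA; congr (_ - _ *: _); rewrite -!rmorphXn.
    by rewrite (barM (ubarI (upoly A))) ubar_in -(uinC _ (ubar z)) !mulrA (uinC _ (ulam _)).
  rewrite !map_mxB !map_mxZ !map_delta_mx !(rmorphM (pscale B _)) sb sl sb0 sl0.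
  rewrite (rmorphM F (ulam _)) pl pb -Y opprD addrACA -opprD -!scalerBl -mulrBr.
  by rewrite (barD (ubarI (upoly B))) (barN (ubarI (upoly B))).
have [t0 St0 H0] := fparam_pscale_clear LF0 SM fU f_loc phiU Ss La.
exists t0 => // c; have [z Lz ez] := H0 c; exists (z *: delta_mx i i).
  by apply: lam_gen_LamMat => //; apply: lam_long.
by rewrite !map_mxZ !map_delta_mx /= -scalerBl ez rmorphM scalerA.
Qed.

Lemma dilates_up b : LamMat LD b -> dilates (up b).
Proof.
move: b; apply: LamMat_ind => [|b c|b].
- by rewrite up0; apply: dilates1.
- by rewrite upD; apply: dilatesM.
- exact: dilates_up_gen.
Qed.

Lemma Esub_dilates (g : 'M[upoly B]_(n + n)) : Esub LD 1 g -> dilates g.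
Proof.
have E (b : 'M[upoly B]_n) : uin (upoly B) 1 ^+ 2 *: b = b.
  by rewrite rmorph1 expr1n scale1r.
elim=> [_ [] _ [b Lb ->]||u v _ Hu _ Hv|u v _ Hu uv].
- by rewrite E; apply: dilates_up.
- by rewrite E -swap_up; apply/dilates_swap/dilates_up.
- exact: dilates1.
- exact: dilatesM.
- exact: dilatesV uv Hu.
Qed.

(** Dilation by t0 gives an elementary y over [A] with the same image over [B] as be(t0 T). After
    normalizing y to 1 at T = 0, the difference is S-torsion without constant term, so T := u T with
    an annihilator u makes both sides equal. *)
Theorem dilation (be : 'M[upoly A]_(n + n)) :
  map_mx (pscale A 0) be = 1%:M -> Esub LD 1 (map_mx F be) ->
  exists2 t, S t & Esub LC 1 (map_mx (pscale A t) be).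
Proof.
move=> be0 /Esub_dilates[_ H]; have [S1 SMM] := SM.
have [t0 St0 /(_ 1)] := H 1 S1; rewrite mulr1 => -[y Ey ey].
have comm u (M : 'M[upoly A]_(n + n)) : map_mx (pscale B u) (map_mx F M) = map_mx F (map_mx (pscale A u) M).
  by apply/matrixP => i j; rewrite !mxE umap_pscale.
rewrite !comm be0 map_mx1 mulmx1 in ey.
have scE u (M : 'M[upoly A]_(n + n)) : Esub LC 1 M -> Esub LC 1 (map_mx (pscale A u) M).
  exact: (Esub_map (pscale_uhom A u) (@fparam_pscaleC u)).
have sc0 u (M : 'M[upoly A]_(n + n)) : map_mx (pscale A 0) (map_mx (pscale A u) M) = map_mx (pscale A 0) M.
  by apply/matrixP => i j; rewrite !mxE pscale_pscale mulr0.
have Ey0 := scE 0 _ Ey; have [y0' y0_inv] := Esub_GL Ey0.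
have Fy0 : map_mx F (map_mx (pscale A 0) y) = 1%:M.
  by rewrite -comm -ey comm sc0 be0 map_mx1.
have Fy0' : map_mx F y0' = 1%:M.
  by have [] := map_mx_inverse F y0_inv; rewrite Fy0 mul1mx.
pose y1 := y *m y0'.
have Ey1 : Esub LC 1 y1 by apply: sgen_mul => //; apply: sgen_inv y0_inv.
have Fy1 : map_mx F y1 = map_mx F (map_mx (pscale A t0) be).
  by rewrite map_mxM Fy0' mulmx1 ey.
have y10 : map_mx (pscale A 0) y1 = 1%:M.
  rewrite map_mxM.
  have := map_mx_inverse (pscale A 0) y0_inv.
  have := sc0 0 y; rewrite -[in RHS](sc0 0 y) => _ [].
  by rewrite sc0.
clearbody y1.
have [|u Su hu] := common_annihilator SM (umap_loc SM fU f_loc)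
    (x := fun ij : 'I_(n + n) * 'I_(n + n) => map_mx (pscale A t0) be ij.1 ij.2 - y1 ij.1 ij.2).
  move=> [i j] /=; rewrite rmorphB.
  by move/matrixP/(_ i j): Fy1; rewrite !mxE => ->; rewrite subrr.
exists (t0 * u); first exact: SMM.
suff -> : map_mx (pscale A (t0 * u)) be = map_mx (pscale A u) y1 by apply: scE.
apply/matrixP => i j; rewrite !mxE -pscale_pscale.
apply/polyP => l; rewrite [LHS]coef_pscale [RHS]coef_pscale.
have h0 : (pscale A t0 (be i j))`_0 = (y1 i j)`_0.
  move/matrixP/(_ i j): y10; move/matrixP/(_ i j): be0; rewrite !mxE => <-.
  by move/polyP/(_ 0%N); rewrite !coef_pscale !expr0 !mul1r.
case: l => [|l]; first by rewrite h0.
have := hu (i, j); rewrite /= mxE => /polyP/(_ l.+1); rewrite coef_in coefB coef0.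
rewrite mulrBr => /eqP; rewrite subr_eq0 => /eqP e.
by rewrite exprSr -!mulrA e.
Qed.

End Dilation.

(** * The local-global principle *)

Lemma ex_maximal_ideal (k : comNzRingType) (J : {pred k}) : idealr_closed J ->
  exists m : maximal_ideal k, {subset J <= mideal m}.
Proof.
move=> [J0 J1 JD].
(* Zorn's lemma is applied to sets whose union with J is an ideal, so that the empty chain needs no
   separate treatment. *)
pose U (X : set k) : {pred k} := fun x => `[< X x \/ x \in J >].
have UP X x : reflect (X x \/ x \in J) (x \in U X) by exact: asboolP.
pose P (X : set k) := idealr_closed (U X).
have [F FP Ftot|M [PM maxM]] := @Zorn_bigcup k P.
  split; first by apply/UP; right.
    apply/UP => -[[X FX X1]|]; last exact/negP.
    by have [_ /negP + _] := FP _ FX; apply; apply/UP; left.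
  have JX X a u v : F X -> X u -> v \in J -> (\bigcup_(Y in F) Y)%classic (a * u + v) \/ a * u + v \in J.
    move=> FX Xu vJ; have [_ _ D] := FP _ FX.
    have /UP[h|h] : a * u + v \in U X by apply: D; apply/UP; [left | right].
      by left; exists X.
    by right.
  move=> a u v /UP[[X FX Xu]|uJ] /UP[[Y FY Yv]|vJ]; apply/UP.
  - have [XY|YX] := Ftot _ _ FX FY.
      have [_ _ D] := FP _ FY.
      have /UP[h|h] : a * u + v \in U Y by apply: D; apply/UP; left => //; apply: XY.
        by left; exists Y.
      by right.
    have [_ _ D] := FP _ FX.
    have /UP[h|h] : a * u + v \in U X by apply: D; apply/UP; left => //; apply: YX.
      by left; exists X.
    by right.
  - exact: JX FX Xu vJ.
  - have [_ _ D] := FP _ FY.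
    have /UP[h|h] : a * u + v \in U Y by apply: D; apply/UP; [right | left].
      by left; exists Y.
    by right.
  - by right; apply: JD.
have max K : idealr_closed K -> {subset U M <= K} -> {subset K <= U M}.
  move=> KI sub x xK; apply: contrapT => nx.
  apply: (maxM [set y | y \in K]%classic).
    split=> [y My|]; first by apply: sub; apply/UP; left.
    by move=> h; apply: nx; apply/UP; left; apply: h.
  have e : U [set y | y \in K]%classic =i K.
    move=> y; apply/UP/idP => [[//|yJ]|]; last by left.
    by apply: sub; apply/UP; right.
  case: KI => K0 K1 KD; split; rewrite ?e // => a u v; rewrite !e.
  exact: KD.
exists (MaximalIdeal PM max) => x xJ; apply/UP; by right.
Qed.

Lemma poly_hom_ext (R S : nzRingType) (f g : {rmorphism {poly R} -> S}) :
  (forall c, f c%:P = g c%:P) -> f 'X = g 'X -> f =1 g.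
Proof.
move=> fgC fgX; elim/poly_ind=> [|p c IH]; first by rewrite !raddf0.
by rewrite !rmorphD !rmorphM fgC fgX IH.
Qed.

Arguments peval : simpl never.
Arguments pscale : simpl never.
Arguments umap : simpl never.

Lemma umapC (k : comNzRingType) (A B : uring k) (f : {rmorphism A -> B}) c :
  umap f c%:P = (f c)%:P.
Proof. exact: map_polyC. Qed.

Lemma umapX (k : comNzRingType) (A B : uring k) (f : {rmorphism A -> B}) :
  umap f 'X = 'X.
Proof. exact: map_polyX. Qed.

Section LocalGlobal.
Variables (k : comNzRingType) (R : uring k) (L : set R).
Hypothesis LF : form_parameter (@ubar k R) (ulam R) L.
Variables (gen : bool) (n : nat).
Hypothesis n3 : (2 < n)%N.

Local Notation RX := (upoly R).
Local Notation iota := (polyC : {rmorphism R -> upoly R}).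
Local Notation LX := (fparam L gen iota).

(** The first alternative expresses that R_m is the zero ring, over which no polynomial ring is
    formed. *)
Definition locally_elementary (al : 'M[RX]_(n + n)) : Prop :=
  forall m : maximal_ideal k,
    (exists2 s, in_den m s & uin R s = 0) \/
    exists (Rm : uring k) (loc : {rmorphism R -> Rm}),
    [/\ uhom loc, is_localization [set s | in_den m s]%classic loc
      & Esub (fparam L gen (phiD loc idfun)) 1 (map_mx (umap loc) al)].

Let iotaU : uhom iota := polyC_uhom R.
(** Total in u, unlike [peval], with which it agrees at central fixed points. *)
Definition psub (u : RX) : RX -> RX := fun p => (map_poly iota p).[u].

Section Quillen.
Variables (al al' : 'M[RX]_(n + n)).
Hypothesis al_inv : mx_inverse al al'.

Definition quillen (b : k) : Prop := forall u v : RX, central_fixed u -> central_fixed v ->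
  Esub LX 1 (map_mx (psub (u + uin RX b * v)) al *m map_mx (psub u) al').

Lemma psub_inv u : central_fixed u -> mx_inverse (map_mx (psub u) al) (map_mx (psub u) al').
Proof. by move=> uF; apply: (map_mx_inverse (peval iota uF)). Qed.

Lemma quillen0 : quillen 0.
Proof.
move=> u v uF vF; rewrite rmorph0 mul0r addr0 (psub_inv uF).1.
exact: sgen_one.
Qed.

(** Telescoping: shift by c v first, then by b (a v). The factor a is absorbed since v is
    arbitrary. *)
Lemma quillenD a b c : quillen b -> quillen c -> quillen (a * b + c).
Proof.
move=> Qb Qc u v uF vF.
have cvF : central_fixed (uin RX c * v) by apply: central_fixedM => //; apply: central_fixed_in.
have avF : central_fixed (uin RX a * v) by apply: central_fixedM => //; apply: central_fixed_in.
have ucF := central_fixedD uF cvF.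
have -> : u + uin RX (a * b + c) * v = (u + uin RX c * v) + uin RX b * (uin RX a * v).
  by rewrite mulrC rmorphD rmorphM mulrDl mulrA addrA addrAC.
have := sgen_mul (Qb _ _ ucF avF) (Qc _ _ uF vF).
by rewrite mulmxA -(mulmxA _ (map_mx (psub (u + uin RX c * v)) al')) (psub_inv ucF).2 mulmx1.
Qed.

Lemma quillen_in0 s : uin R s = 0 -> quillen s.
Proof.
move=> s0 u v uF vF; have -> : uin RX s = 0 by rewrite /= s0.
rewrite mul0r addr0 (psub_inv uF).1; exact: sgen_one.
Qed.

(* Dilation is applied to al(Y + T) al(Y)^-1 over R[Y][T]; u1 is Y + T. *)
Let u1 (Z : uring k) : upoly (upoly Z) := ('X : upoly Z)%:P + 'X.

Let u1F (Z : uring k) : central_fixed (u1 Z).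
Proof.
apply: central_fixedD; last exact: central_fixedX.
exact/central_fixedC/central_fixedX.
Qed.

Let CC (Z : uring k) : {rmorphism Z -> upoly (upoly Z)} :=
  (polyC : {rmorphism upoly Z -> upoly (upoly Z)}) \o (polyC : {rmorphism Z -> upoly Z}).

Let CCU (Z : uring k) : uhom (CC Z).
Proof. exact: uhom_comp (polyC_uhom Z) (polyC_uhom (upoly Z)). Qed.

Let shift (Z : uring k) : {rmorphism upoly Z -> upoly (upoly Z)} := peval (CC Z) (u1F Z).

Let shiftU (Z : uring k) : uhom (shift Z).
Proof. exact: (peval_uhom (CCU Z) (u1F Z)). Qed.

(** Dilation makes al(Y + t T) al(Y)^-1 elementary over R[X]; the substitution Y := u, T := v
    specializes it to all central fixed u and v at once. *)
Lemma quillen_local (m : maximal_ideal k) : locally_elementary al ->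
  exists2 t, in_den m t & quillen t.
Proof.
move=> /(_ m)[[s ms /quillen_in0 Qs]|[Rm [loc [locU loc_loc alE]]]]; first by exists s.
set S := [set s | in_den m s]%classic.
have SM : mul_closed S by split; [exact: in_den1 | exact: in_denM].
set f := umap loc.
have fU : uhom f := umap_uhom locU.
have f_loc : is_localization S f := umap_loc SM locU loc_loc.
have idU : uhom (idfun : {rmorphism R -> R}) by split.
pose be := map_mx (shift R) al *m map_mx (polyC : {rmorphism RX -> upoly RX}) al'.
have be0 : map_mx (pscale RX 0) be = 1%:M.
  have -> : 1%:M = map_mx (polyC : {rmorphism RX -> upoly RX}) (al *m al').
    by rewrite al_inv.1 map_mx1.
  rewrite !map_mxM; congr (_ *m _); apply/matrixP => i j; rewrite !mxE; last exact: pscaleC.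
  apply: (@poly_hom_ext _ _ (pscale RX 0 \o shift R) (polyC : {rmorphism RX -> upoly RX})) => [c|].
    change (pscale RX 0 (shift R c%:P) = c%:P%:P).
    by rewrite [shift R _]pevalC; apply: pscaleC.
  change (pscale RX 0 (shift R 'X) = 'X%:P).
  rewrite [shift R _]pevalX rmorphD [pscale RX 0 'X]pevalX pscaleC.
  by rewrite /pscale_pt rmorph0 mul0r addr0.
have Fbe : Esub (fparam L gen (phiD f iota)) 1 (map_mx (umap f) be).
  have F1 : map_mx (umap f) (map_mx (shift R) al) = map_mx (shift Rm) (map_mx (umap loc) al).
    apply/matrixP => i j; rewrite !mxE.
    apply: (@poly_hom_ext _ _ (umap f \o shift R) (shift Rm \o umap loc)) => [c|].
      change (umap f (shift R c%:P) = shift Rm (umap loc c%:P)).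
      rewrite [shift R _]pevalC umapC [shift Rm _]pevalC.
      rewrite [LHS](@umapC _ RX).
      by congr (_%:P); apply: umapC.
    change (umap f (shift R 'X) = shift Rm (umap loc 'X)).
    by rewrite [shift R _]pevalX umapX [shift Rm _]pevalX /u1 rmorphD umapC !umapX.
  have F2 : map_mx (umap f) (map_mx (polyC : {rmorphism RX -> upoly RX}) al') =
      map_mx (polyC : {rmorphism upoly Rm -> upoly (upoly Rm)}) (map_mx (umap loc) al').
    by apply/matrixP => i j; rewrite !mxE; apply: (@umapC _ RX).
  rewrite map_mxM F1 F2.
  have phU := phiD_uhom locU idU.
  apply: sgen_mul.
    apply: (Esub_map (shiftU Rm)) alE => x.
    apply: (fparam_map LF phU (shiftU Rm)) => r.
    change (shift Rm (umap loc r%:P) = umap f (r%:P : upoly R)%:P).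
    rewrite umapC [LHS]pevalC [RHS](@umapC _ RX).
    by congr (_%:P); apply/esym/umapC.
  have al'E : Esub (fparam L gen (phiD loc idfun)) 1 (map_mx (umap loc) al').
    by apply: sgen_inv alE _; apply: map_mx_inverse.
  apply: (Esub_map (polyC_uhom (upoly Rm))) al'E => x.
  apply: (fparam_map LF phU (polyC_uhom (upoly Rm))) => r.
  by apply/esym/(@umapC _ RX).
have [t St tE] := dilation LF SM fU f_loc iotaU n3 be0 Fbe.
exists t => // u v uF vF.
(* Y is evaluated at u by [e1], then T at v by [ev]. *)
pose e1 : {rmorphism RX -> RX} := peval iota uF.
have e1U : uhom e1 := peval_uhom iotaU uF.
pose ev : {rmorphism upoly RX -> RX} := peval e1 vF.
have evU : uhom ev := peval_uhom e1U vF.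
have tvF : central_fixed (u + uin RX t * v).
  by apply: central_fixedD => //; apply: central_fixedM => //; apply: central_fixed_in.
have -> : map_mx (psub (u + uin RX t * v)) al *m map_mx (psub u) al' =
    map_mx ev (map_mx (pscale RX t) be).
  rewrite !map_mxM; congr (_ *m _); apply/matrixP => i j; rewrite !mxE.
    apply: (@poly_hom_ext _ _ (peval iota tvF) (ev \o (pscale RX t \o shift R))) => [c|].
      change (peval iota tvF c%:P = ev (pscale RX t (shift R c%:P))).
      rewrite [LHS]pevalC [shift R _]pevalC.
      rewrite -[CC R c]/((c%:P : upoly R)%:P : upoly (upoly R)) pscaleC.
      by rewrite [RHS]pevalC [RHS]pevalC.
    change (peval iota tvF 'X = ev (pscale RX t (shift R 'X))).
    rewrite [LHS]pevalX [shift R _]pevalX /u1 rmorphD [pscale RX t 'X]pevalX.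
    rewrite pscaleC rmorphD [ev _%:P]pevalC [e1 _]pevalX.
    rewrite /pscale_pt rmorphM [ev 'X]pevalX; congr (_ + _ * _).
    by have [_ _ ->] := evU.
  change (psub u (al' i j) = ev (pscale RX t (al' i j)%:P)); rewrite pscaleC [ev _]pevalC.
  by [].
apply: (Esub_map evU) tE => x; apply: (fparam_map LF (phiC_uhom iotaU) evU) => r.
by rewrite /phiC /= [ev _]pevalC [e1 _]pevalC.
Qed.

Theorem local_global_principle : map_mx (psub 0) al = 1%:M ->
  locally_elementary al -> Esub LX 1 al.
Proof.
move=> al0 alL.
have Q1 : quillen 1.
  apply: contrapT => nQ1.
  pose J : {pred k} := fun b => `[< quillen b >].
  have JP b : reflect (quillen b) (b \in J) by exact: asboolP.
  have [|m Jm] := @ex_maximal_ideal k J.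
    split; [exact/JP/quillen0 | exact/JP |].
    by move=> a b c /JP Qb /JP Qc; apply/JP/quillenD.
  have [t mt /JP/Jm] := quillen_local m alL.
  by rewrite /in_den in mt; apply/negP.
have F0 := central_fixed0 RX; have FX := central_fixedX R.
(* For u = 0, v = X and b = 1 the product is al(X) al(0)^-1. *)
have := Q1 0 'X F0 FX; rewrite rmorph1 mul1r add0r.
have -> : map_mx (psub 0) al' = 1%:M.
  by have [+ _] := psub_inv F0; rewrite al0 mul1mx.
rewrite mulmx1; congr (Esub _ _ _); apply/matrixP => i j; rewrite mxE.
apply: (@poly_hom_ext _ _ (peval iota FX) idfun) => [c|].
  exact: pevalC.
exact: pevalX.
Qed.

End Quillen.
End LocalGlobal.

(** * Normality *)

Section Normality.
Variables (k : comNzRingType) (R : uring k) (L : set R).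
Hypothesis LF : form_parameter (@ubar k R) (ulam R) L.
Variables (gen : bool) (n : nat).
Hypothesis n3 : (2 < n)%N.
Hypothesis genL : forall x, fparam L gen (idfun : R -> R) x -> L x.

Definition locally_column_reducible : Prop :=
  forall m : maximal_ideal k,
    (exists2 s, in_den m s & uin R s = 0) \/
    exists (Rm : uring k) (loc : {rmorphism R -> Rm}),
    [/\ uhom loc, is_localization [set s | in_den m s]%classic loc
      & column_reducible n (fparam L gen loc)].

Hypothesis locally_reducible : locally_column_reducible.

Local Notation RX := (upoly R).
Local Notation iota := (polyC : {rmorphism R -> upoly R}).
Local Notation LX := (fparam L gen iota).

Let idU : uhom (idfun : {rmorphism R -> R}). Proof. by split. Qed.
Let iotaU : uhom iota := polyC_uhom R.
Let LXF : form_parameter (@ubar k RX) (ulam RX) LX :=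
  fparam_form_parameter LF gen iotaU.

Lemma fparam_base (Z : uring k) (phi : {rmorphism R -> Z}) x : uhom phi ->
  L x -> fparam L gen phi (phi x).
Proof.
move=> phiU Lx; rewrite /fparam; case: gen; last by apply: (image_Lambda_max LF phiU); exists x.
by move=> L' _; apply; exists x.
Qed.

(* The local-global principle for al up(X^2 b) al^-1, evaluated at X = 1. *)
Lemma conj_up_Esub al al' (b : 'M[R]_n) : GQ (@ubar k R) (ulam R) L al ->
  mx_inverse al al' -> LamMat L b -> Esub L 1 (al *m up b *m al').
Proof.
move=> alG al_inv bL.
(* X^2 b, written as a conjugate so that it visibly stays in the form parameter. *)
pose B : 'M[RX]_n := ctmx (@ubar k RX) ('X : RX)%:M *m map_mx iota b *m ('X : RX)%:M.
have BL : LamMat LX B by apply/(LamMat_conj LXF)/(LamMat_map iotaU _ bL) => x; apply: fparam_base.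
pose be : 'M[RX]_(n + n) := map_mx iota al *m up B *m map_mx iota al'.
pose be' : 'M[RX]_(n + n) := map_mx iota al *m up (- B) *m map_mx iota al'.
have ial_inv := map_mx_inverse iota al_inv.
have be_inv : mx_inverse be be'.
  rewrite /be /be' -[X in mx_inverse _ X]mulmxA.
  apply: mx_inverseM; last exact: mx_inverse_sym.
  by apply: mx_inverseM => //; apply: up_inv.
have evE (Z : uring k) (phi : {rmorphism R -> Z}) (phU : uhom phi) (u : Z) (uF : central_fixed u) :
    map_mx (peval phi uF) be = map_mx phi al *m up (u *: (u *: map_mx phi b)) *m map_mx phi al'.
  have C p q (M : 'M[R]_(p, q)) : map_mx (peval phi uF) (map_mx iota M) = map_mx phi M.
    by apply/matrixP => i j; rewrite !mxE; apply: pevalC.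
  rewrite /be !map_mxM !C (map_up); congr (_ *m up _ *m _).
  have X1 : map_mx (peval phi uF) (('X : RX)%:M : 'M_n) = u%:M by rewrite map_scalar_mx /= [X in X%:M]pevalX.
  rewrite /B !map_mxM C X1 (map_ctmx (peval_uhom phU uF)) X1.
  rewrite -(scalemx1 _ u) (ctmx_scale (ubarI Z)); last exact: uF.1.
  by rewrite uF.2 (ctmx1 (ubarI Z)) -!scalemxAl mul1mx scalemx_centralr ?mulmx1 //; apply: uF.1.
have F1 := central_fixed1 R.
have -> : al *m up b *m al' = map_mx (peval idfun F1) be.
  by rewrite (evE _ _ idU) !scale1r !map_mx_id.
suff beE : Esub LX 1 be.
  apply: (Esub_map (peval_uhom idU F1)) beE => x hx; apply: genL.
  by apply: (fparam_map LF iotaU (peval_uhom idU F1)) hx => y; apply: pevalC.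
apply: (local_global_principle LF n3 be_inv).
  have := evE _ _ iotaU _ (central_fixed0 RX).
  by rewrite !scale0r up0 mulmx1 ial_inv.1.
move=> m; have [zero|[Rm [loc [locU loc_loc red]]]] := locally_reducible m; first by left.
right; exists Rm, loc; split=> //.
have locLF := fparam_form_parameter LF gen locU.
have DU := phiD_uhom locU idU.
have fC (M : 'M[R]_(n + n)) : map_mx (umap loc) (map_mx iota M) =
    map_mx (polyC : {rmorphism Rm -> upoly Rm}) (map_mx loc M).
  by apply/matrixP => i j; rewrite !mxE; apply: umapC.
rewrite /be !map_mxM !fC.
(* al is constant in X, so its columns are reduced over R_m while [B] has entries in R_m[X]. *)
apply: (GQ_normalizes_Esub (polyC_uhom Rm) locLF (fparam_form_parameter LF gen DU)) red _ _ _ _ _ _ => //.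
- move=> x; apply: (fparam_map LF locU (polyC_uhom Rm)) => r.
  by apply/esym; apply: umapC.
- by apply: (GQ_map locU LF locLF) alG => x; apply: fparam_base.
- exact: map_mx_inverse.
- apply: (Esub_map (umap_uhom locU) _ (Esub1_up BL)) => x.
  by apply: (fparam_map LF iotaU (umap_uhom locU)).
Qed.

Theorem GQ_normalizes (al al' g : 'M[R]_(n + n)) : GQ (@ubar k R) (ulam R) L al ->
  mx_inverse al al' -> Esub L 1 g -> Esub L 1 (al *m g *m al').
Proof.
move=> alG al_inv; apply: sgen_conj => //.
have E (b : 'M[R]_n) : uin R 1 ^+ 2 *: b = b by rewrite rmorph1 expr1n scale1r.
move=> _ [] _ [b Lb ->]; rewrite E; first exact: conj_up_Esub.
have swG : GQ (@ubar k R) (ulam R) L (al *m swap R n) by apply: GQM => //; apply: GQ_swap.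
have := conj_up_Esub swG (mx_inverseM al_inv (swap_inv R n)) Lb.
by rewrite -(swap_up b) !mulmxA.
Qed.

End Normality.

(** * Localization at a maximal ideal *)

Section BaseRing.
Variables (k : comNzRingType) (R : algType k) (bar : {linear R -> R}) (lam : R).
Hypotheses (bI : involution bar) (lC : central lam) (lU : lam * bar lam = 1).

Fact in_alg_central c : central (in_alg R c).
Proof. by move=> x; rewrite /GRing.in_alg /= -scalerAl mul1r -scalerAr mulr1. Qed.

Fact bar_in_alg c : bar (in_alg R c) = in_alg R c.
Proof. by rewrite /GRing.in_alg /= linearZ (bar1 bI). Qed.

Definition base_uring : uring k :=
  @URing k R bar lam (in_alg R : {rmorphism k -> R}) bI lC lU in_alg_central bar_in_alg.

Variable m : maximal_ideal k.
Local Notation RmT := (loc_ring m R).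
Local Notation frac := (@Localization.frac k m R).

Lemma fracD x y s t : frac x s + frac y t = frac (dval t *: x + dval s *: y) (denM s t).
Proof. exact: esym (Localization.pi_add (x, s) (y, t)). Qed.

Lemma fracM x y s t : frac x s * frac y t = frac (x * y) (denM s t).
Proof. exact: esym (Localization.pi_mul (x, s) (y, t)). Qed.

Lemma frac_cong x s t : dval s = dval t -> frac x s = frac x t.
Proof. by move=> st; apply: Localization.eq_fracE. Qed.

Lemma loc_bar_involution : involution (loc_bar m bar : RmT -> RmT).
Proof.
have [bD bM bK] := bI; split=> [x y|x y|x];
  have [x0 [s ->]] := Localization.fracP x;
  try have [y0 [t ->]] := Localization.fracP y.
- by rewrite fracD !Localization.loc_barE fracD linearD !linearZ.
- rewrite fracM !Localization.loc_barE fracM bM; apply: frac_cong.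
  by rewrite /= mulrC.
- by rewrite !Localization.loc_barE bK.
Qed.

Lemma loc_mapK x (s : den m) : loc_map m (in_alg R (dval s)) * frac x s = loc_map m x.
Proof.
rewrite fracM /GRing.in_alg /= -scalerAl mul1r; apply/Localization.eq_frac.
by exists (den1 m); rewrite /= scalerA !mul1r.
Qed.

Lemma loc_map_central z : central z -> central (loc_map m z : RmT).
Proof.
move=> zC x; have [x0 [s ->]] := Localization.fracP x.
by rewrite !fracM zC; apply: frac_cong; rewrite /= mulrC.
Qed.

Lemma loc_bar_map x : loc_bar m bar (loc_map m x) = loc_map m (bar x).
Proof. exact: Localization.loc_barE. Qed.

Lemma loc_map_eq0 (x : R) : loc_map m x = 0 <-> exists2 s, in_den m s & s *: x = 0.
Proof.
have -> : (0 : RmT) = loc_map m 0 by rewrite raddf0.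
split=> [/Localization.eq_frac[u]|[s ms sx]].
  by rewrite /= mulr1 scaler0 => ux; exists (dval u) => //; apply: denP.
by apply/Localization.eq_frac; exists (Den ms); rewrite /= mulr1 sx scaler0.
Qed.

Section NonZero.
Variable nz : (1 : RmT) != 0.

Definition loc_hom : {rmorphism base_uring -> loc_nz nz} :=
  (loc_map m : {rmorphism R -> RmT}).

Fact loc_lamU : loc_hom lam * loc_bar m bar (loc_hom lam) = 1.
Proof. by rewrite [loc_bar _ _ _]loc_bar_map -[RHS](rmorph1 loc_hom) -lU (rmorphM loc_hom). Qed.

Definition loc_in : {rmorphism k -> loc_nz nz} := loc_hom \o uin base_uring.

Fact loc_inC c : central (loc_in c).
Proof. exact/loc_map_central/in_alg_central. Qed.

Fact loc_bar_in c : loc_bar m bar (loc_in c) = loc_in c.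
Proof. by rewrite [LHS]loc_bar_map bar_in_alg. Qed.

Definition loc_uring : uring k :=
  @URing k (loc_nz nz) (loc_bar m bar) (loc_hom lam) loc_in loc_bar_involution
    (loc_map_central lC) loc_lamU loc_inC loc_bar_in.

Definition loc_uhom : {rmorphism base_uring -> loc_uring} := loc_hom.

Lemma loc_homU : uhom loc_uhom.
Proof. by split=> [x||c] //=; rewrite [RHS]loc_bar_map. Qed.

Lemma loc_hom_localization : is_localization [set s | in_den m s]%classic loc_uhom.
Proof.
split=> [x /loc_map_eq0[s ms sx]|y].
  by exists s; rewrite //= /GRing.in_alg /= -scalerAl mul1r.
have [x [s ->]] := Localization.fracP y; exists (dval s); first exact: denP.
by exists x; apply: loc_mapK.
Qed.

Hypothesis Rfin : fin_gen_module R.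

(* Determinant trick: if g_i generate R and M is the matrix of right
   multiplication by s + c y0, then det M = s^d modulo m is invertible. *)
Lemma loc_in_jac c : c \in mideal m -> jac (uin loc_uring c).
Proof.
move=> mc y; have [y0 [s ys]] := Localization.fracP y.
have [d [g gS]] := Rfin.
have [C hC] := choice (fun i => gS (g i * y0)).
have [e he] := gS 1.
have [f [f0 _]] := residue_mapE m.
pose M : 'M[k]_d := (dval s)%:M + c *: \matrix_(i, j) C i j.
have md : in_den m (\det M).
  rewrite /in_den; apply/negP => /f0; rewrite -det_map_mx.
  rewrite map_mxD map_mxZ map_scalar_mx /= (f0 c).2 // scale0r addr0 det_scalar => /eqP.
  by rewrite (@expf_eq0 (residue_field m)) => /andP[_ /eqP/f0]; apply/negP/denP.
(* The e_i are coefficients of 1 in the generators; the cofactors of M then give w (s + c y0) = det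
   M. *)
pose w : R := \sum_i \sum_j (e i * (\adj M) i j) *: g j.
have wE : w * (dval s *: 1 + c *: y0) = \det M *: 1.
  have gM i : g i * (dval s *: 1 + c *: y0) = \sum_j M i j *: g j.
    rewrite mulrDr -!scalerAr mulr1 hC scaler_sumr.
    rewrite [in RHS](eq_bigr (fun j => (dval s *+ (i == j)) *: g j + (c * C i j) *: g j)).
      rewrite big_split /= [X in _ = X + _](bigD1 i) //= eqxx mulr1n [X in _ = _ + X + _]big1 ?addr0.
        by congr (_ + _); apply: eq_bigr => j _; rewrite scalerA.
      by move=> j ji; rewrite eq_sym (negPf ji) scale0r.
    by move=> j _; rewrite !mxE scalerDl.
  rewrite /w mulr_suml [in RHS]he scaler_sumr; apply: eq_bigr => i _.
  rewrite mulr_suml.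
  under eq_bigr do rewrite -scalerAl gM scaler_sumr.
  rewrite exchange_big /=.
  rewrite (eq_bigr (fun j => (e i * ((\adj M *m M) i j)) *: g j)); last first.
    move=> j _; rewrite mxE mulr_sumr scaler_suml; apply: eq_bigr => l _.
    by rewrite scalerA mulrA.
  rewrite mul_adj_mx (bigD1 i) //= mxE eqxx mulr1n big1 ?addr0 ?scalerA ?(mulrC (e i)) //.
  by move=> j ji; rewrite mxE eq_sym (negPf ji) mulr0 scale0r.
exists (frac (dval s *: w) (Den md)).
have det_u : frac 1 (Den md) * loc_hom (\det M *: 1) = 1.
  rewrite -[LHS](loc_map_central (in_alg_central (\det M))).
  by rewrite [LHS](loc_mapK 1 (Den md)); apply: rmorph1.
rewrite -[RHS]det_u -wE.
have sy : loc_hom (in_alg R (dval s)) * (1 + y * uin loc_uring c) = loc_hom (dval s *: 1 + c *: y0).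
  rewrite mulrDr mulr1 mulrA ys [X in X * _](loc_mapK y0 s) (rmorphD loc_hom).
  congr (_ + _); rewrite -(rmorphM loc_hom); congr (loc_hom _).
  by rewrite /= /GRing.in_alg /= -scalerAr mulr1.
rewrite rmorphM mulrA -sy mulrA; congr (_ * _).
rewrite -mulrA -(rmorphM loc_hom) !fracM; apply/Localization.eq_frac.
by exists (den1 m); rewrite /GRing.in_alg /= -scalerAr !mulr1 !mul1r.
Qed.

(** A fraction x0 / s is congruent to t x0 modulo the radical when t s = 1 modulo m, so generators
    of R suffice without denominators. *)
Lemma loc_spans : exists d (g : 'I_d -> loc_uring), spans_mod_jac (uin loc_uring) g.
Proof.
have [d [g gS]] := Rfin; exists d, (fun i => loc_hom (g i)) => x.
have [x0 [s xs]] := Localization.fracP x; have [c hc] := gS x0.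
have [t ht] := mideal_inv (denP s).
exists (fun i => t * c i).
have -> : \sum_i uin loc_uring (t * c i) * loc_hom (g i) = uin loc_uring (t * dval s) * x.
  rewrite (rmorphM (uin loc_uring)) -mulrA xs [X in _ * X](loc_mapK x0 s) hc raddf_sum mulr_sumr.
  apply: eq_bigr => i _; rewrite (rmorphM (uin loc_uring)) -mulrA; congr (_ * _).
  rewrite -(rmorphM loc_hom); congr (loc_hom _).
  by rewrite /= /GRing.in_alg /= -scalerAl mul1r.
have -> : x - uin loc_uring (t * dval s) * x = - (uin loc_uring (t * dval s - 1) * x).
  by rewrite rmorphB rmorph1 mulrBl mul1r opprB.
by apply/jacN/jacMr/loc_in_jac.
Qed.

Lemma loc_columns_reducible n (L : set loc_uring) :
  form_parameter (@ubar k loc_uring) (ulam loc_uring) L -> (2 < n)%N ->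
  column_reducible n L.
Proof.
move=> LF n3; apply: (columns_reducible LF n3).
  by move=> x P; apply: (local_absolute_stable_range loc_in_jac loc_spans).
by move=> x z; apply: (local_left_inv_inv loc_in_jac loc_spans).
Qed.

End NonZero.
End BaseRing.

(** * Quadratic groups over R *)

Lemma psub0 (k : comNzRingType) (R : uring k) n (al : 'M[upoly R]_n) :
  map_mx (fun p : {poly R} => p.[0]) al = 1%:M -> map_mx (psub 0) al = 1%:M.
Proof.
move=> al0; rewrite -(map_mx1 (polyC : {rmorphism R -> {poly R}})) -al0.
apply/matrixP => i j; rewrite !mxE /psub !horner_coef0.
by rewrite coef_map.
Qed.

Section BaseRing.
Variables (k : comNzRingType) (R : algType k) (Rfin : fin_gen_module R).
Variables (bar : {linear R -> R}) (bI : involution bar) (lam : R).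
Hypotheses (lC : central lam) (lU : lam * bar lam = 1).
Variables (L : set R) (LF : form_parameter bar lam L).

Local Notation uR := (base_uring bI lC lU).
Let LF' : form_parameter (@ubar k uR) (ulam uR) L := LF.

Lemma zero_localization (m : maximal_ideal k) : (1 : loc_ring m R) == 0 ->
  exists2 s, in_den m s & uin uR s = 0.
Proof.
rewrite -(rmorph1 (loc_map m : {rmorphism R -> loc_ring m R})) => /eqP/loc_map_eq0[s ms s1].
by exists s.
Qed.

Lemma base_locally_reducible gen n : (2 < n)%N -> @locally_column_reducible k uR L gen n.
Proof.
move=> n3 m; have [/zero_localization|nz] := boolP ((1 : loc_ring m R) == 0); first by left.
right; exists (loc_uring bI lC lU nz), (loc_uhom bI lC lU nz); split.
- exact: loc_homU.
- exact: loc_hom_localization.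
- apply: loc_columns_reducible => //.
  exact: (fparam_form_parameter LF' gen (loc_homU bI lC lU nz)).
Qed.

Theorem EQ_normal n : (2 < n)%N -> normal_subgroup (EQ bar lam L (n := n)) (GQ bar lam L (n := n)).
Proof.
move=> n3; have E s := @EQ_Esub k uR n L LF' s n3.
split=> [|s|g g' s gG gg'].
- by apply: sgen_subgroup => s Es; apply: (@Esub_GL k uR n L 1); apply/E/sgen_base.
- by move/E/(@Esub_GQ k uR n L LF' 1 s).
- move=> /E Es; apply/E.
  apply: (GQ_normalizes LF' n3 _ (base_locally_reducible true n3)) => // x.
  by apply=> // _ [y Ly <-].
Qed.

Theorem EQ_local_global n : (2 < n)%N -> local_global_Q bar lam L n.
Proof.
move=> n3 al alG /(@psub0 k uR _ al) al0 alL.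
have LXF : form_parameter (@ubar k (upoly uR)) (ulam (upoly uR)) (poly_Lambda bar lam L).
  exact: (fparam_form_parameter LF' true (polyC_uhom uR)).
apply/(EQ_Esub LXF) => //; have [[al' al_inv] _ _ _] := alG.
apply: (local_global_principle (gen := true) LF' n3 al_inv) => // m.
have [/zero_localization|nz] := boolP ((1 : loc_ring m R) == 0); first by left.
right; exists (loc_uring bI lC lU nz), (loc_uhom bI lC lU nz); split.
- exact: loc_homU.
- exact: loc_hom_localization.
have locU := loc_homU bI lC lU nz.
set Rm := loc_uring bI lC lU nz in locU *; set loc := loc_uhom bI lC lU nz in locU *.
have LmF := fparam_form_parameter LF' true locU.
have LmXF := fparam_form_parameter LmF true (polyC_uhom Rm).
have idU : uhom (idfun : {rmorphism uR -> uR}) by split.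
have DF := fparam_form_parameter LF' true (phiD_uhom locU idU).
have /(EQ_Esub LmXF _ n3) E := alL m nz.
rewrite -[map_mx _ _](map_mx_id (f := idfun)) //.
have iU : uhom (idfun : {rmorphism upoly Rm -> upoly Rm}) by split.
(* The form parameter generated in two stages, over R_m and then over R_m[X], is contained in the
   one generated in a single stage from R. *)
apply: (Esub_map iU) E => x hx; apply: hx => // _ [c cL <-].
apply: (fparam_map LF' locU (polyC_uhom Rm) _ cL) => r.
by apply/esym; apply: umapC.
Qed.

End BaseRing.

(** * From Hermitian to quadratic groups *)

Section Hermitian.
Variables (k : comNzRingType) (Z : uring k) (r s : nat).
Local Notation n := (r + s)%N.
Local Notation bar := (@ubar k Z).
Local Notation lam := (ulam Z).
Local Notation "M ^h" := (ctmx bar M) (at level 8, format "M ^h").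
Local Notation Lmax := (Lambda_max bar lam).
Variables (a c : 'rV[Z]_r).
Hypothesis ac : forall i, a 0 i = c 0 i + lam * bar (c 0 i).

Let bI := ubarI Z.
Let lC := @ulamC k Z.
Let lVC := @ulamVC k Z.

Definition traceC : 'M[Z]_n := block_mx (diag_mx c) 0 0 0.
(** The factor [lam] cancels the one built into [lo]: the lower left block is [traceC^h] itself. *)
Definition herm_to_quad : 'M[Z]_(n + n) := lo (lam *: traceC^h).
Definition quad_to_herm : 'M[Z]_(n + n) := lo (- (lam *: traceC^h)).

Local Notation C1 := (diag_mx c).
Local Notation A1 := (A1mx a).
Local Notation D := (traceC^h).
Local Notation P := quad_to_herm.
Local Notation P' := herm_to_quad.

Lemma herm_quad_inv : mx_inverse P' P.
Proof. exact: lo_inv. Qed.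

Lemma A1E : A1 = C1 + lam *: C1^h.
Proof.
apply/matrixP => i j; rewrite !mxE ac; case: eqP => [->|]; first by rewrite eqxx !mulr1n.
by move=> /eqP ij; rewrite eq_sym (negPf ij) !mulr0n (bar0 bI) mulr0 addr0.
Qed.

Lemma A1h : A1^h = C1^h + bar lam *: C1.
Proof. by rewrite A1E ctmxD // ctmx_lam ctmxK. Qed.

Lemma traceCh : D = block_mx C1^h 0 0 0.
Proof. by rewrite ctmx_block !ctmx0. Qed.

Lemma AmxE : Amx s a = traceC + lam *: D.
Proof.
by rewrite traceCh /traceC scale_block_mx add_block_mx !scaler0 !addr0 -A1E.
Qed.

Lemma LamMat_max m (b : 'M[Z]_m) : LamMat Lmax b <-> b = - (lam *: b^h).
Proof.
split=> [[]//|e]; split=> // i.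
by rewrite /Lambda_max /= [in LHS]e !mxE.
Qed.

Lemma psiH_conj : P'^h *m psiQ lam n *m P' = psiH lam s a.
Proof.
rewrite /herm_to_quad /lo ulamVK /psiQ /psiH ctmx_block !ctmx1 // !ctmx0 // ctmxK //.
by rewrite !mulmx_block !mx01E AmxE mul_scalar_mx addrC.
Qed.

(** For the maximal form parameter, the diagonal conditions follow from the symmetry that
    preservation of the Hermitian form provides. *)
Lemma GQ_max (g : 'M[Z]_(n + n)) : GQ bar lam Lmax g <->
  GLmx g /\ g^h *m psiQ lam n *m g = psiQ lam n.
Proof.
split=> [[]//|[gG /psiQ_preserved e]]; apply/GQ_LamMat; split=> //.
exact/LamMat_max.
Qed.

Lemma GH_GQ g : GH bar lam (s := s) a g <-> GQ bar lam Lmax (P' *m g *m P).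
Proof.
have pp := herm_quad_inv; have [PP' P'P] := herm_quad_inv.
have E : g^h *m psiH lam s a *m g = psiH lam s a <->
    (P' *m g *m P)^h *m psiQ lam n *m (P' *m g *m P) = psiQ lam n.
  rewrite -psiH_conj !ctmxM // !mulmxA; split=> [e|e].
    have := congr1 (fun M => P^h *m M *m P) e; rewrite !mulmxA => ->.
    by rewrite -ctmxM // PP' ctmx1 // mul1mx -mulmxA PP' mulmx1.
  have := congr1 (fun M => P'^h *m M *m P') e; rewrite !mulmxA.
  by rewrite -ctmxM // P'P ctmx1 // mul1mx -(mulmxA _ P) P'P mulmx1.
rewrite GQ_max /GH E; split=> [[[g' gg'] e]|[[g' gg'] e]]; split=> //.
  exists (P' *m (g' *m P)); apply: mx_inverseM; last exact: mx_inverse_sym.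
  exact: mx_inverseM.
exists (P *m (g' *m P')).
have -> : g = P *m (P' *m g *m P) *m P'.
  by rewrite !mulmxA P'P mul1mx -mulmxA P'P mulmx1.
apply: mx_inverseM => //; apply: mx_inverseM gg'; exact: mx_inverse_sym.
Qed.

Lemma lo_lower (x y z : 'M[Z]_n) :
  P' *m block_mx x 0 y z *m P = block_mx x 0 (D *m x + y - z *m D) z.
Proof.
rewrite /herm_to_quad /quad_to_herm /lo scalerN !ulamVK !mulmx_block !mx01E.
by rewrite mulmxN.
Qed.

Lemma lo_upper (y z : 'M[Z]_n) :
  P' *m block_mx 1%:M y 0 z *m P =
  block_mx (1%:M - y *m D) y (D - (D *m y + z) *m D) (D *m y + z).
Proof.
rewrite /herm_to_quad /quad_to_herm /lo scalerN !ulamVK !mulmx_block !mx01E.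
by rewrite !mulmxN.
Qed.

Lemma single_col_form i z : (single_col i z)^h *m A1 *m single_col i z =
  herm_val bar a z *: delta_mx i i :> 'M[Z]_s.
Proof.
apply/matrixP => p q; rewrite !mxE /herm_val mulr_suml.
apply: eq_bigr => l _; rewrite !mxE (bigD1 l) //= big1 ?addr0; last first.
  by move=> l' ll'; rewrite !mxE (negPf ll') mulr0.
rewrite !mxE eqxx mulr1n.
by case: eqP => _; case: eqP => _; rewrite ?(bar0 bI) ?mul0r ?mulr0 ?mulr1.
Qed.

(** The equation that defines zf is what makes the lower right blocks of [hm_lo] and [hr_up]
    skew. *)
Lemma herm_form (z : 'cV[Z]_r) zf i : zf + lam * bar zf = herm_val bar a z ->
  let al := single_col i z in let g := bar zf *: delta_mx i i : 'M[Z]_s in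
  lam *: g - al^h *m C1 *m al = - (g^h - lam *: (al^h *m C1^h *m al)).
Proof.
move=> e al g.
have gh : g^h = zf *: delta_mx i i by rewrite ctmx_delta // (barK bI).
have := single_col_form i z; rewrite -e -/al A1E mulmxDr mulmxDl scalerDl -gh -scalerA -/g.
rewrite scalemx_centralr // -scalemxAl opprB => h.
apply/eqP; rewrite subr_eq addrAC eq_sym subr_eq; apply/eqP.
by rewrite addrC [RHS]addrC h.
Qed.

(** The decomposition of the a_i supplies a solution zf for every z, so all columns are
    admissible. *)
Lemma single_col_trace (z : 'cV[Z]_r) :
  let zf := \sum_i bar (z i 0) * c 0 i * z i 0 in zf + lam * bar zf = herm_val bar a z.
Proof.
rewrite /= (bar_sum bI) mulr_sumr -big_split; apply: eq_bigr => i _ /=.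
rewrite ac mulrDr mulrDl !(barM bI) (barK bI) !mulrA; congr (_ + _ * _ * _).
exact: lC.
Qed.

Section Conjugates.
Variables (z : 'cV[Z]_r) (zf : Z) (i : 'I_s).
Hypothesis e : zf + lam * bar zf = herm_val bar a z.
Let al : 'M[Z]_(r, s) := single_col i z.
Let g : 'M[Z]_s := bar zf *: delta_mx i i.

Definition hm_a : 'M[Z]_n := block_mx 1%:M al 0 1%:M.
Definition hm_a' : 'M[Z]_n := block_mx 1%:M (- al) 0 1%:M.
Definition hm_lo : 'M[Z]_n :=
  block_mx 0 (- (C1 *m al)) (lam *: (al^h *m C1^h)) (lam *: g - al^h *m C1 *m al).
Definition hr_a : 'M[Z]_n := block_mx 1%:M 0 (lam *: (al^h *m C1^h)) 1%:M.
Definition hr_a' : 'M[Z]_n := block_mx 1%:M 0 (- (lam *: (al^h *m C1^h))) 1%:M.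
Definition hr_up : 'M[Z]_n :=
  block_mx 0 al (- (lam *: al^h)) (lam *: g - al^h *m C1 *m al).

(** Conjugation adds [C1^h al] to the block [- A1^h al], and by [A1h] this leaves a multiple of
    [C1 al], the mirror image of the opposite block. The Levi factor then splits off. *)
Lemma hm_conj : P' *m hm_mx bar a i z zf *m P = hyp hm_a hm_a' *m lo hm_lo.
Proof.
rewrite /hm_mx -/al -/g lo_lower /hyp /lo !mulmx_block !mx01E traceCh.
have -> : (hm_a')^h = block_mx 1%:M 0 (- al^h) 1%:M.
  by rewrite /hm_a' ctmx_block !ctmx1 // ctmx0 // ctmxN.
congr block_mx.
rewrite /hm_a /hm_lo scale_block_mx !mulmx_block !mx01E opp_block_mx !add_block_mx.
rewrite !subr0 !add0r !addr0 subrr !scaler0 mulmx0 add0r ulamVK mulNmx opprK.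
rewrite A1h mulmxDl opprD addNKr scalerN -scalemxAl.
congr block_mx.
by rewrite mulNmx mulmxN opprK scalemx_centralr // mulmxA scalerBr ulamVK addrCA addrN addr0.
Qed.

(** The conjugate stays block upper triangular: the correction in its lower left block vanishes
    since [traceC] is zero beyond index r. *)
Lemma hr_conj : P' *m hr_mx bar lam a i z zf *m P = up hr_up *m hyp hr_a hr_a'.
Proof.
rewrite /hr_mx -/al lo_upper -scalerA -/g /hyp /up !mulmx_block !mx01E traceCh.
have -> : (hr_a')^h = block_mx 1%:M (- (bar lam *: (C1 *m al))) 0 1%:M.
  by rewrite /hr_a' ctmx_block !ctmx1 // ctmx0 // ctmxN // ctmx_lam ctmxM // !ctmxK //.
rewrite /hr_a /hr_up !mulmx_block !mx01E (scalar_mx_block r s 1) opp_block_mx !add_block_mx.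
rewrite !subr0 !addr0 !add0r mulNmx opprK !mulmx_block !mx01E.
rewrite opp_block_mx add_block_mx subrr oppr0.
congr block_mx; [by congr block_mx; rewrite scalemxAl| | |].
- congr block_mx; rewrite mulNmx mulmxN opprK scalemx_centralr // -scalemxAl ulamVK mulmxA.
  by rewrite addrCA addrN addr0.
- by rewrite !subr0 addr0 /block_mx !row_mx0 col_mx0.
- by rewrite A1h mulmxDl opprD addNKr -scalemxAl.
Qed.

Lemma hm_loL : LamMat Lmax hm_lo.
Proof.
apply/LamMat_max; rewrite /hm_lo ctmx_block ctmx0 // ctmxN // !ctmxM // ctmx_lam ctmxM // !ctmxK //.
rewrite scale_block_mx opp_block_mx scaler0 oppr0 ulamK scalerN opprK.
congr block_mx.
rewrite [LHS](herm_form i e) (ctmxB bI) (ctmx_lam) !(ctmxM bI) (ctmxK bI).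
by rewrite scalerBr ulamK mulmxA.
Qed.

Lemma hr_upL : LamMat Lmax hr_up.
Proof.
apply/LamMat_max; rewrite /hr_up ctmx_block ctmx0 // ctmxN // ctmx_lam ctmxK //.
rewrite scale_block_mx opp_block_mx scaler0 oppr0 scalerN ulamK opprK.
congr block_mx.
rewrite [LHS](herm_form i e) (ctmxB bI) (ctmx_lam) !(ctmxM bI) (ctmxK bI).
by rewrite scalerBr ulamK mulmxA.
Qed.
End Conjugates.

Lemma trace_delta p (i : 'I_n) (j : 'I_p) y : (r <= i)%N -> D *m (y *: delta_mx i j) = 0.
Proof.
rewrite traceCh; case: (split_ordP i) => i' -> /=; first by rewrite leqNgt ltn_ord.
by rewrite delta_mx_dshift scale_col_mx scaler0 mul_block_col !mul0mx !mulmx0 !addr0 col_mx0.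
Qed.

Lemma delta_trace p (i : 'I_n) (j : 'I_p) : (r <= i)%N -> delta_mx j i *m D = 0.
Proof.
rewrite traceCh; case: (split_ordP i) => i' -> /=; first by rewrite leqNgt ltn_ord.
by rewrite delta_mx_rshift mul_row_block !mul0mx !mulmx0 !addr0 row_mx0.
Qed.

Lemma up_fixed (b : 'M[Z]_n) : D *m b = 0 -> b *m D = 0 -> P' *m up b *m P = up b.
Proof. by move=> Db bD; rewrite lo_upper Db bD add0r mul1mx subrr subr0. Qed.

Lemma lo_fixed (b : 'M[Z]_n) : P' *m lo b *m P = lo b.
Proof. by rewrite -!loD addrAC addrN add0r. Qed.

Lemma hyp_fixed (i j : 'I_n) (y : Z) : (r <= i)%N ->
  let N : 'M[Z]_n := y *: delta_mx i j in
  P' *m hyp (1%:M + N) (1%:M - N) *m P = hyp (1%:M + N) (1%:M - N).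
Proof.
move=> ri N; rewrite lo_lower /hyp addr0 ctmxB // ctmx1 // ctmx_delta //.
rewrite mulmxDr mulmx1 mulmxBl mul1mx -scalemxAl delta_trace // trace_delta //.
by rewrite scaler0 addr0 subr0 subrr.
Qed.

Hypothesis n3 : (2 < n)%N.
Let LF : form_parameter bar lam Lmax := Lambda_max_form_parameter Z.

Lemma EH_conj g : EH bar lam (s := s) a g -> Esub Lmax 1 (P' *m g *m P).
Proof.
suff H x : EH_gen bar lam a x -> Esub Lmax 1 (P' *m x *m P) by apply: (sgen_conj herm_quad_inv).
case.
- move=> i j y ri ij; rewrite -hyp_short hyp_fixed //.
  by have := hyp_elem LF 1 y n3 ij; rewrite rmorph1 expr1n mul1r.
- move=> i j y ri rj ij; rewrite -up_short up_fixed.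
  + by apply/Esub1_up/(lam_gen_LamMat LF)/lam_short.
  + by rewrite mulmxBr !trace_delta // subr0.
  + by rewrite mulmxBl -!scalemxAl !delta_trace // !scaler0 subr0.
- move=> i y ri Ly; rewrite -up_long up_fixed.
  + by apply/Esub1_up/(lam_gen_LamMat LF)/lam_long.
  + by rewrite trace_delta.
  + by rewrite -scalemxAl delta_trace // scaler0.
- move=> i j y ij; have -> : y = bar lam * (lam * y) by rewrite mulrA ulamVU mul1r.
  by rewrite -lo_short lo_fixed; apply/Esub1_lo/(lam_gen_LamMat LF)/lam_short.
- move=> i y Ly; have -> : y = bar lam * (lam * y) by rewrite mulrA ulamVU mul1r.
  rewrite -lo_long lo_fixed; apply/Esub1_lo/(lam_gen_LamMat LF)/lam_long.
  by rewrite -[lam * y]opprK -[y](barK bI) -(fp_max LF Ly); apply: (fpN LF).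
- move=> i z zf _ e; rewrite hm_conj; apply: sgen_mul; last exact/Esub1_lo/hm_loL.
  have -> : hm_a z i = 1%:M + block_mx 0 (single_col i z) 0 0.
    by rewrite (scalar_mx_block r s 1) add_block_mx !addr0 add0r.
  have -> : hm_a' z i = 1%:M - block_mx 0 (single_col i z) 0 0.
    by rewrite (scalar_mx_block r s 1) opp_block_mx add_block_mx !oppr0 !addr0 add0r.
  apply: (hyp_unip1 LF (I := [pred i : 'I_n | (i < r)%N])) => // p q.
  case: (split_ordP p) => p' ->; case: (split_ordP q) => q' ->;
    by rewrite ?block_mxEul ?block_mxEur ?block_mxEdl ?block_mxEdr ?mxE // !inE /= ltn_ord -leqNgt leq_addr.
- move=> i z zf _ e; rewrite hr_conj; apply: sgen_mul; first exact/Esub1_up/hr_upL.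
  set X := lam *: ((single_col i z)^h *m C1^h).
  have -> : hr_a z i = 1%:M + block_mx 0 0 X 0.
    by rewrite (scalar_mx_block r s 1) add_block_mx !addr0 add0r.
  have -> : hr_a' z i = 1%:M - block_mx 0 0 X 0.
    by rewrite (scalar_mx_block r s 1) opp_block_mx add_block_mx !oppr0 !addr0 add0r.
  apply: (hyp_unip1 LF (I := [pred i : 'I_n | (r <= i)%N])) => // p q.
  case: (split_ordP p) => p' ->; case: (split_ordP q) => q' ->;
    by rewrite ?block_mxEul ?block_mxEur ?block_mxEdl ?block_mxEdr ?mxE // !inE /= -ltnNge ltn_ord leq_addr.
Qed.

(** The converse inclusion is proved by checking [T] on the generators of the quadratic elementary
    group. *)
Let T (x : 'M[Z]_(n + n)) : Prop := EH bar lam (s := s) a (P *m x *m P').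

Let T_gen g x : EH_gen bar lam (s := s) a g -> P' *m g *m P = x -> T x.
Proof.
move=> gE <-; have [PP' P'P] := herm_quad_inv.
by rewrite /T !mulmxA P'P mul1mx -mulmxA P'P mulmx1; apply: sgen_base.
Qed.

Let T1 : T 1%:M.
Proof. by rewrite /T mulmx1 herm_quad_inv.2; apply: sgen_one. Qed.

Let TM x y : T x -> T y -> T (x *m y).
Proof.
have [PP' P'P] := herm_quad_inv.
move=> Tx Ty; have := sgen_mul Tx Ty.
by rewrite /T !mulmxA -(mulmxA _ P') PP' mulmx1.
Qed.

Let TV x y : T x -> mx_inverse x y -> T y.
Proof.
move=> Tx xy; apply: sgen_inv Tx _; rewrite -[X in mx_inverse _ X]mulmxA.
apply: mx_inverseM; last exact: herm_quad_inv.
by apply: mx_inverseM => //; apply/mx_inverse_sym/herm_quad_inv.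
Qed.

Let T_lo b : LamMat Lmax b -> T (lo b).
Proof.
move: b; apply: LamMat_ind => [|b c' Tb Tc|_ [i j y ij|i y Ly]].
- by rewrite lo0.
- by rewrite loD; apply: TM.
- by rewrite lo_short; apply: T_gen (h_l bar lam a (bar lam * y) ij) _; rewrite -lo_short lo_fixed.
- rewrite lo_long; apply: T_gen (@h_ld _ bar lam r s a i (bar lam * y) _) _; last by rewrite -lo_long lo_fixed.
  rewrite (barM bI) (barK bI) -lC.
  by rewrite -[X in Lmax X]opprK -(fp_max LF Ly); apply: (fpN LF).
Qed.

Let TH (i j : 'I_n) (y : Z) :=
  T (hyp (1%:M + y *: delta_mx i j) (1%:M - y *: delta_mx i j)).

(** Rows beyond r are covered by [h_eps]. For a row below r, [hm_conj] gives the Levi matrix times a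
    [lo], which [T_lo] allows to divide out. *)
Let T_hyp (i j : 'I_n) (y : Z) : i != j -> (r <= i)%N || (r <= j)%N -> TH i j y.
Proof.
move=> ij; have [ri _|ir /= rj] := leqP r i.
  apply: T_gen (h_eps bar lam a y ri ij) _.
  by rewrite -hyp_short hyp_fixed.
have ->: i = lshift s (Ordinal ir) by apply: val_inj.
have [j' ->] : exists j', j = rshift r j'.
  by case: (split_ordP j) rj => j' -> /=; [rewrite leqNgt ltn_ord|exists j'].
set p := Ordinal ir; pose z : 'cV[Z]_r := y *: delta_mx p 0.
have e := single_col_trace z; set zf := \sum_i _ in e.
have zC : herm_C bar lam a z by exists zf.
have := T_gen (h_m _ zC e) (hm_conj _ _ j').
move=> /TM /(_ (T_lo (LamMatN LF (hm_loL j' e)))).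
rewrite -mulmxA (lo_inv _).1 mulmx1.
have zE : single_col j' z = y *: delta_mx p j'.
  apply/matrixP => u v; rewrite !mxE eqxx andbT.
  by case: (v == j'); rewrite ?andbT ?andbF ?mulr0.
have dE : y *: delta_mx (lshift s p) (rshift r j') = block_mx 0 (y *: delta_mx p j') 0 0 :> 'M[Z]_n.
  by rewrite delta_mx_ushift delta_mx_rshift -(row_mx0 _ _ r s) /block_mx scale_col_mx !scale_row_mx !scaler0.
rewrite /TH dE /hm_a /hm_a' zE; congr (T (hyp _ _)).
  by rewrite (scalar_mx_block r s 1) add_block_mx !addr0 add0r.
by rewrite (scalar_mx_block r s 1) opp_block_mx add_block_mx !oppr0 !addr0 add0r.
Qed.

Let Tup b : Prop := T (up b).

Let TupD b b' : Tup b -> Tup b' -> Tup (b + b').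
Proof. by rewrite /Tup upD; apply: TM. Qed.

Let TupN b : Tup b -> Tup (- b).
Proof. by move=> Tb; apply: TV Tb (up_inv _). Qed.

Let Tup_conj (i j : 'I_n) b : i != j -> (r <= i)%N || (r <= j)%N -> Tup b ->
  Tup ((1%:M + delta_mx i j) *m b *m (1%:M + delta_mx j i)).
Proof.
move=> ij rij Tb; have H := T_hyp 1 ij rij; rewrite /TH !scale1r in H.
have dd : (delta_mx i j : 'M[Z]_n) *m delta_mx i j = 0.
  by rewrite mul_delta_mx_0 // eq_sym.
have aa' := mx_inverse_sym (mx_inverse_sq0 dd).
have dh : (delta_mx i j : 'M[Z]_n)^h = delta_mx j i.
  by rewrite -[delta_mx i j](scale1r) ctmx_delta // bar1 // scale1r.
have := hyp_up b (mx_inverse_sym aa').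
rewrite ctmxD // ctmx1 // dh /Tup => <-.
by apply: (TM (TM H Tb)); apply: TV H _; apply/hyp_inv/mx_inverse_sym.
Qed.

Let short (i j : 'I_n) (y : Z) : 'M[Z]_n := y *: delta_mx i j - (lam * bar y) *: delta_mx j i.

Let shortC i j y : short i j y = short j i (- (lam * bar y)).
Proof.
rewrite /short (barN bI) (barM bI) (barK bI) mulrN !scaleNr opprK addrC.
by rewrite -(lVC y) mulrA ulamU mul1r.
Qed.

Hypothesis s3 : (2 < s)%N.

Let ex_l (j : 'I_n) : exists2 l : 'I_n, (r <= l)%N & l != j.
Proof.
have h0 : (r < n)%N by rewrite -addn1 leq_add2l ltnW // ltnW.
have h1 : (r.+1 < n)%N by rewrite -addn2 leq_add2l ltnW.
have [e|ne] := eqVneq (j : nat) r; [exists (Ordinal h1)|exists (Ordinal h0)] => //=.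
- by rewrite -val_eqE /= e gtn_eqF.
- by rewrite -val_eqE /= eq_sym.
Qed.

(** The Hermitian generators contain short roots only beyond r. Conjugating the root (l, j) by 1 +
    e_il with l beyond r, and dividing by it, gives the root (i, j). *)
Let T_short (i j : 'I_n) y : i != j -> Tup (short i j y).
Proof.
have H0 (i' j' : 'I_n) (y' : Z) : i' != j' -> (r <= i')%N -> (r <= j')%N -> Tup (short i' j' y').
  move=> ij ri rj; rewrite /Tup up_short; apply: T_gen (h_r bar lam a y' ri rj ij) _.
  rewrite -up_short up_fixed //.
    by rewrite mulmxBr !trace_delta // subr0.
  by rewrite mulmxBl -!scalemxAl !delta_trace // !scaler0 subr0.
have H (i' j' : 'I_n) (y' : Z) (l : 'I_n) : i' != j' -> l != i' -> l != j' -> (r <= l)%N ->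
    Tup (short l j' y') -> Tup (short i' j' y').
  move=> ij li lj rl Tl; rewrite eq_sym in li.
  have := Tup_conj li _ Tl; rewrite rl orbT => /(_ isT) /TupD /(_ (TupN Tl)).
  congr Tup; apply/eqP; rewrite subr_eq; apply/eqP.
  have jl : (j' == l) = false by rewrite eq_sym (negPf lj).
  have e1 : delta_mx i' l *m short l j' y' = y' *: delta_mx i' j'.
    by rewrite /short mulmxBr -[delta_mx i' l](scale1r) !mul_scale_delta eqxx (negPf lj) mul1r subr0.
  have e2 : short l j' y' *m delta_mx l i' = - ((lam * bar y') *: delta_mx j' i').
    by rewrite /short mulmxBl -[delta_mx l i'](scale1r) !mul_scale_delta eqxx jl mulr1 sub0r.
  have e3 : (y' *: delta_mx i' j') *m delta_mx l i' = 0 :> 'M[Z]_n.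
    by rewrite -[delta_mx l i'](scale1r) mul_scale_delta jl.
  rewrite mulmxDr mulmx1 !mulmxDl !mul1mx e1 e2 e3 addr0 -addrA addrC.
  by rewrite /(short i').
have H1 (i' j' : 'I_n) (y' : Z) : i' != j' -> (r <= j')%N -> Tup (short i' j' y').
  move=> ij rj; have [ri|ir] := leqP r i'; first exact: H0.
  have [l rl lj] := ex_l j'.
  have li : l != i' by apply: contraTneq ir => <-; rewrite -leqNgt.
  by apply: (H _ _ _ l) => //; apply: H0.
move=> ij; have [ri|ir] := leqP r i.
  by rewrite shortC; apply: H1 => //; rewrite eq_sym.
have [l rl lj] := ex_l j.
have li : l != i by apply: contraTneq ir => <-; rewrite -leqNgt.
apply: (H _ _ _ l) => //; rewrite shortC; apply: H1 => //.
by rewrite eq_sym.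
Qed.

(** Conjugating y e_ll with l beyond r by 1 + e_il gives y e_ll, the short root (i, l) with entry y,
    and y e_ii; the first two are divided out. *)
Let T_long (i : 'I_n) y : Lmax y -> Tup (y *: delta_mx i i).
Proof.
move=> Ly; have H (i' : 'I_n) : (r <= i')%N -> Tup (y *: delta_mx i' i').
  move=> ri; rewrite /Tup up_long; apply: T_gen (h_rd a ri Ly) _.
  rewrite -up_long up_fixed ?trace_delta //.
  by rewrite -scalemxAl delta_trace // scaler0.
have [l rl li] := ex_l i; have il : i != l by rewrite eq_sym.
have := Tup_conj il _ (H l rl); rewrite rl orbT => /(_ isT) /TupD /(_ (TupN (H l rl))).
move=> /TupD /(_ (TupN (T_short y il))).
congr Tup; apply/eqP; rewrite subr_eq subr_eq; apply/eqP.
have e1 : delta_mx i l *m (y *: delta_mx l l) = y *: delta_mx i l :> 'M[Z]_n.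
  by rewrite -[delta_mx i l](scale1r) mul_scale_delta eqxx mul1r scale1r.
have e2 p : (y *: delta_mx p l) *m delta_mx l i = y *: delta_mx p i :> 'M[Z]_n.
  by rewrite -[delta_mx l i](scale1r) mul_scale_delta eqxx mulr1.
rewrite mulmxDr mulmx1 !mulmxDl !mul1mx e1 !e2 /short.
have yE : lam * bar y = - y by rewrite [in RHS](fp_max LF Ly) opprK.
rewrite yE scaleNr opprK [RHS]addrC -addrA; congr (_ + _).
by rewrite [RHS]addrC addrA.
Qed.

Lemma EH_Esub g : EH bar lam (s := s) a g <-> Esub Lmax 1 (P' *m g *m P).
Proof.
split; first exact: EH_conj.
have [PP' P'P] := herm_quad_inv.
suff H x : Esub Lmax 1 x -> T x.
  by move/H; rewrite /T !mulmxA P'P mul1mx -mulmxA P'P mulmx1.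
have E (b : 'M[Z]_n) : uin Z 1 ^+ 2 *: b = b by rewrite rmorph1 expr1n scale1r.
elim=> [_ [] _ [b Lb ->]||u v _ Tu _ Tv|u v _ Tu uv].
- rewrite E; move: b Lb; apply: LamMat_ind => [|b d Tb Td|_ [i j y ij|i y Ly]].
  + by rewrite up0.
  + by rewrite upD; apply: TM.
  + exact: T_short.
  + exact: T_long.
- by rewrite E; apply: T_lo.
- exact: T1.
- exact: TM.
- exact: TV uv.
Qed.

End Hermitian.

Lemma map_herm_to_quad (k : comNzRingType) (A B : uring k) (f : {rmorphism A -> B})
    r s (c : 'rV[A]_r) : uhom f ->
  map_mx f (herm_to_quad s c) = herm_to_quad s (map_mx f c).
Proof.
move=> fU; rewrite /herm_to_quad (map_lo fU) map_mxZ (map_ctmx fU).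
have [_ -> _] := fU; congr (lo (_ *: ctmx _ _)).
by rewrite /traceC map_block_mx !map_mx0 map_diag_mx.
Qed.

Lemma map_quad_to_herm (k : comNzRingType) (A B : uring k) (f : {rmorphism A -> B})
    r s (c : 'rV[A]_r) : uhom f ->
  map_mx f (quad_to_herm s c) = quad_to_herm s (map_mx f c).
Proof.
move=> fU; rewrite /quad_to_herm (map_lo fU) map_mxN map_mxZ (map_ctmx fU).
have [_ -> _] := fU; congr (lo (- (_ *: ctmx _ _))).
by rewrite /traceC map_block_mx !map_mx0 map_diag_mx.
Qed.

Section BaseRing.
Variables (k : comNzRingType) (R : algType k) (Rfin : fin_gen_module R).
Variables (bar : {linear R -> R}) (bI : involution bar) (lam : R).
Hypotheses (lC : central lam) (lU : lam * bar lam = 1).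
Variables (r s : nat) (a : 'rV[R]_r).
Hypothesis s3 : (2 < s)%N.
Hypothesis aT : forall i, herm_trace bar lam (a 0 i).

Local Notation uR := (base_uring bI lC lU).
Local Notation n := (r + s)%N.
Local Notation Lmax := (Lambda_max bar lam).
Let LF : form_parameter (@ubar k uR) (ulam uR) Lmax := Lambda_max_form_parameter uR.

Let n3 : (2 < n)%N. Proof. exact: leq_trans s3 (leq_addl _ _). Qed.

Lemma ex_trace : exists c : 'rV[R]_r, forall i, a 0 i = c 0 i + lam * bar (c 0 i).
Proof.
have [c hc] := choice aT; exists (\row_i c i) => i.
by rewrite mxE.
Qed.

Theorem EH_normal : normal_subgroup (EH bar lam (s := s) a) (GH bar lam (s := s) a).
Proof.
have [c ac] := ex_trace.
have EE g := @EH_Esub k uR r s a c ac n3 s3 g.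
have GG g := @GH_GQ k uR r s a c ac g.
have [PP' P'P] := @herm_quad_inv k uR r s c.
set P' := herm_to_quad _ _ in EE GG PP' P'P; set P := quad_to_herm _ _ in EE GG PP' P'P.
have EG g : EH bar lam (s := s) a g -> GH bar lam (s := s) a g.
  by move=> /EE/(@Esub_GQ k uR n Lmax LF 1) ?; apply/GG.
split=> // [|g g' x gG gg' /EE xE].
  by apply: sgen_subgroup => g gE; have [] := EG g (sgen_base gE).
apply/EE.
have -> : P' *m (g *m x *m g') *m P = (P' *m g *m P) *m (P' *m x *m P) *m (P' *m g' *m P).
  by rewrite !mulmxA -!(mulmxA _ P P') !P'P !mulmx1.
apply: (GQ_normalizes LF n3 (gen := false)) => //.
- exact: base_locally_reducible.
- exact/GG.
- rewrite -[X in mx_inverse _ X]mulmxA; apply: mx_inverseM => //.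
  by apply: mx_inverseM.
Qed.

Theorem EH_local_global : local_global_H bar lam s a.
Proof.
have [c ac] := ex_trace.
move=> al alG al0 alL.
pose RX := upoly uR; pose aX : 'rV[RX]_r := map_mx polyC a; pose cX : 'rV[RX]_r := map_mx polyC c.
have iU : uhom (polyC : {rmorphism uR -> RX}) := polyC_uhom uR.
have acX i : aX 0 i = cX 0 i + ulam RX * ubar (cX 0 i).
  have [ib il _] := iU.
  by rewrite !mxE ac rmorphD rmorphM il ib.
pose P' := herm_to_quad s cX; pose P := quad_to_herm s cX.
have pp : mx_inverse P' P := herm_quad_inv s cX.
have [[al' al_inv] _] := alG.
apply/(EH_Esub acX n3 s3).
have be_inv : mx_inverse (P' *m al *m P) (P' *m (al' *m P)).
  apply: mx_inverseM; last exact: mx_inverse_sym.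
  exact: mx_inverseM.
apply: (local_global_principle LF n3 (gen := false) be_inv).
  pose e0 : {rmorphism RX -> RX} := peval (polyC : {rmorphism uR -> RX}) (central_fixed0 RX).
  have e0al : map_mx e0 al = 1%:M by apply: (@psub0 k uR _ al).
  rewrite -[map_mx (psub 0) _]/(map_mx e0 _) !map_mxM e0al mulmx1 -map_mxM pp.1.
  exact: map_mx1.
move=> m.
have [/(zero_localization bI lC lU)|nz] := boolP ((1 : loc_ring m R) == 0); first by left.
right; exists (loc_uring bI lC lU nz), (loc_uhom bI lC lU nz); split.
- exact: loc_homU.
- exact: loc_hom_localization.
have locU := loc_homU bI lC lU nz.
set Rm := loc_uring bI lC lU nz in locU *; set loc := loc_uhom bI lC lU nz in locU *.
pose am : 'rV[upoly Rm]_r := map_mx polyC (map_mx loc a).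
pose cm : 'rV[upoly Rm]_r := map_mx polyC (map_mx loc c).
have acm i : am 0 i = cm 0 i + ulam (upoly Rm) * ubar (cm 0 i).
  have [ib il _] := uhom_comp locU (polyC_uhom Rm).
  pose g : {rmorphism uR -> upoly Rm} := (polyC : {rmorphism Rm -> upoly Rm}) \o loc.
  rewrite !mxE -[LHS]/(g (a 0 i)) ac (rmorphD g) (rmorphM g).
  by congr (_ + _); rewrite -[X in _ = X * _]il -ib.
have cXm : map_mx (umap loc) cX = cm.
  by apply/matrixP => i j; rewrite !mxE; apply: umapC.
have /(EH_Esub acm n3 s3) E := alL m nz.
rewrite !map_mxM (map_herm_to_quad _ _ (umap_uhom locU)) (map_quad_to_herm _ _ (umap_uhom locU)).
rewrite cXm; exact: E.
Qed.

End BaseRing.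

Theorem theorem2 (k : comNzRingType) (R : algType k)
    (Rfin : fin_gen_module R)
    (bar : {linear R -> R}) (bar_inv : involution bar)
    (lam : R) (lam_central : central lam) (lam_unitary : lam * bar lam = 1)
    (Lam : set R) (Lam_form : form_parameter bar lam Lam) :
  (forall n : nat, (3 <= n)%N ->
     (normal_subgroup (EQ bar lam Lam (n := n)) (GQ bar lam Lam (n := n))
      <-> local_global_Q bar lam Lam n))
  /\
  (forall (r s : nat) (a : 'rV[R]_r),
     (1 <= r)%N -> (3 <= s)%N ->
     (forall i, herm_trace bar lam (a 0 i)) ->
     (forall i : 'I_r, i = 0%N :> nat -> a 0 i = 0) ->
     (normal_subgroup (EH bar lam (s := s) a) (GH bar lam (s := s) a)
      <-> local_global_H bar lam s a)).
Proof.
split=> [n n3|r s a _ s3 aT _]; split=> _.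
- exact: EQ_local_global.
- exact: EQ_normal.
- exact: EH_local_global.
- exact: EH_normal.
Qed.
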